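(* Let $\mu>0$. There exists a constant $C=C(\mu)>0$ such that the following holds. Let $W\in\mathbb{R}$ (the constant $C$ is independent of $W$), let $\nu,a:\mathbb{R}\to\mathbb{R}$ be measurable with $\frac1\mu\le\nu\le\mu$ and $\frac1\mu\le a\le\mu$ a.e. in $\mathbb{R}$, and let $p,q$ be two solutions of $$\nu(x)\partial_t p-\partial_x\big(\nu(x)a(x)\partial_x p\big)+W\partial_x p=0,\qquad t>0,\ x\in\mathbb{R},$$ such that $p(0,\cdot)-q(0,\cdot)\in L^1(\mathbb{R})$. Then for all $t>0$, $$\|p(t,\cdot)-q(t,\cdot)\|_{L^\infty(\mathbb{R})}\le\frac{C}{\sqrt t}\,\|p(0,\cdot)-q(0,\cdot)\|_{L^1(\mathbb{R})}.$$
   Context: Equations with measurable coefficients are understood in the weak sense. The solution with initial datum $p_0$ is the one given by the fundamental solution, $p(t,x)=\int_{\mathbb{R}}P(t,x,y)\nu(y)p_0(y)\,dy$ (for data $p_0$ for which the integral converges absolutely), where $P(\cdot,\cdot,y)$ is the fundamental solution of the equation, with initial datum $P(0,\cdot,y)=\delta_y/\nu$. *)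

(* Defs.v *)
From HB Require Import structures.
From mathcomp Require Import all_boot all_order all_algebra.
From mathcomp Require Import all_classical all_reals all_analysis.

Set Implicit Arguments.
Unset Strict Implicit.
Unset Printing Implicit Defensive.

Import Order.TTheory GRing.Theory Num.Theory.
Import numFieldNormedType.Exports.

Local Open Scope classical_set_scope.
Local Open Scope ring_scope.

Section Definitions.
Context {R : realType}.

Local Notation leb := (@lebesgue_measure R).

(* Space-time points are pairs z = (t, x). *)
Definition leb2 := (leb \x leb)%E.

Definition upper_half : set (R * R) := [set z | 0 < z.1].

Definition partial_t (phi : R * R -> R) (z : R * R) : R :=
  derive1 (fun t : R => phi (t, z.2)) z.1.

Definition partial_x (phi : R * R -> R) (z : R * R) : R :=
  derive1 (fun x : R => phi (z.1, x)) z.2.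

(* phi is C^1 with compact support inside the open set {t > 0}. *)
Definition test_function (phi : R * R -> R) : Prop :=
  [/\ forall z : R * R, derivable (fun t : R => phi (t, z.2)) z.1 1 /\
                        derivable (fun x : R => phi (z.1, x)) z.2 1,
      continuous phi,
      continuous (partial_t phi),
      continuous (partial_x phi) &
      exists2 K : set (R * R), compact K /\ K `<=` upper_half &
        forall z, ~ K z -> phi z = 0].

(* L^2_loc((0,oo); L^2(R)): square integrability on every slab
   [s, T] x R with 0 < s. *)
Definition L2_slabs (u : R * R -> R) : Prop :=
  measurable_fun upper_half u /\
  forall s T : R, 0 < s ->
    leb2.-integrable (`[s, T]%classic `*` [set: R]) (fun z => (u z ^+ 2)%:E).

Definition weak_partial_x (u ux : R * R -> R) : Prop :=
  forall phi, test_function phi ->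
    \int[leb2]_(z in upper_half) (u z * partial_x phi z) =
    - \int[leb2]_(z in upper_half) (ux z * phi z).

(* Weak (energy) solutions, u in L^2_loc((0,oo); H^1(R)), of
     nu u_t - (nu a u_x)_x + W u_x = 0   for t > 0, x in R. *)
Definition weak_solution (W : R) (nu a : R -> R) (u : R * R -> R) : Prop :=
  exists ux : R * R -> R,
    [/\ L2_slabs u, L2_slabs ux, weak_partial_x u ux &
      forall phi, test_function phi ->
        \int[leb2]_(z in upper_half)
          (- (nu z.2 * u z * partial_t phi z)
           + nu z.2 * a z.2 * ux z * partial_x phi z
           + W * ux z * phi z) = 0].

(* The measures nu(x) u(t,x) dx are finite for t > 0 and converge weakly
   (against bounded continuous functions) to the Dirac mass at y as t -> 0+;
   this is u(0,.) = delta_y / nu. *)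
Definition initial_dirac (nu : R -> R) (y : R) (u : R * R -> R) : Prop :=
  (forall t : R, 0 < t ->
     leb.-integrable [set: R] (fun x => (nu x * u (t, x))%:E)) /\
  forall f : R -> R, continuous f -> (exists M : R, forall x, `|f x| <= M) ->
    \int[leb]_(x in [set: R]) (nu x * u (t, x) * f x) @[t --> (0:R)^'+] --> f y.

(* P t x y is the fundamental solution with pole y. A weak solution is only
   determined almost everywhere; P(.,.,y) is its continuous representative on
   t > 0 (De Giorgi-Nash), so that P(t,x,y) makes sense at every point.
   Nonnegativity, finite mass and finite energy away from t = 0 single it out
   among all the solutions with initial datum delta_y / nu. *)
Definition fundamental_solution (W : R) (nu a : R -> R) (P : R -> R -> R -> R)
    : Prop :=
  forall y : R, let u := fun z : R * R => P z.1 z.2 y in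
    [/\ {within upper_half, continuous u},
        forall z, upper_half z -> 0 <= u z,
        weak_solution W nu a u &
        initial_dirac nu y u].

(* p is the solution with initial datum p 0. *)
Definition solution_of (P : R -> R -> R -> R) (nu : R -> R) (p : R -> R -> R)
    : Prop :=
  forall t x : R, 0 < t ->
    leb.-integrable [set: R] (fun y => (P t x y * nu y * p 0 y)%:E) /\
    p t x = \int[leb]_(y in [set: R]) (P t x y * nu y * p 0 y).

End Definitions.

(* Main.v *)
(* The fundamental solution u = P(., ., y) satisfies 0 <= u <= 5 mu^2 / sqrt t,
   whatever W is; integrating this against nu (p(0) - q(0)) gives the claim.

   In one space dimension, testing the equation with chi(t) eta(x) and applying
   the du Bois-Reymond lemma in t and then in x turns it into an ODE in x for
   v(t, x) = \int_t^(t+h) u(s, x) ds: v(t, .) is absolutely continuous with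
   derivative w in L^2, and the flux nu a w agrees almost everywhere with an
   absolutely continuous function of derivative nu v_t + W w.  The energy
   computations are then rigorous for v, and the drift contributes nothing to
   d/dt \int nu v^p, since v^(p-1) v_x is an exact derivative.  Hence:
   - with D = \int nu a w^2 one has (d/dt) \int nu v^2 <= - 2 D, and
     sup v^2 <= 2 |v|_2 |w|_2 together with \int nu v^2 <= m sup v, where m is the
     mass, gives (\int nu v^2)^3 <= C m^4 D; so \int nu v^2 <= C m^2 / sqrt t;
   - at some intermediate time D is of order m^2 t^(-3/2), and there
     sup v <= C m / sqrt t;
   - every \int nu v^p is nonincreasing in time; letting p tend to infinity
     carries the bound on the supremum to all later times.
   All integrals are localized by cutoffs of width n, whose errors are O(1/n).
   The mass of u is 1, so m = h, and dividing by h and letting h tend to 0 gives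
   the bound on u. *)
Require Import Defs.
From HB Require Import structures.
From mathcomp Require Import all_boot all_order all_algebra.
From mathcomp Require Import all_classical all_reals all_analysis.
From mathcomp Require Import measurable_realfun ess_sup_inf.
From mathcomp Require Import ring lra.

Set Implicit Arguments.
Unset Strict Implicit.
Unset Printing Implicit Defensive.

Import Order.TTheory GRing.Theory Num.Theory.
Import numFieldNormedType.Exports.

Local Open Scope classical_set_scope.
Local Open Scope ring_scope.

(** * Integrals over compact intervals and rectangles *)

(** The slices [u (t, _)] of a weak solution need not have a time derivative or, at a given [t], a
    derivative in [x], so no energy identity for [u] itself is at hand. A window in time repairs
    both: [nu], [a] and [W] do not depend on time, so the average solves the same equation, and its
    time derivative is the continuous function [u (t + h, x) - u (t, x)]. The usual passage from L^2
    to L^infinity in Nash's argument is duality, which relies on the adjoint equation and on the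
    semigroup property of [P]. The definition of a fundamental solution states neither, so the
    supremum bound is carried forward in time through the L^p norms. The drift survives in the
    estimates only where it meets the derivative of a cutoff: [W] enters the O(1/n) errors and
    disappears in the limit, whence a constant uniform in [W]. The bounds on [nu] and [a] hold
    almost everywhere; clamping makes them hold at every point and alters the integrands on a null
    set only. *)

Section IntegrableR.
Context d (T : measurableType d) (R : realType).
Variable mu : {measure set T -> \bar R}.
Implicit Types (D : set T) (f g : T -> R).

Lemma aeS (P Q : T -> Prop) : (forall x, P x -> Q x) ->
  {ae mu, forall x, P x} -> {ae mu, forall x, Q x}.
Proof. by move=> PQ; apply: filterS. Qed.

Lemma aeS2 (P Q S : T -> Prop) : (forall x, P x -> Q x -> S x) ->
  {ae mu, forall x, P x} -> {ae mu, forall x, Q x} -> {ae mu, forall x, S x}.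
Proof. by move=> PQ; apply: filterS2. Qed.

Lemma itg_measurable D f : mu.-integrable D (EFin \o f) -> measurable_fun D f.
Proof. by move/(measurable_int mu)/measurable_EFinP. Qed.

Lemma itg_le D f g : measurable D -> measurable_fun D f ->
  (forall x, D x -> `|f x| <= g x) ->
  mu.-integrable D (EFin \o g) -> mu.-integrable D (EFin \o f).
Proof.
move=> mD mf fg; apply: le_integrable => //; first exact/measurable_EFinP.
by move=> x Dx /=; rewrite lee_fin (le_trans (fg _ Dx))// ler_norm.
Qed.

Lemma itgD D f g : measurable D -> mu.-integrable D (EFin \o f) ->
  mu.-integrable D (EFin \o g) -> mu.-integrable D (EFin \o (fun x => f x + g x)).
Proof. by move=> mD fi gi; exact: (integrableD mD fi gi). Qed.

Lemma itgB D f g : measurable D -> mu.-integrable D (EFin \o f) ->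
  mu.-integrable D (EFin \o g) -> mu.-integrable D (EFin \o (fun x => f x - g x)).
Proof. by move=> mD fi gi; exact: (integrableB mD fi gi). Qed.

Lemma itgZ D f k : measurable D -> mu.-integrable D (EFin \o f) ->
  mu.-integrable D (EFin \o (fun x => k * f x)).
Proof. by move=> mD fi; exact: (integrableZl mD k fi). Qed.

Lemma itg_abs D f : measurable D -> mu.-integrable D (EFin \o f) ->
  mu.-integrable D (EFin \o (fun x => `|f x|)).
Proof. by move=> mD /integrable_norm. Qed.

Lemma itg_eq D f g : measurable D -> (forall x, D x -> f x = g x) ->
  mu.-integrable D (EFin \o f) -> mu.-integrable D (EFin \o g).
Proof.
move=> mD fg; apply: eq_integrable => // x /set_mem Dx /=.
by rewrite fg.
Qed.

Lemma itg_Mbnd D f g M : measurable D -> mu.-integrable D (EFin \o f) ->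
  measurable_fun D g -> (forall x, D x -> `|g x| <= M) ->
  mu.-integrable D (EFin \o (fun x => f x * g x)).
Proof.
move=> mD fi mg gM; apply: (@itg_le _ _ (fun x => M * `|f x|)) => //.
- by apply: measurable_funM => //; exact: itg_measurable fi.
- by move=> x Dx; rewrite normrM mulrC ler_wpM2r// gM.
- exact/itgZ/itg_abs.
Qed.

Lemma ae_eq_Rintegral D f g : measurable D -> measurable_fun D f ->
  measurable_fun D g -> {ae mu, forall x, D x -> f x = g x} ->
  \int[mu]_(x in D) f x = \int[mu]_(x in D) g x.
Proof.
move=> mD mf mg fg; congr fine; apply: ae_eq_integral => //.
- exact/measurable_EFinP.
- exact/measurable_EFinP.
- by apply: filterS fg => x fg Dx; rewrite fg.
Qed.

Lemma ae_le_Rintegral D f g : measurable D -> mu.-integrable D (EFin \o f) ->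
  mu.-integrable D (EFin \o g) -> {ae mu, forall x, D x -> f x <= g x} ->
  \int[mu]_(x in D) f x <= \int[mu]_(x in D) g x.
Proof.
move=> mD fi gi fg.
have mf := itg_measurable fi; have mg := itg_measurable gi.
(* The minimum equals [f] almost everywhere and lies below [g] everywhere, so the pointwise
   comparison applies to it. *)
have -> : \int[mu]_(x in D) f x = \int[mu]_(x in D) Num.min (f x) (g x).
  apply: ae_eq_Rintegral => //; first exact: measurable_funS (measurable_minr mf mg).
  by apply: filterS fg => x fg Dx; rewrite min_l// fg.
apply: le_Rintegral => //.
- apply: (@itg_le _ _ (fun x => `|f x| + `|g x|)) => //.
  + exact: measurable_funS (measurable_minr mf mg).
  + move=> x _; have := normr_ge0 (f x); have := normr_ge0 (g x).
    by rewrite /Num.min; case: ifP => _; lra.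
  + by apply: itgD => //; exact: itg_abs.
- by move=> x _; rewrite ge_min lexx orbT.
Qed.

End IntegrableR.

Section IntervalIntegral.
Context {R : realType}.
Local Notation leb := (@lebesgue_measure R).
Implicit Types (f g : R -> R) (a b c x : R).

Definition itg a b f := leb.-integrable `[a, b] (EFin \o f).
(** Not an oriented integral: for [b < a] the interval is empty and the value is 0, hence the order
    hypotheses wherever intervals are split. *)
Definition intg a b f := \int[leb]_(x in `[a, b]) f x.

Lemma itg_sub a b c d f : a <= c -> d <= b -> itg a b f -> itg c d f.
Proof.
move=> ac db; apply: integrableS => //.
by apply: subset_itvScc; rewrite bnd_simp.
Qed.

Lemma intg_split a b c f : a <= b -> b <= c -> itg a c f ->
  intg a c f = intg a b f + intg b c f.
Proof.
move=> ab bc fi; have := @Rintegral_itvB _ f (BLeft a) (BRight c) b fi.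
rewrite !bnd_simp => /(_ ab bc) E.
rewrite /intg -(@Rintegral_itv_obnd_cbnd _ b (BRight c)); last first.
  by apply: integrableS fi => //; apply: subset_itvScc; rewrite bnd_simp.
by rewrite -E addrC subrK.
Qed.

Lemma intg_pt a f : intg a a f = 0.
Proof. by rewrite /intg set_itv1 Rintegral_set1. Qed.

Lemma itg_bounded a b f M : measurable_fun `[a, b] f ->
  (forall x, a <= x <= b -> `|f x| <= M) -> itg a b f.
Proof.
move=> mf fM; apply: measurable_bounded_integrable => //.
- by rewrite /= lebesgue_measure_itv/= lte_fin; case: ifP => _; rewrite -?EFinB ltry.
- exists M; split; first by rewrite num_real.
  by move=> y My x /=; rewrite in_itv/= => /fM /le_trans; apply; exact: ltW.
Qed.

Lemma itg_continuous a b f : {within `[a, b], continuous f} -> itg a b f.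
Proof.
by move=> cf; apply: continuous_compact_integrable => //; exact: segment_compact.
Qed.

Lemma intg_cst a b k : a <= b -> intg a b (cst k) = k * (b - a).
Proof.
move=> ab; rewrite /intg Rintegral_cst//= lebesgue_measure_itv/= lte_fin.
move: ab; rewrite le_eqVlt => /predU1P[->|->]; first by rewrite ltxx subrr.
by rewrite -EFinB.
Qed.

Lemma itg_cst a b k : itg a b (cst k).
Proof. exact: (@itg_bounded _ _ _ `|k|). Qed.

End IntervalIntegral.

Lemma integrable_fubini_G d1 d2 (T1 : measurableType d1) (T2 : measurableType d2)
    (R : realType) (m1 : {sigma_finite_measure set T1 -> \bar R})
    (m2 : {sigma_finite_measure set T2 -> \bar R}) (f : T1 * T2 -> \bar R) :
  (m1 \x m2)%E.-integrable setT f -> m2.-integrable setT (fubini_G m1 f).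
Proof.
move=> fi; have mf := measurable_int _ fi.
apply/integrableP; split; first exact: (measurable_fubini_G fi).
apply: le_lt_trans ((integrable21ltyP m1 m2 mf).1 fi).
apply: ge0_le_integral => //.
- by apply: measurableT_comp => //; exact: (measurable_fubini_G fi).
- apply: (measurable_fun_fubini_tonelli_G (abse \o f)) => //=.
  exact: measurableT_comp.
- by move=> y _; apply: le_abse_integral => //; exact: measurableT_comp.
Qed.

Section FubiniRectangle.
Context {R : realType}.
Local Notation leb := (@lebesgue_measure R).
Local Notation leb2 := (@leb2 R).

Lemma measurable_rect (s t a b : R) :
  measurable (`[s, t]%classic `*` `[a, b]%classic : set (measurableTypeR R * measurableTypeR R)%type).
Proof. exact: measurableX. Qed.

(** Fubini on the plane for the extension of [K] by zero: a section at a point of the side is the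
    extension of the section of [K], and the other sections vanish. *)
Lemma fubini_rect (s t a b : R) (K : R * R -> R) :
  leb2.-integrable (`[s, t]%classic `*` `[a, b]%classic) (EFin \o K) ->
  [/\ itg s t (fun x => intg a b (fun y => K (x, y))),
      itg a b (fun y => intg s t (fun x => K (x, y))),
      intg s t (fun x => intg a b (fun y => K (x, y))) =
        \int[leb2]_(z in `[s, t]%classic `*` `[a, b]%classic) K z,
      intg a b (fun y => intg s t (fun x => K (x, y))) =
        \int[leb2]_(z in `[s, t]%classic `*` `[a, b]%classic) K z &
      {ae leb, forall x, `[s, t]%classic x -> itg a b (fun y => K (x, y))} /\
      {ae leb, forall y, `[a, b]%classic y -> itg s t (fun x => K (x, y))}].
Proof.
move=> Ki; set D := _ `*` _ in Ki *.
have mD := measurable_rect s t a b; rewrite -/D in mD.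
pose f : measurableTypeR R * measurableTypeR R -> \bar R := (EFin \o K) \_ D.
have fi : (leb \x leb)%E.-integrable setT f.
  exact: (@integrable_mkcond _ (measurableTypeR R * measurableTypeR R)%type R
    (leb \x leb)%E D (EFin \o K) mD).1 Ki.
have fx x : `[s, t]%classic x -> (fun y => f (x, y)) = (EFin \o (fun y => K (x, y))) \_ `[a, b].
  move=> stx; apply/funext => y; rewrite /f !patchE /D /=.
  by congr (if _ then _ else _); apply/idP/idP => /set_mem h; apply/mem_set; [case: h|split].
have fy y : `[a, b]%classic y -> (fun x => f (x, y)) = (EFin \o (fun x => K (x, y))) \_ `[s, t].
  move=> aby; apply/funext => x; rewrite /f !patchE /D /=.
  by congr (if _ then _ else _); apply/idP/idP => /set_mem h; apply/mem_set; [case: h|split].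
pose F := fubini_F leb f; pose G := fubini_G leb f.
have FE x : `[s, t]%classic x -> F x = (\int[leb]_(y in `[a, b]) (K (x, y))%:E)%E.
  by move=> stx; rewrite /F /fubini_F fx// -integral_mkcond.
have GE y : `[a, b]%classic y -> G y = (\int[leb]_(x in `[s, t]) (K (x, y))%:E)%E.
  by move=> aby; rewrite /G /fubini_G fy// -integral_mkcond.
have F0 x : ~ `[s, t]%classic x -> F x = 0%E.
  move=> stx; rewrite /F /fubini_F (eq_integral (cst 0%E)) ?integral0//.
  by move=> y _; rewrite /f patchE ifF//; apply/negbTE/negP => /set_mem[].
have G0 y : ~ `[a, b]%classic y -> G y = 0%E.
  move=> aby; rewrite /G /fubini_G (eq_integral (cst 0%E)) ?integral0//.
  by move=> x _; rewrite /f patchE ifF//; apply/negbTE/negP => /set_mem[].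
have Fi : leb.-integrable setT F by exact: integrable_fubini_F.
have Gi : leb.-integrable setT G by exact: integrable_fubini_G.
(* The partial integrals are extended reals, possibly infinite on a null set. Integrability makes
   them finite almost everywhere, so [fine] changes no integral. *)
have fineP (c d : R) (H : R -> \bar R) : leb.-integrable setT H ->
    (forall x, ~ `[c, d]%classic x -> H x = 0%E) ->
    itg c d (fun x => fine (H x)) /\
    intg c d (fun x => fine (H x)) = fine (\int[leb]_x H x)%E.
  move=> Hi H0.
  have mH : measurable_fun `[c, d] (fun x => (fine (H x))%:E).
    apply/measurable_EFinP; apply: measurable_funTS.
    by apply: measurableT_comp => //; exact: (measurable_int leb).
  have Hi' : leb.-integrable `[c, d] H by exact: integrableS Hi.
  split.
    apply: le_integrable Hi' => // x _ /=.
    by case: (H x) => [r| |]//=; rewrite ?leey.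
  congr fine; rewrite [RHS](_ : _ = \int[leb]_(x in `[c, d]) H x)%E.
    have mH' : measurable_fun `[c, d] H := measurable_int _ Hi'.
    apply: ae_eq_integral => //.
    have : {ae leb, forall x, `[c, d]%classic x -> H x \is a fin_num}.
      exact: integrable_ae Hi'.
    by apply: aeS => x /[apply] /fineK.
  rewrite [RHS]integral_mkcond; apply: eq_integral => x _.
  by rewrite patchE; case: ifPn => // /negP xcd; rewrite H0// => /mem_set.
have [Fi1 FI] := fineP s t F Fi F0; have [Gi1 GI] := fineP a b G Gi G0.
have intD : (\int[leb2]_z f z)%E = (\int[leb2]_(z in D) (K z)%:E)%E.
  by rewrite [RHS]integral_mkcond.
split.
- by apply: itg_eq Fi1 => // x stx; rewrite FE.
- by apply: itg_eq Gi1 => // x stx; rewrite GE.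
- rewrite /Rintegral -intD; transitivity (fine (\int[leb]_x F x)%E); last first.
    by congr fine; exact: integral12_prod_meas1.
  by rewrite -FI; apply: eq_Rintegral => x /set_mem stx; rewrite FE.
- rewrite /Rintegral -intD; transitivity (fine (\int[leb]_x G x)%E); last first.
    by congr fine; exact: integral21_prod_meas1.
  by rewrite -GI; apply: eq_Rintegral => x /set_mem stx; rewrite GE.
split.
- have := ae_integrable1 fi; apply: aeS => x /[swap] stx.
  by rewrite fx// => h; apply: (integrable_mkcond _ _).2 h.
- have := ae_integrable2 fi; apply: aeS => y /[swap] aby.
  by rewrite fy// => h; apply: (integrable_mkcond _ _).2 h.
Qed.

Lemma fubini_rect_swap (s t a b : R) (K : R * R -> R) :
  leb2.-integrable (`[s, t]%classic `*` `[a, b]%classic) (EFin \o K) ->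
  intg s t (fun x => intg a b (fun y => K (x, y))) =
  intg a b (fun y => intg s t (fun x => K (x, y))).
Proof. by case/fubini_rect => _ _ -> ->. Qed.

End FubiniRectangle.

(** * Absolutely continuous functions *)

Section ProductIntegrable.
Context {R : realType}.
Local Notation leb := (@lebesgue_measure R).
Local Notation leb2 := (@leb2 R).
Local Notation RR := (measurableTypeR R * measurableTypeR R)%type.

Lemma itg_prod (s t a b : R) (f h : R -> R) : itg s t f -> itg a b h ->
  leb2.-integrable (`[s, t]%classic `*` `[a, b]%classic)
    (EFin \o (fun z => f z.1 * h z.2)).
Proof.
move=> fi hi.
pose f1 : measurableTypeR R -> R := f \_ `[s, t].
pose h1 : measurableTypeR R -> R := h \_ `[a, b].
have f1i : leb.-integrable setT (EFin \o f1).
  by rewrite /f1 -restrict_EFin; apply: (integrable_mkcond _ _).1 fi.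
have h1i : leb.-integrable setT (EFin \o h1).
  by rewrite /h1 -restrict_EFin; apply: (integrable_mkcond _ _).1 hi.
have mf1 : measurable_fun setT f1 := itg_measurable f1i.
have mh1 : measurable_fun setT h1 := itg_measurable h1i.
have mk : measurable_fun [set: RR] (fun z : RR => (f1 z.1 * h1 z.2)%:E).
  apply/measurable_EFinP; apply: measurable_funM.
  - exact: (measurableT_comp mf1 measurable_fst).
  - exact: (measurableT_comp mh1 measurable_snd).
have ki : (leb \x leb)%E.-integrable [set: RR] (fun z : RR => (f1 z.1 * h1 z.2)%:E).
  apply/(integrable12ltyP leb leb mk) => /=.
  have -> : (\int[leb]_x \int[leb]_y `|(f1 x * h1 y)%:E| =
      \int[leb]_x ((\int[leb]_y `|(h1 y)%:E|) * `|(f1 x)%:E|))%E.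
    apply: eq_integral => x _; rewrite muleC.
    under eq_integral do rewrite EFinM abseM.
    rewrite ge0_integralZl//; apply: measurableT_comp => //.
    exact/measurable_EFinP.
  move/integrableP : h1i => [_ h1i]; move/integrableP : f1i => [_ f1i].
  rewrite ge0_integralZl//.
  - apply: lte_mul_pinfty => //; first exact: integral_ge0.
    by rewrite ge0_fin_numE//; exact: integral_ge0.
  - by apply: measurableT_comp => //; exact/measurable_EFinP.
  - exact: integral_ge0.
have mD := measurable_rect s t a b.
have ki' : leb2.-integrable (`[s, t]%classic `*` `[a, b]%classic)
    (fun z : RR => (f1 z.1 * h1 z.2)%:E) by exact: integrableS ki.
apply: eq_integrable ki' => // z /set_mem[z1 z2].
by rewrite /f1 /h1 !patchE !mem_set.
Qed.

(** The indicator of the half-plane below the diagonal, which cuts the square into two triangles in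
    the integration by parts. *)
Lemma measurable_le_indicator :
  measurable_fun [set: RR] (fun z : RR => (z.2 <= z.1)%R%:R : R).
Proof.
have mle : measurable_fun [set: RR] (fun z : RR => z.2 <= z.1).
  apply: measurable_fun_ler.
    exact: (@measurable_snd _ _ (measurableTypeR R) (measurableTypeR R)).
  exact: (@measurable_fst _ _ (measurableTypeR R) (measurableTypeR R)).
rewrite (_ : (fun z => _) = (fun z : RR => if z.2 <= z.1 then 1 else 0)).
  exact: measurable_fun_ifT.
by apply/funext => z; case: ifP.
Qed.

End ProductIntegrable.

Section AbsolutelyContinuous.
Context {R : realType}.
Local Notation leb := (@lebesgue_measure R).
Local Notation leb2 := (@leb2 R).
Local Notation RR := (measurableTypeR R * measurableTypeR R)%type.
Implicit Types (F H f h : R -> R) (a b c x y : R).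

(** Absolute continuity with an explicit density instead of an almost everywhere derivative; the
    product rule is then a consequence of Fubini alone. *)
Definition abs_cont a b F f :=
  itg a b f /\ forall x, a <= x <= b -> F x = F a + intg a x f.

Lemma intg_trunc a x b f : a <= x <= b ->
  intg a b (fun y => f y * (y <= x)%R%:R) = intg a x f.
Proof.
move=> /andP[ax xb]; rewrite /intg Rintegral_mkcond [RHS]Rintegral_mkcond.
apply: eq_Rintegral => y _; rewrite !patchE.
have [yab|yab] := boolP (y \in `[a, b]%classic).
- move/set_mem: yab; rewrite /= in_itv/= => /andP[ay yb].
  case: ifPn => [/set_mem|/negP yax].
    by rewrite /= in_itv/= => /andP[_ ->]; rewrite mulr1.
  suff /negbTE -> : ~~ (y <= x) by rewrite mulr0.
  by apply/negP => yx; apply: yax; apply/mem_set; rewrite /= in_itv/= ay.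
- case: ifPn => // /set_mem; rewrite /= in_itv/= => /andP[ay yx].
  by case/negP: yab; apply/mem_set; rewrite /= in_itv/= ay (le_trans yx).
Qed.

Lemma itg_abs_itv a b f : itg a b f -> itg a b (fun x => `|f x|).
Proof. exact: itg_abs. Qed.

Lemma itg_ext a b f h : (forall x, a <= x <= b -> f x = h x) -> itg a b f -> itg a b h.
Proof. by move=> fh; apply: itg_eq => // x /=; rewrite in_itv; exact: fh. Qed.

Lemma itg_dom a b f h : measurable_fun `[a, b] f ->
  (forall x, a <= x <= b -> `|f x| <= h x) -> itg a b h -> itg a b f.
Proof. by move=> mf fh; apply: itg_le => // x /=; rewrite in_itv; exact: fh. Qed.

Lemma itg_itvD a b f h : itg a b f -> itg a b h -> itg a b (fun x => f x + h x).
Proof. exact: itgD. Qed.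

Lemma itg_itvB a b f h : itg a b f -> itg a b h -> itg a b (fun x => f x - h x).
Proof. exact: itgB. Qed.

Lemma itg_itvZ a b k f : itg a b f -> itg a b (fun x => k * f x).
Proof. exact: itgZ. Qed.

Lemma itg_bndM a b M f h : measurable_fun `[a, b] h ->
  (forall x, a <= x <= b -> `|h x| <= M) -> itg a b f -> itg a b (fun x => h x * f x).
Proof.
move=> mh hM fi; apply: (@itg_ext _ _ (fun x => f x * h x)).
  by move=> x _; rewrite mulrC.
by apply: (itg_Mbnd _ fi mh) => // x /=; rewrite in_itv; exact: hM.
Qed.

Lemma intg_norm a b f : itg a b f -> `|intg a b f| <= intg a b (fun x => `|f x|).
Proof. by move=> fi; exact: le_normr_Rintegral. Qed.

Lemma intg_ge0 a b f : (forall x, a <= x <= b -> 0 <= f x) -> 0 <= intg a b f.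
Proof. by move=> f0; apply: Rintegral_ge0 => x /=; rewrite in_itv; exact: f0. Qed.

Lemma intg_le a b f h : itg a b f -> itg a b h ->
  (forall x, a <= x <= b -> f x <= h x) -> intg a b f <= intg a b h.
Proof. by move=> fi hi fh; apply: le_Rintegral => // x /=; rewrite in_itv; exact: fh. Qed.

Lemma eq_intg a b f h : (forall x, a <= x <= b -> f x = h x) ->
  intg a b f = intg a b h.
Proof. by move=> fh; apply: eq_Rintegral => x /set_mem/=; rewrite in_itv; exact: fh. Qed.

Lemma intgD a b f h : itg a b f -> itg a b h ->
  intg a b (fun x => f x + h x) = intg a b f + intg a b h.
Proof. by move=> fi hi; rewrite /intg RintegralD. Qed.

Lemma intgB a b f h : itg a b f -> itg a b h ->
  intg a b (fun x => f x - h x) = intg a b f - intg a b h.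
Proof. by move=> fi hi; rewrite /intg RintegralB. Qed.

Lemma intgZ a b k f : itg a b f -> intg a b (fun x => k * f x) = k * intg a b f.
Proof. by move=> fi; rewrite /intg RintegralZl. Qed.

Lemma intgZr a b k f : itg a b f -> intg a b (fun x => f x * k) = intg a b f * k.
Proof. by move=> fi; rewrite /intg RintegralZr. Qed.

Lemma intg_sub a b c d f : a <= c -> c <= d -> d <= b -> itg a b f ->
  (forall x, a <= x <= b -> 0 <= f x) -> intg c d f <= intg a b f.
Proof.
move=> ac cd db fi f0.
have fi1 : itg a d f by exact: itg_sub fi.
rewrite (intg_split _ db fi) ?(le_trans ac)// (intg_split ac cd fi1).
have h1 : 0 <= intg a c f.
  by apply: intg_ge0 => x /andP[? ?]; apply: f0; lra.
have h2 : 0 <= intg d b f.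
  by apply: intg_ge0 => x /andP[? ?]; apply: f0; lra.
lra.
Qed.

Lemma AC_diff a b F f x y : abs_cont a b F f -> a <= x -> x <= y -> y <= b ->
  F y = F x + intg x y f.
Proof.
move=> [fi FE] ax xy yb; rewrite (FE x) ?ax ?(le_trans xy)//.
rewrite (FE y) ?yb ?(le_trans ax)// -addrA -(@intg_split _ a)//.
exact: itg_sub fi.
Qed.

Lemma AC_sub a b c d F f : abs_cont a b F f -> a <= c -> d <= b -> abs_cont c d F f.
Proof.
move=> FA ac db; split; first exact: itg_sub FA.1.
by move=> x /andP[cx xd]; apply: (AC_diff FA) => //; exact: le_trans db.
Qed.

Lemma AC_continuous a b F f : a <= b -> abs_cont a b F f -> {within `[a, b], continuous F}.
Proof.
move=> ab [fi FE].
have := parameterized_integral_continuous ab fi.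
move=> h.
have : {within `[a, b], continuous (fun x => F a + parameterized_integral lebesgue_measure a x f)}.
  by move=> x; apply: cvgD; [exact: cvg_cst|exact: h].
apply: subspace_eq_continuous => x /set_mem/=; rewrite in_itv/= => xab.
by symmetry; exact: FE.
Qed.

Lemma AC_measurable a b F f : abs_cont a b F f -> measurable_fun `[a, b] F.
Proof.
have [ab FA|ba _] := leP a b.
  apply: subspace_continuous_measurable_fun => //; exact: AC_continuous FA.
by rewrite set_itv_ge ?bnd_simp -?ltNge//; exact: measurable_fun_set0.
Qed.

Lemma AC_bounded a b F f : abs_cont a b F f ->
  exists M, forall x, a <= x <= b -> `|F x| <= M.
Proof.
move=> FA; exists (`|F a| + intg a b (fun x => `|f x|)) => x /andP[ax xb].
rewrite FA.2 ?ax// (le_trans (ler_normD _ _))// lerD2l.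
rewrite (le_trans (intg_norm _))//; first exact: itg_sub FA.1.
apply: intg_sub => //; exact: itg_abs_itv FA.1.
Qed.

Lemma AC_itg a b F f : abs_cont a b F f -> itg a b F.
Proof.
move=> FA; have [M FM] := AC_bounded FA.
exact: itg_bounded (AC_measurable FA) FM.
Qed.

Lemma AC_itgM a b F f h : abs_cont a b F f -> itg a b h -> itg a b (fun x => h x * F x).
Proof.
move=> FA hi; have [M FM] := AC_bounded FA.
exact: (itg_Mbnd _ hi (AC_measurable FA) FM).
Qed.

Lemma AC_intg a b f : a <= b -> itg a b f -> abs_cont a b (fun x => intg a x f) f.
Proof. by move=> ab fi; split => // x _; rewrite intg_pt add0r. Qed.

Lemma AC_eq a b F H f h : (forall x, a <= x <= b -> F x = H x) ->
  (forall x, a <= x <= b -> f x = h x) -> abs_cont a b F f -> abs_cont a b H h.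
Proof.
move=> FH fh [fi FE]; split.
  by apply: itg_eq fi => // x /=; rewrite in_itv; exact: fh.
move=> x xab; rewrite -!FH ?lexx//; last by case/andP: xab => ? ?; apply: le_trans; eassumption.
rewrite FE//; congr (_ + _); apply: eq_intg => y /andP[ay yx]; apply: fh.
by case/andP: xab => _ xb; rewrite ay (le_trans yx).
Qed.

(* Fubini on the two triangles of the square [a, b]^2. *)
Lemma intg_by_parts0 a b f h : a <= b -> itg a b f -> itg a b h ->
  intg a b f * intg a b h =
  intg a b (fun x => f x * intg a x h + intg a x f * h x).
Proof.
move=> ab fi hi.
pose K (z : RR) : R := f z.1 * h z.2 * (z.2 <= z.1)%R%:R.
have Ki : leb2.-integrable (`[a, b]%classic `*` `[a, b]%classic) (EFin \o K).
  apply: (itg_Mbnd (M := 1) (measurable_rect _ _ _ _) (itg_prod fi hi)).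
    by apply: measurable_funTS; exact: measurable_le_indicator.
  by move=> z _; case: (z.2 <= z.1); rewrite ?normr1 ?normr0.
have FA := AC_intg ab fi; have HA := AC_intg ab hi.
have := fubini_rect_swap Ki.
rewrite (@eq_intg _ _ _ (fun x => f x * intg a x h)); last first.
  move=> x xab; rewrite -(intg_trunc _ xab) -intgZ; last first.
    apply: (itg_Mbnd (M := 1)) => //.
      have mle : measurable_fun `[a, b] (fun y : measurableTypeR R => y <= x).
        exact: measurable_fun_ler.
      rewrite (_ : (fun z => _) = (fun z : measurableTypeR R => if z <= x then 1 else 0)).
        exact: measurable_fun_if.
      by apply/funext => z; case: ifP.
    by move=> z _; case: (z <= x); rewrite ?normr1 ?normr0.
  by apply: eq_intg => y _; rewrite /K/= mulrA.
rewrite [RHS](@eq_intg _ _ _ (fun y => h y * (intg a b f - intg a y f))); last first.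
  move=> y /andP[ay yb].
  rewrite (intg_split ay yb fi) addrAC subrr add0r.
  have fyi : itg y b f by exact: itg_sub fi.
  have -> : intg y b f = intg a b (fun x => f x * (y <= x)%R%:R).
    rewrite /intg Rintegral_mkcond [RHS]Rintegral_mkcond.
    apply: eq_Rintegral => x _; rewrite !patchE.
    have [xab|xab] := boolP (x \in `[a, b]%classic).
    - move/set_mem: xab; rewrite /= in_itv/= => /andP[ax xb].
      case: ifPn => [/set_mem|/negP xyb].
        by rewrite /= in_itv/= => /andP[-> _]; rewrite mulr1.
      suff /negbTE -> : ~~ (y <= x) by rewrite mulr0.
      by apply/negP => yx; apply: xyb; apply/mem_set; rewrite /= in_itv/= yx.
    - case: ifPn => // /set_mem; rewrite /= in_itv/= => /andP[yx xb].
      by case/negP: xab; apply/mem_set; rewrite /= in_itv/= xb (le_trans ay).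
  rewrite -intgZ; last first.
    apply: (itg_Mbnd (M := 1)) => //.
      have mle : measurable_fun `[a, b] (fun x : measurableTypeR R => y <= x).
        exact: measurable_fun_ler.
      rewrite (_ : (fun z => _) = (fun z : measurableTypeR R => if y <= z then 1 else 0)).
        exact: measurable_fun_if.
      by apply/funext => z; case: ifP.
    by move=> z _; case: (y <= z); rewrite ?normr1 ?normr0.
  by apply: eq_intg => x _; rewrite /K/= mulrA [h y * _]mulrC.
rewrite intgD; last 2 first.
- exact: AC_itgM HA fi.
- by apply: itg_eq (AC_itgM FA hi) => // x _; rewrite mulrC.
move=> ->; rewrite (@eq_intg _ _ (fun x => h x * (intg a b f - intg a x f))
  (fun x => h x * intg a b f - h x * intg a x f)); last first.
  by move=> x _; rewrite mulrBr.
rewrite intgB; last 2 first.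
- by apply: itg_eq (itgZ (intg a b f) _ hi) => // x _; rewrite mulrC.
- exact: AC_itgM FA hi.
rewrite intgZr// (@eq_intg _ _ (fun x => h x * intg a x f) (fun x => intg a x f * h x)).
  by rewrite subrK mulrC.
by move=> x _; rewrite mulrC.
Qed.

Lemma AC_M a b F H f h : abs_cont a b F f -> abs_cont a b H h ->
  abs_cont a b (fun x => F x * H x) (fun x => f x * H x + h x * F x).
Proof.
move=> FA HA; split.
  by apply: itgD => //; [exact: AC_itgM HA FA.1|exact: AC_itgM FA HA.1].
move=> x /andP[ax xb].
have {FA} FA := AC_sub FA (lexx a) xb; have {HA} HA := AC_sub HA (lexx a) xb.
(* Each factor is its value at [a] plus a primitive vanishing at [a]; the product of the two
   primitives is the case already settled in [intg_by_parts0]. *)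
rewrite (@eq_intg _ _ _ (fun y => f y * H a + h y * F a +
   (f y * intg a y h + intg a y f * h y))); last first.
  by move=> y yax; rewrite FA.2// HA.2//; ring.
have FA' := AC_intg ax FA.1; have HA' := AC_intg ax HA.1.
have i1 : itg a x (fun y => f y * H a).
  by apply: itg_eq (itgZ (H a) _ FA.1) => // y _; rewrite mulrC.
have i2 : itg a x (fun y => h y * F a).
  by apply: itg_eq (itgZ (F a) _ HA.1) => // y _; rewrite mulrC.
have i3 : itg a x (fun y => f y * intg a y h) by exact: AC_itgM HA' FA.1.
have i4 : itg a x (fun y => intg a y f * h y).
  by apply: itg_eq (AC_itgM FA' HA.1) => // y _; rewrite mulrC.
rewrite intgD; [|exact: itgD|exact: itgD].
rewrite -intg_by_parts0//; [|exact: FA.1|exact: HA.1].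
rewrite intgD// !intgZr; [|exact: HA.1|exact: FA.1].
by rewrite (FA.2 x) ?ax ?lexx// (HA.2 x) ?ax ?lexx//; ring.
Qed.

Lemma AC_X a b F f n : abs_cont a b F f ->
  abs_cont a b (fun x => F x ^+ n.+1) (fun x => n.+1%:R * (F x ^+ n * f x)).
Proof.
move=> FA; elim: n => [|n IH].
  by apply: AC_eq FA => x _; rewrite ?expr1// mul1r expr0 mul1r.
have := AC_M IH FA; apply: AC_eq => x _; first by rewrite -exprSr.
rewrite -[n.+2%:R]natr1 exprS; ring.
Qed.

Lemma is_derive_continuous F f : (forall x, is_derive x 1 F (f x)) -> continuous F.
Proof.
move=> dF x; apply: differentiable_continuous; apply/derivable1_diffP.
exact: (@ex_derive _ _ _ _ _ _ _ (dF x)).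
Qed.

Lemma AC_derivable a b F f : (forall x, is_derive x 1 F (f x)) -> continuous f ->
  abs_cont a b F f.
Proof.
move=> dF cf; split.
  by apply: itg_continuous; exact: continuous_subspaceT.
move=> x /andP[]; rewrite le_eqVlt => /predU1P[->|ax xb].
  by rewrite intg_pt addr0.
have cF := is_derive_continuous dF.
rewrite /intg /Rintegral (@continuous_FTC2 _ f F)//=; first
  by rewrite -?EFinB /= addrCA subrr addr0.
- exact: continuous_subspaceT.
- split => [y _| |].
  + exact: (@ex_derive _ _ _ _ _ _ _ (dF y)).
  + exact/cvg_at_right_filter/cF.
  + exact/cvg_at_left_filter/cF.
- by move=> y _; rewrite derive1E; exact: (@derive_val _ _ _ _ _ _ _ (dF y)).
Qed.

End AbsolutelyContinuous.

(** * Cutoffs and the du Bois-Reymond lemma *)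

Section SmoothStep.
Context {R : realType}.
Implicit Types (x y z e : R).

Definition pospart z : R := Num.max z 0.

Lemma pospart_ge z : 0 <= z -> pospart z = z.
Proof. by move=> z0; rewrite /pospart max_l. Qed.

Lemma pospart_le z : z <= 0 -> pospart z = 0.
Proof. by move=> z0; rewrite /pospart max_r. Qed.

Lemma continuous_pospart : continuous pospart.
Proof.
by move=> z; apply: (@continuous_max _ _ (fun x : R => x) (cst 0) z);
  [exact: cvg_id|exact: cvg_cst].
Qed.

Lemma is_derive_pospart2 z : is_derive z 1 (fun x => pospart x ^+ 2) (2 * pospart z).
Proof.
have [z0|z0|->] := ltgtP z 0.
- apply: (@near_eq_is_derive _ _ _ (cst 0)); last first.
    rewrite pospart_le ?mulr0 ?ltW//; exact: is_derive_cst.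
  near=> x; rewrite /= pospart_le ?expr0n//.
  by apply: ltW; near: x; exact: lt_nbhsl.
- apply: (@near_eq_is_derive _ _ _ (fun x => x ^+ 2)); last first.
    by rewrite pospart_ge ?ltW//; apply: is_derive_eq; rewrite /GRing.scale/=; ring.
  near=> x; rewrite /= pospart_ge//.
  by apply: ltW; near: x; exact: lt_nbhsr.
(* At the kink, [pospart x ^+ 2 = pospart x * x], so [pospart] itself is a continuous slope
   function, with value 0 at the origin. *)
- apply/is_derive1_caratheodory; exists pospart; split.
  + move=> x; rewrite (pospart_le (lexx 0)) expr0n subr0 /= subr0.
    have [x0|x0] := leP 0 x; first by rewrite pospart_ge.
    by rewrite pospart_le ?ltW// mul0r expr0n.
  + exact: continuous_pospart.
  + by rewrite pospart_le// mulr0.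
Unshelve. all: by end_near. Qed.

(** The second difference of the positive part: the triangular hat on [-e, e] with height 1/e and
    integral 1. *)
Definition tent e z : R :=
  (pospart (z + e) - 2 * pospart z + pospart (z - e)) / e ^+ 2.

(** The same second difference of half the squared positive part, hence a primitive of [tent]: a C^1
    transition from 0 to 1 across [-e, e]. *)
Definition step e z : R :=
  (pospart (z + e) ^+ 2 - 2 * pospart z ^+ 2 + pospart (z - e) ^+ 2) / (2 * e ^+ 2).

Lemma is_derive_step e z : e != 0 -> is_derive z 1 (step e) (tent e z).
Proof.
move=> e0; rewrite /step /tent.
have h c : is_derive z 1 (fun x => pospart (x + c) ^+ 2) (2 * pospart (z + c)).
  have := @is_derive1_comp _ (fun x => pospart x ^+ 2) (shift c) z _ _
    (is_derive_pospart2 (z + c)) (is_derive_shift z 1 c).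
  by rewrite mulr1.
have h1 := h e; have h2 := h (- e); have h3 := is_derive_pospart2 z.
apply: is_derive_eq; rewrite /GRing.scale/=.
by field.
Qed.

Lemma continuous_tent e : continuous (tent e).
Proof.
move=> z; apply: cvgM; last exact: cvg_cst.
have h c : pospart (x + c) @[x --> z] --> pospart (z + c).
  apply: (@continuous_comp _ _ _ (shift c) pospart); last exact: continuous_pospart.
  by apply: cvgD; [exact: cvg_id|exact: cvg_cst].
apply: cvgD; last exact: h.
apply: cvgB; first exact: h.
by apply: cvgM; [exact: cvg_cst|exact: continuous_pospart].
Qed.

Ltac pospart_cases :=
  repeat match goal with |- context [pospart ?t] =>
    let H := fresh in
    have [H|H] := leP 0 t; [rewrite (pospart_ge H)|rewrite (pospart_le (ltW H))] end.

Lemma tent_ge0 e z : 0 < e -> 0 <= tent e z.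
Proof. by move=> e0; rewrite /tent divr_ge0 ?sqr_ge0//; pospart_cases; lra. Qed.

Lemma tent_le e z : 0 < e -> tent e z <= e^-1.
Proof.
move=> e0; rewrite /tent ler_pdivrMr ?exprn_gt0// expr2 mulKf ?gt_eqF//.
by pospart_cases; lra.
Qed.

Lemma tent_out e z : 0 < e -> e <= `|z| -> tent e z = 0.
Proof.
move=> e0; rewrite ler_normr => /orP ez; rewrite /tent.
suff -> : pospart (z + e) - 2 * pospart z + pospart (z - e) = 0 by rewrite mul0r.
by pospart_cases; case: ez => ez; lra.
Qed.

Lemma step_left e z : 0 < e -> z <= - e -> step e z = 0.
Proof.
by move=> e0 ze; rewrite /step !pospart_le ?expr0n ?mulr0 ?subr0 ?addr0 ?mul0r//; lra.
Qed.

Lemma step_right e z : 0 < e -> e <= z -> step e z = 1.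
Proof.
by move=> e0 ze; rewrite /step !pospart_ge; [field; rewrite gt_eqF|lra..].
Qed.

Lemma step_ge0 e z : 0 < e -> 0 <= step e z.
Proof.
move=> e0; apply: divr_ge0; last by rewrite mulr_ge0 ?sqr_ge0.
by pospart_cases; nra.
Qed.

Lemma step_le1 e z : 0 < e -> step e z <= 1.
Proof.
move=> e0; rewrite /step ler_pdivrMr ?mulr_gt0 ?exprn_gt0// mul1r.
by pospart_cases; nra.
Qed.

(** The derivative is carried along as a function, and both functions vanish at [a] and [b]
    themselves, so that integration by parts leaves no boundary term. *)
Definition C1c (a b : R) (chi dchi : R -> R) :=
  [/\ forall z, is_derive z 1 chi (dchi z), continuous dchi,
      forall z, ~~ (a < z < b) -> chi z = 0 &
      forall z, ~~ (a < z < b) -> dchi z = 0].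

(** An admissible test function whose derivative approximates the Dirac mass at [x] minus the one at
    [y]; it serves to compare two values of a function. *)
Definition plateau e x y z : R := step e (z - x) - step e (z - y).
Definition dplateau e x y z : R := tent e (z - x) - tent e (z - y).

Lemma C1c_plateau a b e x y : 0 < e -> x <= y -> a <= x - e -> y + e <= b ->
  C1c a b (plateau e x y) (dplateau e x y).
Proof.
move=> e0 xy ax yb; split.
- move=> z; rewrite /plateau /dplateau.
  have h c : is_derive z 1 (fun t => step e (t - c)) (tent e (z - c)).
    have := @is_derive1_comp _ (step e) (shift (- c)) z _ _
      (is_derive_step (z - c) _) (is_derive_shift z 1 (- c)).
    by rewrite mulr1; apply; rewrite gt_eqF.
  exact: is_deriveB.
- have h c : continuous (fun t => tent e (t - c)).
    move=> z; apply: (@continuous_comp _ _ _ (shift (- c)) (tent e)); last exact: continuous_tent.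
    by apply: cvgB; [exact: cvg_id|exact: cvg_cst].
  by move=> z; apply: cvgB; exact: h.
- move=> z; rewrite negb_and -!leNgt => /orP[] h; rewrite /plateau.
    by rewrite !step_left ?subrr//; lra.
  by rewrite !step_right ?subrr//; lra.
- move=> z; rewrite negb_and -!leNgt => /orP[] h; rewrite /dplateau.
    by rewrite !tent_out ?subrr// ler_normr; apply/orP; right; lra.
  by rewrite !tent_out ?subrr// ler_normr; apply/orP; left; lra.
Qed.

(** The transitions have half-width [n] and centres [-2n] and [2n]: value 1 on [-n, n], support in
    [-3n, 3n], slope at most 1/n. *)
Definition cutoff (n z : R) := plateau n (- (2 * n)) (2 * n) z.
Definition dcutoff (n z : R) := dplateau n (- (2 * n)) (2 * n) z.

Lemma C1c_cutoff n : 0 < n -> C1c (- (3 * n)) (3 * n) (cutoff n) (dcutoff n).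
Proof. by move=> n0; apply: C1c_plateau => //; lra. Qed.

Lemma cutoff_ge0 n z : 0 < n -> 0 <= cutoff n z.
Proof.
move=> n0; rewrite /cutoff /plateau subr_ge0; have [h|h] := leP (- n) z.
  by rewrite [leRHS]step_right ?step_le1//; lra.
by rewrite step_left ?step_ge0//; lra.
Qed.

Lemma cutoff_le1 n z : 0 < n -> cutoff n z <= 1.
Proof.
move=> n0; rewrite /cutoff /plateau.
have := step_le1 (z - - (2 * n)) n0; have := step_ge0 (z - 2 * n) n0; lra.
Qed.

Lemma cutoff_eq1 n z : 0 < n -> `|z| <= n -> cutoff n z = 1.
Proof.
move=> n0; rewrite ler_norml => /andP[h1 h2]; rewrite /cutoff /plateau.
by rewrite step_right ?step_left ?subr0//; lra.
Qed.

Lemma dcutoff_le n z : 0 < n -> `|dcutoff n z| <= n^-1.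
Proof.
move=> n0; rewrite /dcutoff /dplateau.
have := tent_ge0 (z - - (2 * n)) n0; have := tent_le (z - - (2 * n)) n0.
have := tent_ge0 (z - 2 * n) n0; have := tent_le (z - 2 * n) n0.
by rewrite ler_norml; lra.
Qed.

End SmoothStep.

(** * The du Bois-Reymond lemma by comparison of Lebesgue points *)

Section DuBoisReymond.
Context {R : realType}.
Local Notation leb := (@lebesgue_measure R).
Implicit Types (a b x y e : R) (f m n : R -> R).

Lemma ae_exists (P : R -> Prop) a b : a < b ->
  {ae leb, forall x, P x} -> exists2 x, a < x < b & P x.
Proof.
move=> ab aeP; apply: contrapT => nP.
have : leb.-negligible `]a, b[%classic.
  apply: negligibleS aeP => x /=; rewrite in_itv/= => axb Px.
  by apply: nP; exists x.
move=> /negligibleP => /(_ (measurable_itv _)).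
rewrite /= lebesgue_measure_itv/= lte_fin ab -EFinB => -[] /eqP.
by rewrite subr_eq0 gt_eqF.
Qed.

Lemma ae_neq x : {ae leb, forall y, y != x}.
Proof.
have x0 : leb.-negligible [set x].
  by apply/negligibleP => //; exact: lebesgue_measure_set1.
suff : leb.-negligible (~` [set y | y != x]) by [].
by apply: negligibleS x0 => y /= /negP; rewrite negbK => /eqP.
Qed.

Lemma continuous_itv_bounded a b f : a <= b -> continuous f ->
  exists M, forall x, a <= x <= b -> `|f x| <= M.
Proof.
move=> ab cf.
have cf' : {within `[a, b], continuous f} by exact: continuous_subspaceT.
have [c _ cM] := EVT_max ab cf'; have [c' _ cm] := EVT_min ab cf'.
exists (`|f c| + `|f c'|) => x xab.
have := cM x; rewrite in_itv/= => /(_ xab) h1.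
have := cm x; rewrite in_itv/= => /(_ xab) h2.
have := ler_norm (f c); have := ler_norm (- f c'); rewrite normrN => h3 h4.
have := normr_ge0 (f c); have := normr_ge0 (f c').
by rewrite ler_norml; lra.
Qed.

Lemma tent_C1 a b x e : 0 < e -> a <= x - e -> x + e <= b ->
  intg a b (fun y => tent e (y - x)) = 1.
Proof.
move=> e0 ax xb; have ab : a <= b by lra.
have h : abs_cont a b (fun y => step e (y - x)) (fun y => tent e (y - x)).
  apply: AC_derivable.
  - move=> z; have := @is_derive1_comp _ (step e) (shift (- x)) z _ _
      (is_derive_step (z - x) _) (is_derive_shift z 1 (- x)).
    by rewrite mulr1; apply; rewrite gt_eqF.
  - move=> z; apply: (@continuous_comp _ _ _ (shift (- x)) (tent e)); last exact: continuous_tent.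
    by apply: cvgB; [exact: cvg_id|exact: cvg_cst].
have := h.2 b; rewrite ab lexx => /(_ isT).
by rewrite step_right ?step_left ?add0r; lra.
Qed.

Lemma measurable_tent a b x e : measurable_fun `[a, b] (fun y => tent e (y - x)).
Proof.
apply: measurable_funTS; apply: continuous_measurable_fun => z.
apply: (@continuous_comp _ _ _ (shift (- x)) (tent e)); last exact: continuous_tent.
by apply: cvgB; [exact: cvg_id|exact: cvg_cst].
Qed.

Lemma itg_tent a b f x e : 0 < e -> itg a b f ->
  itg a b (fun y => f y * tent e (y - x)).
Proof.
move=> e0 fi; apply: (itg_Mbnd (M := e^-1) _ fi) => //; first exact: measurable_tent.
by move=> y _; rewrite ger0_norm ?tent_ge0// tent_le.
Qed.

Lemma tent_average a b f x : itg a b f -> a < x < b ->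
  lebesgue_pt (f \_ `[a, b]) x ->
  forall d, 0 < d -> \forall e \near 0^'+,
    `|intg a b (fun y => f y * tent e (y - x)) - f x| <= d.
Proof.
move=> fi /andP[ax xb] + d d0; set g := f \_ _ => gx.
have gxE : g x = f x by rewrite /g patchE mem_set//= in_itv/= !ltW.
have d20 : 0 < d / 2 by rewrite divr_gt0.
move/fine_cvgP : gx => [gfin /cvgrPdist_le/(_ _ d20) gd].
near=> e.
have e0 : 0 < e by near: e; exact: nbhs_right_gt.
have aex : a <= x - e.
  have : e < x - a by near: e; apply: nbhs_right_lt; rewrite subr_gt0.
  lra.
have exb : x + e <= b.
  have : e < b - x by near: e; apply: nbhs_right_lt; rewrite subr_gt0.
  lra.
have ab : a <= b by lra.
have ti := itg_tent x e0 fi.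
have t1 : itg a b (fun y => tent e (y - x)).
  apply: (itg_bounded (M := e^-1)); first exact: measurable_tent.
  by move=> y _; rewrite ger0_norm ?tent_ge0// tent_le.
have fci : itg a b (fun y => f y - f x).
  by apply: itgB => //; exact: itg_cst.
have -> : intg a b (fun y => f y * tent e (y - x)) - f x =
    intg a b (fun y => (f y - f x) * tent e (y - x)).
  rewrite (@eq_intg _ _ _ (fun y => (f y - f x) * tent e (y - x))
    (fun y => f y * tent e (y - x) - f x * tent e (y - x))); last first.
    by move=> y _; rewrite mulrBl.
  by rewrite intgB ?intgZ ?tent_C1 ?mulr1//; exact: itgZ.
have mball : measurable (ball x e : set R) by exact: measurable_ball.
have ballab : ball x e `<=` `[a, b]%classic.
  move=> y; rewrite ball_itv/= !in_itv/= => /andP[? ?]; apply/andP; split; lra.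
have fcib : leb.-integrable (ball x e) (EFin \o (fun y => `|f y - f x|)).
  by apply: integrableS (itg_abs _ fci) => //.
apply: (@le_trans _ _ (e^-1 * \int[leb]_(y in ball x e) `|f y - f x|)).
  apply: le_trans (intg_norm (itg_tent x e0 fci)) _.
  pose h y := e^-1 * `|f y - f x|.
  have hi : leb.-integrable (ball x e) (EFin \o h) by exact: itgZ.
  have -> : e^-1 * \int[leb]_(y in ball x e) `|f y - f x| = intg a b (h \_ (ball x e)).
    by rewrite -RintegralZl// /intg -Rintegral_mkcondr setIidr.
  apply: intg_le.
  - exact: itg_abs_itv (itg_tent x e0 fci).
  - rewrite /itg -restrict_EFin; apply/(integrable_restrict _ _) => //.
    by rewrite setIidr.
  - move=> y _; rewrite patchE; case: ifPn => [yb|yb].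
      rewrite normrM mulrC ler_wpM2r// ger0_norm ?tent_ge0//; exact: tent_le.
    rewrite tent_out ?mulr0 ?normr0//.
    move: yb => /negP yb; rewrite leNgt; apply/negP => ye; apply: yb; apply/mem_set.
    by rewrite /ball/= distrC.
have : `|fine (davg g x e)| <= d / 2.
  near: e; move: gd; apply: filterS => e /=; by rewrite sub0r normrN.
have -> : davg g x e = ((2 * e)^-1 * \int[leb]_(y in ball x e) `|f y - f x|)%:E.
  rewrite /davg /iavg lebesgue_measure_ball ?ltW// inver mulrn_eq0/= gt_eqF//.
  rewrite EFinM fineK; last first.
    by apply: integrable_fin_num => //.
  congr (_ * _)%E; first by rewrite mulr_natl.
  apply: eq_integral => y /set_mem yb; rewrite /= gxE.
  by rewrite /g patchE mem_set// ; exact: ballab.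
set I := Rintegral _ _ _ => h.
have I0 : 0 <= I by apply: Rintegral_ge0.
move: h; rewrite /= ger0_norm; last by rewrite mulr_ge0// invr_ge0 mulr_ge0// ltW.
by rewrite invfM -mulrA; lra.
Unshelve. all: by end_near. Qed.

(** Integrating [n chi] by parts replaces [m] by [f], the difference of [m] and a primitive of [n],
    whose integral against every [dchi] is 0; it remains to see that [f] is constant on its Lebesgue
    points. *)
Lemma du_bois_reymond a b m n : a < b -> itg a b m -> itg a b n ->
  (forall chi dchi, C1c a b chi dchi ->
    intg a b (fun x => m x * dchi x + n x * chi x) = 0) ->
  exists K, {ae leb, forall x, a <= x <= b -> m x = K + intg a x n}.
Proof.
move=> ab mi ni mn0; have leab := ltW ab.
have NA := AC_intg leab ni; set N := (fun x => intg a x n) in NA.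
pose f x := m x - N x.
have fi : itg a b f by apply: itgB => //; exact: AC_itg NA.
have f0 chi dchi : C1c a b chi dchi -> intg a b (fun x => f x * dchi x) = 0.
  move=> Cchi; have [dchiP cdchi chi0 dchi0] := Cchi.
  have chiA : abs_cont a b chi dchi by exact: AC_derivable.
  have := (AC_M NA chiA).2 b; rewrite leab lexx => /(_ isT).
  rewrite !chi0 ?mulr0 ?add0r ?ltxx ?andbF// => /esym nchi.
  have i1 : itg a b (fun x => n x * chi x) by exact: AC_itgM chiA ni.
  have i2 : itg a b (fun x => dchi x * N x) by exact: AC_itgM NA chiA.1.
  have [M dchiM] := continuous_itv_bounded leab cdchi.
  have i3 : itg a b (fun x => m x * dchi x).
    exact: (itg_Mbnd _ mi (itg_measurable chiA.1) dchiM).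
  have := mn0 _ _ Cchi; rewrite (intgD i3 i1) => h.
  have -> : intg a b (fun x => f x * dchi x) =
     intg a b (fun x => m x * dchi x - dchi x * N x).
    by apply: eq_intg => x _; rewrite /f mulrBl [N x * _]mulrC.
  by rewrite (intgB i3 i2); move: nchi; rewrite intgD//; lra.
have lp : {ae leb, forall x, lebesgue_pt (f \_ `[a, b]) x}.
  by apply: lebesgue_differentiation; exact: integrable_locally.
(* Tested with a plateau between [x] and [y], the hypothesis says that the hat averages of [f] at
   the two points coincide for every small width. *)
have key x y : a < x < b -> a < y < b -> lebesgue_pt (f \_ `[a, b]) x ->
    lebesgue_pt (f \_ `[a, b]) y -> x <= y -> f x = f y.
  move=> xab yab lx ly xy; apply/eqP; rewrite -subr_eq0 -normr_le0.
  apply/ler_addgt0Pl => d d0; rewrite addr0.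
  have d20 : 0 < d / 2 by rewrite divr_gt0.
  have hx := tent_average fi xab lx d20; have hy := tent_average fi yab ly d20.
  near (0:R)^'+ => e.
  have e0 : 0 < e by near: e; exact: nbhs_right_gt.
  have aex : e <= x - a.
    by near: e; apply: nbhs_right_le; case/andP: xab; rewrite subr_gt0.
  have eyb : e <= b - y.
    by near: e; apply: nbhs_right_le; case/andP: yab; rewrite subr_gt0.
  have bmp : C1c a b (plateau e x y) (dplateau e x y) by apply: C1c_plateau => //; lra.
  have := f0 _ _ bmp.
  rewrite (@eq_intg _ _ _ (fun z => f z * dplateau e x y z)
    (fun z => f z * tent e (z - x) - f z * tent e (z - y))); last first.
    by move=> z _; rewrite /dplateau mulrBr.
  rewrite intgB; [|exact: itg_tent|exact: itg_tent].
  have : `|intg a b (fun z => f z * tent e (z - x)) - f x| <= d / 2 by near: e.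
  have : `|intg a b (fun z => f z * tent e (z - y)) - f y| <= d / 2 by near: e.
  by rewrite !ler_norml; lra.
have [x0 x0ab lx0] := ae_exists ab lp.
exists (f x0).
have h : {ae leb, forall x, x != a /\ x != b}.
  by apply: aeS2 (ae_neq a) (ae_neq b) => x xa xb; split.
apply: aeS2 h lp => x [xa xb] lx /andP[ax' xb'].
have xab : a < x < b by rewrite lt_neqAle eq_sym xa ax' lt_neqAle xb.
suff : f x0 = f x by rewrite /f => ->; rewrite subrK.
by case: (leP x0 x) => [|/ltW] h; [exact: key|apply/esym/key].
Unshelve. all: by end_near. Qed.

Lemma within_continuous_dist a b f x e : {within `[a, b], continuous f} ->
  a <= x <= b -> 0 < e ->
  exists2 r, 0 < r & forall y, a <= y <= b -> `|x - y| < r -> `|f x - f y| < e.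
Proof.
move=> cf xab e0.
have xab' : `[a, b]%classic x by rewrite /= in_itv.
have := cf x; rewrite /continuous_at => /cvgrPdist_lt/(_ _ e0).
rewrite /nbhs/= /nbhs_subspace; case: ifPn => [_|]; last by rewrite mem_set.
rewrite /within/= => -[r /= r0 rP]; exists r => // y yab xy.
by apply: rP => //; rewrite in_itv.
Qed.

Lemma ae_eq_continuous a b f K : a < b -> {within `[a, b], continuous f} ->
  {ae leb, forall x, a <= x <= b -> f x = K} -> forall x, a <= x <= b -> f x = K.
Proof.
move=> ab cf fK x xab; apply/eqP; rewrite -subr_eq0 -normr_le0.
apply/ler_addgt0Pl => d d0; rewrite addr0.
have [r r0 rP] := within_continuous_dist cf xab d0.
have [y yab yK] : exists2 y, Num.max a (x - r) < y < Num.min b (x + r) &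
    (a <= y <= b -> f y = K).
  apply: ae_exists fK; case/andP: xab => ax xb.
  by rewrite gt_max !lt_min ab; apply/andP; split; apply/andP; split; lra.
move: yab; rewrite gt_max lt_min => /andP[/andP[ay yr1] /andP[yb yr2]].
have yab : a <= y <= b by rewrite !ltW.
rewrite -(yK yab); apply: ltW; apply: rP => //.
by rewrite ltr_norml; lra.
Qed.

Lemma du_bois_reymond_continuous a b m n : a < b ->
  {within `[a, b], continuous m} -> itg a b n ->
  (forall chi dchi, C1c a b chi dchi ->
    intg a b (fun x => m x * dchi x + n x * chi x) = 0) ->
  abs_cont a b m n.
Proof.
move=> ab cm ni mn0; split => // x xab.
have [K mK] := du_bois_reymond ab (itg_continuous cm) ni mn0.
have NA := AC_intg (ltW ab) ni.
have h : forall x, a <= x <= b -> m x - intg a x n = K.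
  apply: ae_eq_continuous => //.
    have cN := AC_continuous (ltW ab) NA.
    by move=> z; apply: cvgB; [exact: cm|exact: cN].
  by apply: aeS mK => y /[apply] ->; rewrite addrK.
have := h _ xab; have := h a; rewrite lexx (ltW ab) => /(_ isT).
by rewrite intg_pt subr0 => -> /eqP; rewrite subr_eq => /eqP.
Qed.

End DuBoisReymond.

(** * Nash's inequality and the decay of the maximum *)

Section Decay.
Context {R : realType}.
Local Notation leb := (@lebesgue_measure R).
Implicit Types (a b s t x lam : R).

(** The one-dimensional Sobolev inequality: [z ^+ 2] is the integral of [2 z z'], split by Young's
    inequality. The weight [lam] stays free, since different uses optimize it differently. *)
Lemma sqr_sup_le a b (z z' : R -> R) lam : 0 < lam -> abs_cont a b z z' -> z a = 0 ->
  itg a b (fun x => z' x ^+ 2) ->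
  forall x, a <= x <= b ->
    z x ^+ 2 <= lam * intg a b (fun x => z x ^+ 2) + lam^-1 * intg a b (fun x => z' x ^+ 2).
Proof.
move=> lam0 zA za z'i x xab; have /andP[ax xb] := xab.
have z2A := AC_X 1 zA.
have z2i : itg a b (fun x => z x ^+ 2) by exact: AC_itg z2A.
have i1 : itg a b (fun x => lam * z x ^+ 2) by exact: itgZ.
have i2 : itg a b (fun x => lam^-1 * z' x ^+ 2) by exact: itgZ.
have i3 : itg a b (fun x => lam * z x ^+ 2 + lam^-1 * z' x ^+ 2) by exact: itgD.
rewrite (z2A.2 x xab) za expr0n add0r -!intgZ// -intgD//.
apply: (@le_trans _ _ (intg a x (fun x => lam * z x ^+ 2 + lam^-1 * z' x ^+ 2))).
  apply: intg_le; [exact: itg_sub z2A.1|exact: itg_sub i3|] => y _.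
  rewrite expr1.
  have -> : 2 * (z y * z' y) = lam * z y ^+ 2 + lam^-1 * z' y ^+ 2 -
      lam * (z y - lam^-1 * z' y) ^+ 2 by field; rewrite gt_eqF.
  by rewrite gerBl mulr_ge0 ?sqr_ge0 ?ltW.
apply: intg_sub => // y _.
by rewrite addr_ge0// mulr_ge0 ?sqr_ge0 ?invr_ge0 ?ltW.
Qed.

(* If f(r) >= 2 f(t) at the midpoint r of [s, t], halve the number of doublings
   left between s and r; otherwise the inequality between r and t suffices. *)
Lemma cubic_decay (f : R -> R) (kap : R) : 0 < kap -> (forall t, 0 < t -> 0 <= f t) ->
  (forall s t, 0 < s -> s < t -> f t + (t - s) * (kap * f t ^+ 3) <= f s) ->
  forall s t, 0 < s -> s < t -> (t - s) * f t ^+ 2 <= 4 / kap.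
Proof.
move=> kap0 f0 fd.
have main k : forall s t, 0 < s -> s < t -> f s <= 2 ^+ k * f t ->
    (t - s) * f t ^+ 2 <= 4 / kap.
  elim: k => [|k IH] s t s0 st fst.
    rewrite expr0 mul1r in fst; have h := fd _ _ s0 st.
    have t0 := lt_trans s0 st.
    have ft3 : f t = 0.
      apply/eqP; rewrite -[_ == _](expf_eq0 _ 3) eq_le.
      rewrite exprn_ge0 ?f0// andbT.
      have : (t - s) * (kap * f t ^+ 3) <= 0 by lra.
      by rewrite pmulr_rle0 ?subr_gt0// pmulr_rle0.
    by rewrite ft3 expr0n mulr0 divr_ge0// ltW.
  pose r := (s + t) / 2.
  have sr : s < r by rewrite /r; lra.
  have rt : r < t by rewrite /r; lra.
  have r0 := lt_trans s0 sr; have t0 := lt_trans s0 st.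
  have ft0 := f0 t t0.
  have [h|h] := leP (2 * f t) (f r).
    (* The factor 4 gained in [f ^+ 2] outweighs the halved time span, so the bound on [s, r]
       implies the one on [s, t]. *)
    have := IH s r s0 sr; rewrite exprS in fst.
    have -> : f s <= 2 ^+ k * f r.
      apply: le_trans fst _; rewrite [2 * _]mulrC -mulrA ler_wpM2l// exprn_ge0//.
    move=> /(_ isT); apply: le_trans.
    have : (2 * f t) ^+ 2 <= f r ^+ 2 by rewrite lerXn2r// ?nnegrE ?f0// mulr_ge0.
    have -> : r - s = (t - s) / 2 by rewrite /r; field.
    rewrite exprMn => h2.
    have : 0 <= (t - s) * (f r ^+ 2 - 2 ^+ 2 * f t ^+ 2) by rewrite mulr_ge0; lra.
    have := sqr_ge0 (f t); nra.
  have := fd _ _ r0 rt; have -> : t - r = (t - s) / 2 by rewrite /r; field.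
  move=> h3.
  have h4 : (t - s) / 2 * (kap * f t ^+ 3) <= 2 * f t by lra.
  move: ft0; rewrite le_eqVlt => /predU1P[<-|ftp].
    by rewrite expr0n mulr0 divr_ge0// ltW.
  rewrite ler_pdivlMr//.
  have : f t * ((t - s) / 2 * (kap * f t ^+ 2)) <= f t * 2.
    by rewrite (mulrC _ 2); move: h4; rewrite exprS; nra.
  rewrite ler_pM2l//; nra.
move=> s t s0 st; have t0 := lt_trans s0 st.
have := f0 t t0; rewrite le_eqVlt => /predU1P[<-|ft0].
  by rewrite expr0n mulr0 divr_ge0// ltW.
(* Any [k] above the ratio [f s / f t] will do, as [k < 2 ^ k]. *)
pose k := (Num.truncn (f s / f t)).+1.
apply: (main k) => //.
rewrite -ler_pdivrMr//; apply: le_trans (ltW (truncnS_gt _)) _.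
rewrite -natrX ler_nat; exact/ltnW/ltn_expl.
Qed.

Lemma expr_unbounded (rho A : R) : 1 < rho -> exists k, A < rho ^+ k.
Proof.
move=> rho1; pose a := rho - 1; have a0 : 0 < a by rewrite subr_gt0.
have bernoulli k : 1 + k%:R * a <= rho ^+ k.
  elim: k => [|k IH]; first by rewrite mul0r addr0.
  have h : rho * (1 + k%:R * a) <= rho * rho ^+ k by rewrite ler_wpM2l//; lra.
  rewrite exprS; apply: le_trans h; rewrite -natr1.
  have -> : rho = 1 + a by rewrite /a; ring.
  by have := mulr_ge0 (ler0n R k) (sqr_ge0 a); nra.
exists (Num.truncn (A / a)).+1; apply: lt_le_trans (bernoulli _).
have := truncnS_gt (A / a); rewrite ltr_pdivrMr// => h; lra.
Qed.

End Decay.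

(** * From a mass bound to a supremum bound, for a function regular in time *)

Section NashBound.
Context {R : realType}.
Local Notation leb := (@lebesgue_measure R).
Implicit Types (r x y n s t T L B V : R) (k : nat).
Variables (mu W : R) (nu b : R -> R) (v vt w : R -> R -> R) (m : R).
Hypothesis mu1 : 1 <= mu.
Hypothesis mnu : measurable_fun [set: R] nu.
Hypothesis mb : measurable_fun [set: R] b.
Hypothesis nuP : forall x, mu^-1 <= nu x <= mu.
Hypothesis bP : forall x, (mu ^+ 2)^-1 <= b x <= mu ^+ 2.
Hypothesis v_ge0 : forall r x : R, 0 < r -> 0 <= v r x.
Hypothesis v_derive : forall r x : R, 0 < r -> is_derive r 1 (v ^~ x) (vt r x).
Hypothesis v_locally_bounded : forall s T L : R, 0 < s ->
  exists B, forall r x : R, s <= r <= T -> - L <= x <= L -> `|v r x| <= B /\ `|vt r x| <= B.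
Hypothesis vt_measurable : forall r : R, 0 < r -> measurable_fun [set: R] (vt r).
Hypothesis v_AC : forall r L : R, 0 < r -> 0 < L -> abs_cont (- L) L (v r) (w r).
(** As [b] is merely measurable, the flux [b w] has an absolutely continuous representative [G] but
    need not equal it at every point. *)
Hypothesis v_flux : forall r L : R, 0 < r -> 0 < L -> exists G,
  abs_cont (- L) L G (fun x => nu x * vt r x + W * w r x) /\
  {ae leb, forall x, - L <= x <= L -> b x * w r x = G x}.
(** The bound [B] does not depend on [L]; this is what makes the errors of the cutoffs O(1/n). *)
Hypothesis v_H1 : forall s T : R, 0 < s -> exists B, forall r L : R, s <= r <= T -> 0 < L ->
  itg (- L) L (fun x => w r x ^+ 2) /\
  intg (- L) L (fun x => v r x ^+ 2 + w r x ^+ 2) <= B.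
Hypothesis m_gt0 : 0 < m.
Hypothesis v_mass : forall r L : R, 0 < r -> 0 < L ->
  intg (- L) L (fun x => nu x * v r x) <= m.

Let mu0 : 0 < mu. Proof. exact: lt_le_trans mu1. Qed.
Let nu0 x : 0 < nu x.
Proof. by have /andP[h _] := nuP x; apply: lt_le_trans h; rewrite invr_gt0. Qed.
Let b0 x : 0 < b x.
Proof. by have /andP[h _] := bP x; apply: lt_le_trans h; rewrite invr_gt0 exprn_gt0. Qed.
Let nu_bound x : `|nu x| <= mu.
Proof. by rewrite ger0_norm ?(ltW (nu0 _))//; case/andP: (nuP x). Qed.
Let b_bound x : `|b x| <= mu ^+ 2.
Proof. by rewrite ger0_norm ?(ltW (b0 _))//; case/andP: (bP x). Qed.

Let itg_nu c d f : itg c d f -> itg c d (fun x => nu x * f x).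
Proof. by apply: (itg_bndM (M := mu)) => //; exact: measurable_funTS. Qed.

Let itg_b c d f : itg c d f -> itg c d (fun x => b x * f x).
Proof. by apply: (itg_bndM (M := mu ^+ 2)) => //; exact: measurable_funTS. Qed.

Let z n r x := cutoff n x * v r x.
Let z' n r x := dcutoff n x * v r x + w r x * cutoff n x.

Let cutoff_AC n : 0 < n -> abs_cont (- (3 * n)) (3 * n) (cutoff n) (dcutoff n).
Proof. by move=> n0; case: (C1c_cutoff n0) => ? ? _ _; exact: AC_derivable. Qed.

Let z_AC n r : 0 < n -> 0 < r ->
  abs_cont (- (3 * n)) (3 * n) (z n r) (z' n r).
Proof.
by move=> n0 r0; apply: AC_M; [exact: cutoff_AC|apply: v_AC; rewrite ?mulr_gt0].
Qed.

Let cutoff_left n : 0 < n -> cutoff n (- (3 * n)) = 0.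
Proof. by move=> n0; case: (C1c_cutoff n0) => _ _ h _; apply: h; rewrite ltxx. Qed.

Let cutoff_right n : 0 < n -> cutoff n (3 * n) = 0.
Proof. by move=> n0; case: (C1c_cutoff n0) => _ _ h _; apply: h; rewrite ltxx andbF. Qed.

Let z_ge0 n r x : 0 < n -> 0 < r -> 0 <= z n r x.
Proof. by move=> n0 r0; rewrite mulr_ge0 ?cutoff_ge0 ?v_ge0. Qed.

Let z_le n r x : 0 < n -> 0 < r -> z n r x <= v r x.
Proof. by move=> n0 r0; rewrite ler_piMl ?v_ge0// cutoff_le1. Qed.

Let itg_v2 r L : 0 < r -> 0 < L -> itg (- L) L (fun x => v r x ^+ 2).
Proof. by move=> r0 L0; exact: AC_itg (AC_X 1 (v_AC r0 L0)). Qed.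

Let itg_w2 r L : 0 < r -> 0 < L -> itg (- L) L (fun x => w r x ^+ 2).
Proof.
move=> r0 L0; have [B h] := v_H1 r r0.
by have [] := h r L _ L0; rewrite ?lexx.
Qed.

Let mw r L : 0 < r -> 0 < L -> measurable_fun `[- L, L] (w r).
Proof. by move=> r0 L0; exact: itg_measurable (v_AC r0 L0).1. Qed.

Let itg_zw2 n r : 0 < n -> 0 < r ->
  itg (- (3 * n)) (3 * n) (fun x => (cutoff n x * w r x) ^+ 2).
Proof.
move=> n0 r0; have L0 : 0 < 3 * n by rewrite mulr_gt0.
apply: (itg_dom _ _ (itg_w2 r0 L0)).
- apply: measurable_funX; apply: measurable_funM; last exact: mw.
  exact: AC_measurable (cutoff_AC n0).
- move=> x _; rewrite ger0_norm ?sqr_ge0// exprMn ler_piMl ?sqr_ge0//.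
  by rewrite exprn_ile1 ?cutoff_ge0 ?cutoff_le1.
Qed.

Let z'_sqr n r x : 0 < n ->
  z' n r x ^+ 2 <= 2 * (cutoff n x * w r x) ^+ 2 + 2 * (n^-1) ^+ 2 * v r x ^+ 2.
Proof.
move=> n0; rewrite /z'.
have h : (dcutoff n x) ^+ 2 <= (n^-1) ^+ 2.
  rewrite -[dcutoff n x ^+ 2]real_normK ?num_real//.
  by apply: lerXn2r; rewrite ?nnegrE ?dcutoff_le// ?invr_ge0 ?ltW//.
have h2 : dcutoff n x ^+ 2 * v r x ^+ 2 <= (n^-1) ^+ 2 * v r x ^+ 2.
  by rewrite ler_wpM2r ?sqr_ge0.
have := sqr_ge0 (dcutoff n x * v r x - cutoff n x * w r x); nra.
Qed.

Let itg_z'2 n r : 0 < n -> 0 < r ->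
  itg (- (3 * n)) (3 * n) (fun x => z' n r x ^+ 2).
Proof.
move=> n0 r0; have L0 : 0 < 3 * n by rewrite mulr_gt0.
have i1 := itg_zw2 n0 r0; have i2 := itg_v2 r0 L0.
apply: (@itg_dom _ _ _ _ (fun x => 2 * (cutoff n x * w r x) ^+ 2 +
   2 * (n^-1) ^+ 2 * v r x ^+ 2)).
- by apply: measurable_funX; exact: itg_measurable (z_AC n0 r0).1.
- by move=> x _; rewrite ger0_norm ?sqr_ge0// z'_sqr.
- by apply: itgD => //; exact: itgZ.
Qed.

Let intg_z'2 n r : 0 < n -> 0 < r ->
  intg (- (3 * n)) (3 * n) (fun x => z' n r x ^+ 2) <=
  2 * intg (- (3 * n)) (3 * n) (fun x => (cutoff n x * w r x) ^+ 2) +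
  2 * (n^-1) ^+ 2 * intg (- (3 * n)) (3 * n) (fun x => v r x ^+ 2).
Proof.
move=> n0 r0; have L0 : 0 < 3 * n by rewrite mulr_gt0.
have i1 := itg_zw2 n0 r0; have i2 := itg_v2 r0 L0.
have i3 : itg (- (3 * n)) (3 * n) (fun x => 2 * (cutoff n x * w r x) ^+ 2) by exact: itgZ.
have i4 : itg (- (3 * n)) (3 * n) (fun x => 2 * (n^-1) ^+ 2 * v r x ^+ 2) by exact: itgZ.
rewrite -!intgZ// -intgD//; apply: intg_le; [exact: itg_z'2|exact: itgD|].
by move=> x _; exact: z'_sqr.
Qed.

Let v2_le s T B : (forall r L, s <= r <= T -> 0 < L ->
  itg (- L) L (fun x => w r x ^+ 2) /\
  intg (- L) L (fun x => v r x ^+ 2 + w r x ^+ 2) <= B) -> 0 < s ->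
  forall r L, s <= r <= T -> 0 < L ->
  intg (- L) L (fun x => v r x ^+ 2) <= B /\ intg (- L) L (fun x => w r x ^+ 2) <= B.
Proof.
move=> h s0 r L rsT L0; have [w2 vw] := h r L rsT L0.
have r0 : 0 < r by case/andP: rsT => sr _; exact: lt_le_trans sr.
have v2 := itg_v2 r0 L0; split; apply: le_trans vw; apply: intg_le => //; try exact: itgD.
- by move=> x _; rewrite lerDl sqr_ge0.
- by move=> x _; rewrite lerDr sqr_ge0.
Qed.

(** A qualitative bound, with no control of its dependence on [s] and [T]: it only enters the
    constants in front of 1/n. *)
Let v_bounded s T : 0 < s -> exists2 V, 0 <= V &
  forall r x, s <= r <= T -> v r x <= V.
Proof.
move=> s0; have [B hB] := v_H1 T s0; have hB' := v2_le hB s0.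
(* The Sobolev inequality with [lam = 1] gives [v ^+ 2 <= B + 4 * B], where [4 * B] bounds the
   integral of [z' ^+ 2]; the added 1 passes from the square to [v]. *)
exists (Num.max 0 (5 * B + 1)); first by rewrite le_max lexx.
move=> r x rsT; have r0 : 0 < r by case/andP: rsT => sr _; exact: lt_le_trans sr.
rewrite le_max; apply/orP; right.
pose n := Num.max 1 `|x|; have n0 : 0 < n by rewrite lt_max ltr01.
have n1 : n^-1 <= 1 by rewrite invf_le1// le_max lexx.
have xn : `|x| <= n by rewrite le_max lexx orbT.
have L0 : 0 < 3 * n by rewrite mulr_gt0.
have xL : - (3 * n) <= x <= 3 * n by move: xn; rewrite ler_norml; lra.
have zA := z_AC n0 r0.
have z0 : z n r (- (3 * n)) = 0 by rewrite /z cutoff_left ?mul0r.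
have := sqr_sup_le ltr01 zA z0 (itg_z'2 n0 r0) xL.
rewrite /z cutoff_eq1// invr1 !mul1r.
have := intg_z'2 n0 r0; have [h1 h2] := hB' r _ rsT L0.
have h3 : intg (- (3 * n)) (3 * n) (fun x => (cutoff n x * w r x) ^+ 2) <= B.
  apply: le_trans h2; apply: intg_le; [exact: itg_zw2|exact: itg_w2|].
  move=> y _; rewrite exprMn ler_piMl ?sqr_ge0//.
  by rewrite exprn_ile1 ?cutoff_ge0 ?cutoff_le1.
have h4 : intg (- (3 * n)) (3 * n) (fun x => (cutoff n x * v r x) ^+ 2) <= B.
  apply: le_trans h1; apply: intg_le; [exact: AC_itg (AC_X 1 zA)|exact: itg_v2|].
  move=> y _; rewrite exprMn ler_piMl ?sqr_ge0//.
  by rewrite exprn_ile1 ?cutoff_ge0 ?cutoff_le1.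
have h5 : 0 <= intg (- (3 * n)) (3 * n) (fun x => v r x ^+ 2).
  by apply: intg_ge0 => y _; exact: sqr_ge0.
have h6 : (n^-1) ^+ 2 <= 1 by rewrite exprn_ile1// invr_ge0 ltW.
have h7 : 2 * (n^-1) ^+ 2 * intg (- (3 * n)) (3 * n) (fun x => v r x ^+ 2) <= 2 * B.
  rewrite -mulrA ler_pM2l//; apply: le_trans h1.
  by rewrite ler_piMl.
move=> h8 h9; have := sqr_ge0 (v r x - 1); nra.
Qed.

(** The exponent starts at 2, so that the time derivative contains [z ^+ k.+1] and the dissipation
    [z ^+ k] without any subtraction. *)
Let energy k n r := intg (- (3 * n)) (3 * n) (fun x => nu x * z n r x ^+ k.+2).
Let energy' k n r := intg (- (3 * n)) (3 * n)
  (fun x => nu x * (k.+2%:R * (z n r x ^+ k.+1 * (cutoff n x * vt r x)))).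
Let dissipation k n r := intg (- (3 * n)) (3 * n)
  (fun x => z n r x ^+ k * (b x * (cutoff n x * w r x) ^+ 2)).

Let itg_energy k n r : 0 < n -> 0 < r ->
  itg (- (3 * n)) (3 * n) (fun x => nu x * z n r x ^+ k.+2).
Proof. by move=> n0 r0; apply: itg_nu; exact: AC_itg (AC_X k.+1 (z_AC n0 r0)). Qed.

Let energy_derive k n r : 0 < n -> 0 < r -> is_derive r 1 (energy k n) (energy' k n r).
Proof.
move=> n0 r0; have L0 : 0 < 3 * n by rewrite mulr_gt0.
pose f (s x : R) := nu x * z n s x ^+ k.+2.
have df s x : 0 < s -> is_derive s 1 (f ^~ x)
    (nu x * (k.+2%:R * (z n s x ^+ k.+1 * (cutoff n x * vt s x)))).
  move=> s0; have h := v_derive x s0.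
  have hz : is_derive s 1 (fun t => z n t x) (cutoff n x * vt s x).
    by apply: is_derive_eq; rewrite /GRing.scale/=.
  have hX : is_derive s 1 (fun t => z n t x ^+ k.+2)
      (k.+2%:R * (z n s x ^+ k.+1 * (cutoff n x * vt s x))).
    by have := is_deriveX k.+2 hz; rewrite exprfctE /GRing.scale/= mulrA.
  by apply: is_derive_eq; rewrite /GRing.scale/=.
have u0 : 0 < r / 2 by rewrite divr_gt0.
have [B hB] := v_locally_bounded (r + 1) (3 * n) u0.
have Ir : `](r / 2), (r + 1)[%classic r.
  by rewrite /= in_itv/=; apply/andP; split; lra.
have Ipos s : `](r / 2), (r + 1)[%classic s -> 0 < s.
  by rewrite /= in_itv/= => /andP[? _]; lra.
have itf s : `](r / 2), (r + 1)[%classic s -> itg (- (3 * n)) (3 * n) (f s).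
  by move=> /Ipos s0; exact: itg_energy.
have derf s y : `](r / 2), (r + 1)[%classic s -> `[- (3 * n), 3 * n]%classic y ->
    derivable (f ^~ y) s 1.
  by move=> /Ipos s0 _; exact: (@ex_derive _ _ _ _ _ _ _ (df s y s0)).
have partialE s y : 0 < s -> partial1of2 f s y =
    nu y * (k.+2%:R * (z n s y ^+ k.+1 * (cutoff n y * vt s y))).
  by move=> s0; rewrite partial1of2E; exact: (@derive_val _ _ _ _ _ _ _ (df s y s0)).
pose G (_ : R) := mu * (k.+2%:R * (`|B| ^+ k.+1 * `|B|)).
have G0 y : 0 <= G y.
  by rewrite /G !mulr_ge0// ?exprn_ge0// ltW.
have iG : itg (- (3 * n)) (3 * n) G by exact: itg_cst.
have GP s y : `](r / 2), (r + 1)[%classic s -> `[- (3 * n), 3 * n]%classic y ->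
    `|partial1of2 f s y| <= G y.
  move=> Is; have s0 := Ipos _ Is; rewrite /= in_itv/= => yL.
  rewrite partialE// /G normrM; apply: ler_pM => //.
  have [vB vtB] : `|v s y| <= B /\ `|vt s y| <= B.
    by apply: hB => //; move: Is; rewrite /= in_itv/= => /andP[? ?]; apply/andP; split; lra.
  have B0 : 0 <= B by apply: le_trans vB.
  have c1 : `|cutoff n y| <= 1 by rewrite ger0_norm ?cutoff_ge0// cutoff_le1.
  rewrite normrM normr_nat ler_wpM2l// (ger0_norm B0) normrM normrX; apply: ler_pM => //.
  - apply: lerXn2r; rewrite ?nnegrE// /z normrM; apply: le_trans vB.
    by rewrite ler_piMl.
  - by rewrite normrM; apply: le_trans vtB; rewrite ler_piMl.
have mY := measurable_itv `[- (3 * n), 3 * n] : measurable (_ : set (measurableTypeR R)).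
have D1 := @derivable_under_integral R _ (measurableTypeR R) leb f _ mY
  r (r / 2) (r + 1) Ir itf derf G G0 iG GP.
have D2 := @differentiation_under_integral R _ (measurableTypeR R) leb f _ mY
  r (r / 2) (r + 1) Ir itf derf G G0 iG GP.
have -> : energy' k n r = derive1 (energy k n) r.
  by rewrite D2; apply: eq_intg => x _; rewrite partialE.
rewrite derive1E; exact: derivableP.
Qed.

(** A pointwise bound for the two terms in which [d], the derivative of the cutoff, survives: one
    from the flux, one from the drift. *)
Let error_le (d zx p bx wx vx W' A c P M e : R) : `|d| <= e -> 0 <= zx <= vx ->
  0 <= p <= P -> `|bx| <= M -> 0 <= A -> 0 <= c ->
  - A * (d * (zx * p) * bx * wx) + c * W' * (zx * p * d * vx) <=
  (A * M + c * `|W'|) * P * e * (vx ^+ 2 + wx ^+ 2).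
Proof.
move=> de /andP[z0 zv] /andP[p0 pP] bM A0 c0.
have e0 : 0 <= e by exact: le_trans de.
have M0 : 0 <= M by exact: le_trans bM.
have P0 : 0 <= P by exact: le_trans pP.
have v0 : 0 <= vx by exact: le_trans zv.
have zp : `|zx * p| <= vx * P by rewrite ger0_norm ?mulr_ge0//; exact: ler_pM.
have h1 : `|d * (zx * p) * bx * wx| <= M * P * e * (vx ^+ 2 + wx ^+ 2).
  apply: (@le_trans _ _ (e * (vx * P) * M * `|wx|)).
    rewrite normrM [`|d * _ * bx|]normrM [`|d * _|]normrM ler_wpM2r//.
    by apply: ler_pM; rewrite ?mulr_ge0//; exact: ler_pM.
  have -> : e * (vx * P) * M * `|wx| = M * P * e * (vx * `|wx|) by ring.
  rewrite ler_wpM2l ?mulr_ge0// -[wx ^+ 2]real_normK ?num_real//.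
  by have := sqr_ge0 (vx - `|wx|); have := normr_ge0 wx; nra.
have h2 : `|zx * p * d * vx| <= P * e * (vx ^+ 2 + wx ^+ 2).
  apply: (@le_trans _ _ ((vx * P) * e * vx)).
    rewrite normrM [`|zx * p * d|]normrM (ger0_norm v0) ler_wpM2r//.
    exact: ler_pM.
  have -> : vx * P * e * vx = P * e * vx ^+ 2 by ring.
  by rewrite ler_wpM2l ?mulr_ge0// lerDl sqr_ge0.
have h3 : - A * (d * (zx * p) * bx * wx) <= A * (M * P * e * (vx ^+ 2 + wx ^+ 2)).
  rewrite mulNr -mulrN ler_wpM2l//; move: h1; rewrite ler_norml => /andP[h1 _].
  by rewrite lerNl.
have h4 : c * W' * (zx * p * d * vx) <= c * `|W'| * (P * e * (vx ^+ 2 + wx ^+ 2)).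
  rewrite -(mulrA c W') -(mulrA c `|W'|) ler_wpM2l//; apply: le_trans (ler_norm _) _.
  by rewrite normrM ler_wpM2l.
apply: le_trans (lerD h3 h4) _.
suff -> : A * (M * P * e * (vx ^+ 2 + wx ^+ 2)) + c * `|W'| * (P * e * (vx ^+ 2 + wx ^+ 2)) =
  (A * M + c * `|W'|) * P * e * (vx ^+ 2 + wx ^+ 2) by [].
by ring.
Qed.

(** The equation tested with [cutoff n x * z n r x ^+ k.+1]. The drift [W] is hidden in [C], and so
    leaves no trace as [n] tends to infinity. *)
Let energy_le k s T : 0 < s -> exists2 C, 0 <= C & forall n r, 1 <= n -> s <= r <= T ->
  energy' k n r <= - (k.+2%:R * k.+1%:R) * dissipation k n r + C / n.
Proof.
move=> s0; have [B hB] := v_H1 T s0; have [V V0 hV] := v_bounded T s0.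
pose K := (k.+2%:R ^+ 2 * mu ^+ 2 + k.+2%:R * `|W|) * V ^+ k.
have K0 : 0 <= K by rewrite mulr_ge0 ?exprn_ge0// addr_ge0// mulr_ge0 ?sqr_ge0.
exists (K * `|B|); first by rewrite mulr_ge0.
move=> n r n1 rsT; have n0 : 0 < n by exact: lt_le_trans n1.
have r0 : 0 < r by case/andP: rsT => sr _; exact: lt_le_trans sr.
have L0 : 0 < 3 * n by rewrite mulr_gt0.
have zA := z_AC n0 r0; have [G [GA Gae]] := v_flux r0 L0.
have [w2i vwB] := hB r _ rsT L0; have v2i := itg_v2 r0 L0.
have vwi : itg (- (3 * n)) (3 * n) (fun x => v r x ^+ 2 + w r x ^+ 2) by exact: itgD.
have LL : - (3 * n) <= 3 * n by lra.
(* Two functions that vanish at both end points: the test function times the flux, and [z ^+ k.+2],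
   whose derivative absorbs the drift. Their densities [d1] and [d2] have integral 0. *)
have D1 := AC_M (AC_M (cutoff_AC n0) (AC_X k zA)) GA.
have D2 := AC_X k.+1 zA.
set d1 := (X in abs_cont _ _ _ X) in D1; set d2 := (X in abs_cont _ _ _ X) in D2.
have d10 : intg (- (3 * n)) (3 * n) d1 = 0.
  have := D1.2 (3 * n); rewrite LL lexx => /(_ isT).
  by rewrite cutoff_left// cutoff_right// !mul0r add0r.
have d20 : intg (- (3 * n)) (3 * n) d2 = 0.
  have := D2.2 (3 * n); rewrite LL lexx => /(_ isT).
  by rewrite /z cutoff_left// cutoff_right// !mul0r !expr0n add0r.
pose ds x := z n r x ^+ k * (b x * (cutoff n x * w r x) ^+ 2).
have dsi : itg (- (3 * n)) (3 * n) ds.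
  have bi := itg_b (itg_zw2 n0 r0).
  apply: (itg_bndM (M := V ^+ k)) bi.
    by apply: measurable_funX; exact: AC_measurable zA.
  move=> x _; rewrite normrX ger0_norm ?z_ge0//; apply: lerXn2r; rewrite ?nnegrE ?z_ge0//.
  by apply: le_trans (z_le x n0 r0) _; exact: hV.
have i1 : itg (- (3 * n)) (3 * n) (fun x => k.+2%:R * d1 x) by exact: itgZ D1.1.
have i2 : itg (- (3 * n)) (3 * n) (fun x => W * d2 x) by exact: itgZ D2.1.
have i3 : itg (- (3 * n)) (3 * n) (fun x => k.+2%:R * k.+1%:R * ds x) by exact: itgZ.
have i4 : itg (- (3 * n)) (3 * n) (fun x => K * n^-1 * (v r x ^+ 2 + w r x ^+ 2)).
  exact: itgZ.
have i12 := itg_itvB i1 i2.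
have i123 := itg_itvB i12 i3.
have i1234 := itg_itvD i123 i4.
apply: (@le_trans _ _ (intg (- (3 * n)) (3 * n) (fun x =>
  k.+2%:R * d1 x - W * d2 x - k.+2%:R * k.+1%:R * ds x +
  K * n^-1 * (v r x ^+ 2 + w r x ^+ 2)))); last first.
  rewrite (intgD i123 i4) (intgB i12 i3) (intgB i1 i2).
  rewrite (intgZ _ D1.1) (intgZ _ D2.1) (intgZ _ dsi) (intgZ _ vwi).
  rewrite d10 d20 !mulr0 subr0 sub0r -mulNr lerD2l mulrAC.
  rewrite ler_wpM2r ?invr_ge0 ?(ltW n0)// ler_wpM2l//.
  by apply: le_trans vwB _; exact: ler_norm.
apply: ae_le_Rintegral => //.
- have [B' hB'] := v_locally_bounded r (3 * n) r0.
  apply: (@itg_ext _ _ _ (fun x => vt r x *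
      (k.+2%:R * (nu x * (cutoff n x * z n r x ^+ k.+1))))).
    by move=> x _; ring.
  apply: (itg_bndM (M := B')).
  + by apply: measurable_funTS; exact: vt_measurable.
  + by move=> x xL; have [] := hB' r x _ xL; rewrite ?lexx.
  + apply: itg_itvZ; apply: itg_nu.
    exact: AC_itg (AC_M (cutoff_AC n0) (AC_X k zA)).
move: Gae; apply: aeS => x Gx; rewrite /= in_itv/= => /Gx {}Gx.
(* The flux term occurs [k + 2] times through the outer cutoff and [(k + 2)(k + 1)] times through
   the one inside [z], in all [(k + 2)^2] times. *)
have := @error_le (dcutoff n x) (z n r x) (z n r x ^+ k) (b x) (w r x) (v r x) W
  (k.+2%:R ^+ 2) k.+2%:R (V ^+ k) (mu ^+ 2) n^-1.
rewrite dcutoff_le// z_ge0// z_le// b_bound.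
have -> : 0 <= z n r x ^+ k <= V ^+ k.
  rewrite exprn_ge0 ?z_ge0//; apply: lerXn2r; rewrite ?nnegrE ?z_ge0//.
  by apply: le_trans (z_le x n0 r0) _; exact: hV.
rewrite ler0n sqr_ge0 => /(_ isT isT isT isT isT isT) err.
rewrite -subr_ge0; apply: le_trans (_ : 0 <= K / n * (v r x ^+ 2 + w r x ^+ 2) - _) _.
  by rewrite subr_ge0; exact: err.
rewrite le_eqVlt; apply/orP; left; apply/eqP.
rewrite /d1 /d2 /ds -Gx /z' !exprS -[k.+2%:R]natr1.
set p := _ ^+ k; rewrite /z; ring.
Qed.

Let zX_le n r k x N : 0 < n -> 0 < r -> z n r x <= N ->
  nu x * z n r x ^+ k.+2 <= N ^+ k.+1 * (nu x * v r x).
Proof.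
move=> n0 r0 zN; have N0 : 0 <= N by apply: le_trans zN; exact: z_ge0.
rewrite exprSr mulrCA; apply: ler_pM.
- by rewrite exprn_ge0 ?z_ge0.
- by rewrite mulr_ge0 ?z_ge0 ?(ltW (nu0 _)).
- by apply: lerXn2r; rewrite ?nnegrE ?z_ge0.
- by rewrite ler_wpM2l ?(ltW (nu0 _))// z_le.
Qed.

(** Interpolation between L^1 and L^infinity: one factor is left to the mass, the others go to the
    supremum. *)
Let energy_le_sup k n r N : 0 < n -> 0 < r ->
  (forall x, - (3 * n) <= x <= 3 * n -> z n r x <= N) ->
  energy k n r <= N ^+ k.+1 * m.
Proof.
move=> n0 r0 zN; have L0 : 0 < 3 * n by rewrite mulr_gt0.
have nvi : itg (- (3 * n)) (3 * n) (fun x => nu x * v r x).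
  by apply: itg_nu; exact: AC_itg (v_AC r0 L0).
have N0 : 0 <= N.
  apply: le_trans (zN 0 _); first exact: z_ge0.
  by apply/andP; split; lra.
apply: (@le_trans _ _ (N ^+ k.+1 * intg (- (3 * n)) (3 * n) (fun x => nu x * v r x))).
  rewrite -intgZ//; apply: intg_le; [exact: itg_energy|exact: itg_itvZ|].
  by move=> x /zN; exact: zX_le.
by rewrite ler_wpM2l ?exprn_ge0// v_mass.
Qed.

Let dissipation0_ge n r : 0 < n -> 0 < r ->
  intg (- (3 * n)) (3 * n) (fun x => (cutoff n x * w r x) ^+ 2) <=
  mu ^+ 2 * dissipation 0 n r.
Proof.
move=> n0 r0; have wi := itg_zw2 n0 r0; have bi := itg_b wi.
have di : itg (- (3 * n)) (3 * n) (fun x => z n r x ^+ 0 * (b x * (cutoff n x * w r x) ^+ 2)).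
  by apply: itg_ext bi => x _; rewrite expr0 mul1r.
rewrite /dissipation -intgZ//; apply: intg_le => //; first exact: itg_itvZ.
move=> x _; rewrite expr0 mul1r mulrA ler_peMl ?sqr_ge0//.
by have /andP[h _] := bP x; rewrite -ler_pdivrMl ?exprn_gt0// mulr1.
Qed.

Let energy0_ge n r : 0 < n -> 0 < r ->
  intg (- (3 * n)) (3 * n) (fun x => z n r x ^+ 2) <= mu * energy 0 n r.
Proof.
move=> n0 r0; have ei := itg_energy 0 n0 r0.
rewrite /energy -intgZ//; apply: intg_le.
- exact: AC_itg (AC_X 1 (z_AC n0 r0)).
- exact: itg_itvZ.
move=> x _; rewrite mulrA ler_peMl ?sqr_ge0//.
by have /andP[h _] := nuP x; rewrite -ler_pdivrMl// mulr1.
Qed.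

Let energy_ge0 k n r : 0 < n -> 0 < r -> 0 <= energy k n r.
Proof.
move=> n0 r0; apply: intg_ge0 => x _.
by rewrite mulr_ge0 ?(ltW (nu0 _))// exprn_ge0// z_ge0.
Qed.

Let dissipation_ge0 k n r : 0 < n -> 0 < r -> 0 <= dissipation k n r.
Proof.
move=> n0 r0; apply: intg_ge0 => x _.
apply: mulr_ge0; first by rewrite exprn_ge0 ?z_ge0.
by rewrite mulr_ge0 ?sqr_ge0 ?(ltW (b0 _)).
Qed.

(** [sqr_sup_le] in terms of energy and dissipation; [C / n] pays for the part of [z'] that contains
    [dcutoff]. *)
Let z_sup s T : 0 < s -> exists2 C, 0 <= C & forall n r lam x, 1 <= n -> s <= r <= T ->
  0 < lam -> - (3 * n) <= x <= 3 * n ->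
  z n r x ^+ 2 <= lam * (mu * energy 0 n r) +
    lam^-1 * (2 * mu ^+ 2 * dissipation 0 n r + C / n).
Proof.
move=> s0; have [B hB] := v_H1 T s0; have hB' := v2_le hB s0.
exists (2 * `|B|); first by rewrite mulr_ge0.
move=> n r lam x n1 rsT lam0 xL; have n0 : 0 < n by exact: lt_le_trans n1.
have r0 : 0 < r by case/andP: rsT => sr _; exact: lt_le_trans sr.
have L0 : 0 < 3 * n by rewrite mulr_gt0.
have zA := z_AC n0 r0; have z0 : z n r (- (3 * n)) = 0 by rewrite /z cutoff_left ?mul0r.
apply: le_trans (sqr_sup_le lam0 zA z0 (itg_z'2 n0 r0) xL) _.
apply: lerD; first by rewrite ler_wpM2l ?(ltW lam0)// energy0_ge.
rewrite ler_wpM2l ?invr_ge0 ?(ltW lam0)//.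
apply: le_trans (intg_z'2 n0 r0) _; apply: lerD.
  by rewrite -mulrA ler_wpM2l// dissipation0_ge.
have [h1 _] := hB' r _ rsT L0.
have h2 : 0 <= intg (- (3 * n)) (3 * n) (fun x => v r x ^+ 2).
  by apply: intg_ge0 => y _; exact: sqr_ge0.
rewrite -!mulrA ler_wpM2l// [`|B| * _]mulrC.
have ni0 : 0 <= n^-1 by rewrite invr_ge0 ltW.
rewrite ler_wpM2l//; apply: le_trans (ler_norm _); apply: le_trans h1.
by rewrite ler_piMl// invf_le1.
Qed.

Let cube_le (e Q : R) : 0 <= e -> 0 <= Q ->
  (forall lam, 0 < lam -> e ^+ 2 <= m ^+ 2 * (lam * (mu * e) + lam^-1 * Q)) ->
  e ^+ 3 <= 4 * mu * m ^+ 4 * Q.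
Proof.
rewrite le_eqVlt => /predU1P[<-|e0] Q0 h.
  by rewrite expr0n !mulr_ge0// ?exprn_ge0 ?ltW.
(* With this [lam] the first term on the right is [e ^+ 2 / 2] and can be absorbed on the left. *)
have lam0 : 0 < e / (2 * mu * m ^+ 2) by rewrite divr_gt0// !mulr_gt0// exprn_gt0.
have := h _ lam0.
have -> : m ^+ 2 * (e / (2 * mu * m ^+ 2) * (mu * e) + (e / (2 * mu * m ^+ 2))^-1 * Q) =
    e ^+ 2 / 2 + (2 * mu * m ^+ 4 * Q) / e.
  by field; rewrite !gt_eqF.
move=> h2; have : e ^+ 2 / 2 <= 2 * mu * m ^+ 4 * Q / e by lra.
rewrite ler_pdivlMr// => h3; rewrite exprSr; lra.
Qed.

(** [cube_le] is used with [Q] equal to [2 * mu ^+ 2] times the dissipation, up to O(1/n); the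
    factor [4 * mu * m ^+ 4] times [mu ^+ 2] is what must be divided out to leave twice the
    dissipation, the loss rate of the energy. *)
Let kap := (4 * mu ^+ 3 * m ^+ 4)^-1.

Let energy_ode s T : 0 < s -> exists2 C, 0 <= C & forall n r, 1 <= n -> s <= r <= T ->
  energy' 0 n r <= - (kap * energy 0 n r ^+ 3) + C / n.
Proof.
move=> s0; have [C1 C10 h1] := energy_le 0 T s0; have [C2 C20 h2] := z_sup T s0.
exists (C1 + C2); first exact: addr_ge0.
move=> n r n1 rsT; have n0 : 0 < n by exact: lt_le_trans n1.
have r0 : 0 < r by case/andP: rsT => sr _; exact: lt_le_trans sr.
have e0 := energy_ge0 0 n0 r0; have d0 := dissipation_ge0 0 n0 r0.
set e := energy 0 n r in e0 *; set D := dissipation 0 n r in d0 *.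
pose Q := 2 * mu ^+ 2 * D + C2 / n.
have Q0 : 0 <= Q.
  have mu00 := ltW mu0.
  by rewrite addr_ge0// ?divr_ge0 ?(ltW n0)// !mulr_ge0.
have eQ : e ^+ 3 <= 4 * mu * m ^+ 4 * Q.
  apply: cube_le => // lam lam0.
  pose N2 := lam * (mu * e) + lam^-1 * Q.
  have N20 : 0 <= N2 by rewrite addr_ge0 ?mulr_ge0 ?invr_ge0// ltW.
  have eN : e <= Num.sqrt N2 * m.
    have := @energy_le_sup 0 n r (Num.sqrt N2) n0 r0; rewrite expr1; apply.
    move=> x xL; rewrite -(@ler_pXn2r _ 2)// ?nnegrE ?sqrtr_ge0 ?z_ge0//.
    by rewrite sqr_sqrtr//; exact: h2.
  apply: (@le_trans _ _ ((Num.sqrt N2 * m) ^+ 2)).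
    by apply: lerXn2r; rewrite ?nnegrE ?mulr_ge0 ?sqrtr_ge0// ltW.
  by rewrite exprMn sqr_sqrtr// mulrC.
have h3 : energy' 0 n r <= - (2 * 1) * D + C1 / n by exact: h1.
apply: le_trans h3 _.
have eQ' : kap * e ^+ 3 <= 2 * D + C2 / n / mu ^+ 2.
  have -> : 2 * D + C2 / n / mu ^+ 2 = kap * (4 * mu * m ^+ 4 * Q).
    by rewrite /kap /Q; field; rewrite !gt_eqF.
  by rewrite ler_wpM2l// invr_ge0 !mulr_ge0 ?exprn_ge0 ?ltW.
have : C2 / n / mu ^+ 2 <= C2 / n.
  rewrite ler_pdivrMr ?exprn_gt0// ler_peMr ?divr_ge0 ?(ltW n0)//.
  exact: exprn_ege1.
rewrite (mulrDl C1); lra.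
Qed.

(** The mean value theorem spares any integrability of [energy'] in time; the price is an
    intermediate time that depends on [n]. *)
Let energy_MVT k n s t : 0 < n -> 0 < s -> s < t -> exists2 r, s < r < t &
  energy k n t - energy k n s = energy' k n r * (t - s).
Proof.
move=> n0 s0 st.
have h1 r : r \in `]s, t[ -> is_derive r 1 (energy k n) (energy' k n r).
  by rewrite in_itv/= => /andP[sr _]; apply: energy_derive => //; exact: lt_trans sr.
have h2 : {within `[s, t], continuous (energy k n)}.
  apply: derivable_within_continuous => r; rewrite in_itv/= => /andP[sr _].
  have r0 : 0 < r by exact: lt_le_trans sr.
  exact: (@ex_derive _ _ _ _ _ _ _ (energy_derive k n0 r0)).
have [r rst ->] := MVT st h1 h2.
by exists r => //; move: rst; rewrite in_itv.
Qed.

(** Almost-monotonicity, by which an estimate at the unknown intermediate time is compared with the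
    end points. *)
Let energy_drop s T : 0 < s -> exists2 C, 0 <= C & forall n r r', 1 <= n ->
  s <= r -> r < r' -> r' <= T -> energy 0 n r' - C / n <= energy 0 n r.
Proof.
move=> s0; have [C C0 h] := energy_ode T s0.
exists (C * (`|T - s|)) => [|n r r' n1 sr rr' r'T]; first by rewrite mulr_ge0.
have n0 : 0 < n by exact: lt_le_trans n1.
have r0 : 0 < r by exact: lt_le_trans sr.
have [q /andP[rq qr'] E] := energy_MVT 0 n0 r0 rr'.
have q0 : 0 < q by exact: lt_trans rq.
have := h n q n1; rewrite (le_trans sr (ltW rq)) (le_trans (ltW qr') r'T) => /(_ isT) hq.
have h3 : 0 <= kap * energy 0 n q ^+ 3.
  by rewrite mulr_ge0 ?exprn_ge0 ?energy_ge0// invr_ge0 !mulr_ge0 ?exprn_ge0 ?ltW.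
have h4 : energy' 0 n q <= C / n by lra.
have h5 : energy' 0 n q * (r' - r) <= C / n * (r' - r).
  by rewrite ler_wpM2r// subr_ge0 ltW.
have h6 : C / n * (r' - r) <= C / n * `|T - s|.
  rewrite ler_wpM2l ?divr_ge0 ?(ltW n0)//; apply: le_trans (ler_norm _).
  by rewrite lerB.
have -> : C * `|T - s| / n = C / n * `|T - s| by ring.
lra.
Qed.

Let mass2 L r := intg (- L) L (fun x => nu x * v r x ^+ 2).

Let mass2_mono r L L' : 0 < r -> 0 < L -> L <= L' -> mass2 L r <= mass2 L' r.
Proof.
move=> r0 L0 LL'; have L'0 : 0 < L' by exact: lt_le_trans LL'.
apply: intg_sub; [lra|lra|lra|by apply: itg_nu; exact: itg_v2|].
by move=> x _; rewrite mulr_ge0 ?sqr_ge0 ?(ltW (nu0 _)).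
Qed.

Let energy_le_mass2 n r : 0 < n -> 0 < r -> energy 0 n r <= mass2 (3 * n) r.
Proof.
move=> n0 r0; have L0 : 0 < 3 * n by rewrite mulr_gt0.
apply: intg_le; [exact: itg_energy|by apply: itg_nu; exact: itg_v2|].
move=> x _; rewrite ler_wpM2l ?(ltW (nu0 _))//; apply: lerXn2r.
- by rewrite nnegrE z_ge0.
- by rewrite nnegrE v_ge0.
- exact: z_le.
Qed.

Let mass2_le_energy n r : 0 < n -> 0 < r -> mass2 n r <= energy 0 n r.
Proof.
move=> n0 r0; have L0 : 0 < 3 * n by rewrite mulr_gt0.
have -> : mass2 n r = intg (- n) n (fun x => nu x * z n r x ^+ 2).
  apply: eq_intg => x xn; rewrite /z cutoff_eq1 ?mul1r//.
  by rewrite ler_norml.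
apply: intg_sub; [lra|lra|lra|exact: itg_energy|].
by move=> x _; rewrite mulr_ge0 ?sqr_ge0 ?(ltW (nu0 _)).
Qed.

(** The integral of [nu v^2] over the line, as a supremum over intervals. The cutoff energies lie
    between [mass2 n] and [mass2 (3 * n)], hence converge to it. *)
Let E r := sup [set mass2 L r | L in [set L | 0 < L]].

Let E_has_sup r : 0 < r -> has_sup [set mass2 L r | L in [set L | 0 < L]].
Proof.
move=> r0; split; first by exists (mass2 1 r), 1 => //; exact: ltr01.
have [B hB] := v_H1 r r0; have hB' := v2_le hB r0.
exists (mu * B) => _ [L /= L0 <-]; have [|h1 _] := hB' r L _ L0; first by rewrite lexx.
apply: (@le_trans _ _ (mu * intg (- L) L (fun x => v r x ^+ 2))); last first.
  by rewrite ler_wpM2l// ltW.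
have vi := itg_v2 r0 L0.
rewrite -intgZ//; apply: intg_le; [exact: itg_nu|exact: itg_itvZ|].
by move=> x _; have /andP[_ h] := nuP x; rewrite ler_wpM2r ?sqr_ge0.
Qed.

Let mass2_le_E L r : 0 < r -> 0 < L -> mass2 L r <= E r.
Proof.
move=> r0 L0; apply: ub_le_sup; first by case: (E_has_sup r0).
by exists L.
Qed.

Let energy_le_E n r : 0 < n -> 0 < r -> energy 0 n r <= E r.
Proof.
move=> n0 r0; apply: le_trans (energy_le_mass2 n0 r0) _.
by apply: mass2_le_E => //; rewrite mulr_gt0.
Qed.

Let E_ge0 r : 0 < r -> 0 <= E r.
Proof. by move=> r0; apply: le_trans (energy_le_E ltr01 r0); exact: energy_ge0. Qed.

Let energy_cvg r : 0 < r -> energy 0 k.+1%:R r @[k --> \oo] --> E r.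
Proof.
move=> r0; apply/cvgrPdist_le => e e0.
have [_ [L /= L0 <-] hL] := sup_adherent e0 (E_has_sup r0).
near=> k.
have Lk : L <= k.+1%:R.
  apply: (@le_trans _ _ k%:R); last by rewrite ler_nat.
  by near: k; exact: nbhs_infty_ger.
have k0 : 0 < k.+1%:R :> R by rewrite ltr0n.
rewrite ger0_norm ?subr_ge0 ?energy_le_E//.
have := mass2_mono r0 L0 Lk; have := mass2_le_energy k0 r0; rewrite -/(E r) in hL; lra.
Unshelve. all: by end_near. Qed.

Let E_decay s t : 0 < s -> s < t -> E t + (t - s) * (kap * E t ^+ 3) <= E s.
Proof.
move=> s0 st; have t0 := lt_trans s0 st.
have [C1 C10 ode] := energy_ode t s0; have [C2 C20 drop] := energy_drop t s0.
(* The differential inequality at the intermediate time, with the energy there bounded below by its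
   value at [t] minus an error; every term converges as the cutoff widens. *)
pose u k := energy 0 k.+1%:R t +
  (t - s) * (kap * (energy 0 k.+1%:R t - C2 * k.+1%:R^-1) ^+ 3 - C1 * k.+1%:R^-1).
have uE : u k @[k --> \oo] --> E t + (t - s) * (kap * (E t - C2 * 0) ^+ 3 - C1 * 0).
  have h0 : (k.+1%:R^-1 : R) @[k --> \oo] --> (0 : R) by exact: cvg_harmonic.
  have hE := energy_cvg t0.
  apply: cvgD => //; apply: cvgM; first exact: cvg_cst.
  apply: cvgB; last by apply: cvgM => //; exact: cvg_cst.
  apply: cvgM; first exact: cvg_cst.
  have hd : energy 0 k.+1%:R t - C2 * k.+1%:R^-1 @[k --> \oo] --> E t - C2 * 0.
    by apply: cvgB => //; apply: cvgM => //; exact: cvg_cst.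
  rewrite !exprS expr0; under eq_fun do rewrite !exprS expr0.
  by apply: cvgM => //; apply: cvgM => //; apply: cvgM => //; exact: cvg_cst.
rewrite !mulr0 !subr0 in uE.
have -> : E t + (t - s) * (kap * E t ^+ 3) = limn u by apply/esym/cvg_lim.
apply: limr_le; first by apply/cvg_ex; eexists; exact: uE.
near=> k; rewrite /u; set n : R := k.+1%:R.
have n1 : 1 <= n by rewrite ler1n.
have n0 : 0 < n by exact: lt_le_trans n1.
have [r /andP[sr rt] hr] := energy_MVT 0 n0 s0 st.
have r0 : 0 < r by exact: lt_trans sr.
have h1 := drop n r t n1 (ltW sr) rt (lexx _).
have := ode n r n1; rewrite (ltW sr) (ltW rt) => /(_ isT) h2.
apply: le_trans (energy_le_E n0 s0).
(* The corrected energy may be negative; its cube is then negative too, as 3 is odd. *)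
have h3 : (energy 0 n t - C2 / n) ^+ 3 <= energy 0 n r ^+ 3.
  have [e0|e0] := leP 0 (energy 0 n t - C2 / n).
    by apply: lerXn2r => //; rewrite nnegrE ?energy_ge0.
  apply: (@le_trans _ _ 0); last by rewrite exprn_ge0// energy_ge0.
  by rewrite exprn_odd_le0//= ltW.
have kap0 : 0 <= kap by rewrite invr_ge0 !mulr_ge0 ?exprn_ge0 ?ltW.
have h4 : kap * (energy 0 n t - C2 / n) ^+ 3 <= kap * energy 0 n r ^+ 3 by rewrite ler_wpM2l.
have h5 : kap * (energy 0 n t - C2 / n) ^+ 3 - C1 / n <= - energy' 0 n r.
  by move: h2 h4; move: (kap * _) (kap * _) (C1 / n) (energy' 0 n r) => *; lra.
have h6 : (t - s) * (kap * (energy 0 n t - C2 / n) ^+ 3 - C1 / n) <=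
    (t - s) * - energy' 0 n r by rewrite ler_wpM2l// subr_ge0 ltW.
move: h6; rewrite mulrN [(t - s) * energy' _ _ _]mulrC -hr.
by rewrite opprB lerBrDl.
Unshelve. all: by end_near. Qed.

(** [cubic_decay] has to start at a positive time; starting at [t / 2] doubles its constant
    [4 / kap]. *)
Let E_le t : 0 < t -> t * E t ^+ 2 <= 8 / kap.
Proof.
move=> t0; have kap0 : 0 < kap by rewrite invr_gt0 !mulr_gt0// exprn_gt0.
have := @cubic_decay _ E kap kap0 E_ge0 E_decay (t / 2) t.
have -> : t - t / 2 = t / 2 by field.
have t20 : 0 < t / 2 by rewrite divr_gt0.
have -> : t / 2 < t by lra.
move=> /(_ t20 isT).
have -> : 8 / kap = 2 * (4 / kap) by ring.
by move: (4 / kap) (E t ^+ 2) => A B h; nra.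
Qed.

(** The square of 5 is 24 + 1: the Sobolev bound yields [24 * mu ^+ 4 * m ^+ 2 / t], and the
    remaining unit, called [gap] below, absorbs the O(1/n) errors. *)
Let K0 t := 5 * mu ^+ 2 * m / Num.sqrt t.

Let E_half t : 0 < t -> E (t / 2) <= 8 * mu ^+ 2 * m ^+ 2 / Num.sqrt t.
Proof.
move=> t0; have t20 : 0 < t / 2 by rewrite divr_gt0.
have sq0 : 0 < Num.sqrt t by rewrite sqrtr_gt0.
rewrite -(@ler_pXn2r _ 2)// ?nnegrE ?E_ge0//; last first.
  by rewrite divr_ge0 ?(ltW sq0)// !mulr_ge0 ?exprn_ge0 ?ltW.
rewrite expr_div_n sqr_sqrtr ?(ltW t0)// ler_pdivlMr//.
have := E_le t20; have -> : 8 / kap = 32 * mu ^+ 3 * m ^+ 4.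
  by rewrite /kap invrK; ring.
(* Raising the power of [mu], which is at least 1, turns the bound on the squared energy into a
   perfect square. *)
move=> h; have h2 : 32 * mu ^+ 3 * m ^+ 4 <= 32 * mu ^+ 4 * m ^+ 4.
  rewrite ler_wpM2r ?exprn_ge0 ?(ltW m_gt0)// ler_wpM2l// [leRHS]exprS.
  by rewrite ler_peMl// exprn_ge0// ltW.
have -> : (8 * mu ^+ 2 * m ^+ 2) ^+ 2 = 2 * (32 * mu ^+ 4 * m ^+ 4) by ring.
by move: (E (t / 2) ^+ 2) h h2 => e; nra.
Qed.

(** On [t/2, t] the energy loses at most [E (t / 2)], so at some time the dissipation is at most of
    the order of [E (t / 2) / t]; energy and dissipation then bound the supremum. *)
Let z_le_K0 t : 0 < t -> exists2 n0, 1 <= n0 & forall n, n0 <= n ->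
  exists2 r, t / 2 < r < t & forall x, - (3 * n) <= x <= 3 * n -> z n r x <= K0 t.
Proof.
move=> t0; have s0 : 0 < t / 2 by rewrite divr_gt0.
have sq0 : 0 < Num.sqrt t by rewrite sqrtr_gt0.
have sqt : Num.sqrt t ^+ 2 = t by rewrite sqr_sqrtr// ltW.
have [C1 C10 h1] := energy_le 0 t s0; have [C2 C20 h2] := energy_drop t s0.
have [C3 C30 h3] := z_sup t s0.
set s := t / 2 in s0 h1 h2 h3 *; set sq := Num.sqrt t in sq0 sqt *.
pose C := mu * C2 / sq + sq * (mu ^+ 2 * C1 + C3).
have mu00 := ltW mu0.
have C0 : 0 <= C by rewrite addr_ge0 ?divr_ge0 ?mulr_ge0 ?addr_ge0 ?mulr_ge0 ?(ltW sq0).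
pose gap := mu ^+ 4 * m ^+ 2 / t.
have gap0 : 0 < gap by rewrite divr_gt0// mulr_gt0// exprn_gt0.
exists (Num.max 1 (C / gap)); first by rewrite le_max lexx.
move=> n; rewrite ge_max => /andP[n1 nC].
have n0 : 0 < n by exact: lt_le_trans n1.
have st : s < t by rewrite /s; lra.
have [r /andP[sr rt] hr] := energy_MVT 0 n0 s0 st.
have r0 : 0 < r by exact: lt_trans sr.
have srt : s <= r <= t by rewrite !ltW.
exists r => [|x xL]; first by rewrite sr.
have K00 : 0 <= K0 t by rewrite divr_ge0 ?(ltW sq0)// !mulr_ge0// ltW.
rewrite -(@ler_pXn2r _ 2)// ?nnegrE ?z_ge0//.
(* The weight [1 / Num.sqrt t] balances the energy against a dissipation smaller by a factor of
   order [1 / t]. *)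
have lam0 : 0 < sq^-1 by rewrite invr_gt0.
apply: le_trans (h3 n r _ x n1 srt lam0 xL) _; rewrite invrK.
have eE : energy 0 n r <= E s + C2 / n.
  by have := h2 n s r n1 (lexx _) sr (ltW rt); have := energy_le_E n0 s0; lra.
have d1 : energy' 0 n r <= - (2 * 1) * dissipation 0 n r + C1 / n by exact: h1.
have d2 : - E s <= energy' 0 n r * s.
  have -> : energy' 0 n r * s = energy 0 n t - energy 0 n s.
    by rewrite hr; congr (_ * _); rewrite /s; field.
  by have := energy_ge0 0 n0 t0; have := energy_le_E n0 s0; lra.
have d3 : 2 * dissipation 0 n r <= E s / s + C1 / n.
  have : - (E s / s) <= energy' 0 n r by rewrite -mulNr ler_pdivrMr.
  lra.
have Eh : E s <= 8 * mu ^+ 2 * m ^+ 2 / sq by exact: E_half.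
apply: (@le_trans _ _ (sq^-1 * (mu * (E s + C2 / n)) +
    sq * (mu ^+ 2 * (E s / s + C1 / n) + C3 / n))).
  apply: lerD.
    by rewrite ler_wpM2l ?(ltW lam0)// ler_wpM2l.
  rewrite ler_wpM2l ?(ltW sq0)// lerD2r [2 * _]mulrC -mulrA ler_wpM2l// exprn_ge0//.
have -> : sq^-1 * (mu * (E s + C2 / n)) + sq * (mu ^+ 2 * (E s / s + C1 / n) + C3 / n) =
    (mu + 2 * mu ^+ 2) * E s / sq + C / n.
  by rewrite /C /s -sqt; field; rewrite !gt_eqF.
have g1 : C / n <= gap by rewrite ler_pdivrMr// mulrC -ler_pdivrMr.
have g2 : (mu + 2 * mu ^+ 2) * E s / sq <= 24 * mu ^+ 4 * m ^+ 2 / t.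
  have -> : 24 * mu ^+ 4 * m ^+ 2 / t = 3 * mu ^+ 2 * (8 * mu ^+ 2 * m ^+ 2 / sq) / sq.
    by rewrite -sqt; field; rewrite gt_eqF.
  rewrite ler_wpM2r ?(ltW lam0)//; apply: ler_pM => //.
  - by rewrite addr_ge0// mulr_ge0// exprn_ge0.
  - exact: E_ge0.
  - rewrite -subr_ge0; have -> : 3 * mu ^+ 2 - (mu + 2 * mu ^+ 2) = mu * (mu - 1) by ring.
    by rewrite mulr_ge0// subr_ge0.
have -> : K0 t ^+ 2 = 24 * mu ^+ 4 * m ^+ 2 / t + gap.
  by rewrite /K0 -/sq expr_div_n sqt /gap; field; rewrite gt_eqF.
exact: lerD.
Qed.

(** Interpolation at the good time before [t], then almost-monotonicity of the energy up to [t]: the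
    sign of the dissipation is all that matters here. *)
Let energy_K0 t k : 0 < t -> exists2 C, 0 <= C & exists2 n0, 1 <= n0 &
  forall n, n0 <= n -> energy k n t <= K0 t ^+ k.+1 * m + C / n.
Proof.
move=> t0; have s0 : 0 < t / 2 by rewrite divr_gt0.
have [C C0 h] := energy_le k t s0; have [n0 n01 hz] := z_le_K0 t0.
exists (C * t); first by rewrite mulr_ge0// ltW.
exists n0 => // n n0n; have n1 : 1 <= n by exact: le_trans n0n.
have np : 0 < n by exact: lt_le_trans n1.
have [r /andP[sr rt] zr] := hz n n0n.
have r0 : 0 < r by exact: lt_trans sr.
have [q /andP[rq qt] hq] := energy_MVT k np r0 rt.
have q0 : 0 < q by exact: lt_trans rq.
have := h n q n1; rewrite (ltW (lt_trans sr rq)) (ltW qt) => /(_ isT) hq'.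
have hd : 0 <= (k.+2%:R * k.+1%:R) * dissipation k n q.
  by rewrite mulr_ge0 ?dissipation_ge0.
have hE : energy' k n q <= C / n by lra.
have h5 : energy' k n q * (t - r) <= C / n * (t - r).
  by rewrite ler_wpM2r// subr_ge0 ltW.
have h6 : C / n * (t - r) <= C / n * t.
  by rewrite ler_wpM2l ?divr_ge0 ?(ltW np)// gerBl ltW.
have h7 := energy_le_sup k np r0 zr.
have -> : C * t / n = C / n * t by ring.
lra.
Qed.

(** The limit of large exponents as a contradiction: if [v t x] exceeds [K0 t], then [v] stays above
    some [K1 > K0 t] on an interval, where the energies grow like [K1 ^+ k], faster than the upper
    bound allows. *)
Lemma nash_bound t x : 0 < t -> v t x <= 5 * mu ^+ 2 * m / Num.sqrt t.
Proof.
move=> t0; rewrite leNgt; apply/negP; rewrite -/(K0 t) => Kv.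
have sq0 : 0 < Num.sqrt t by rewrite sqrtr_gt0.
have K00 : 0 < K0 t by rewrite divr_gt0// !mulr_gt0.
pose K1 := (K0 t + v t x) / 2.
have K01 : K0 t < K1 by rewrite /K1; lra.
have K10 : 0 < K1 by exact: lt_trans K01.
pose L := `|x| + 1.
have L0 : 0 < L by rewrite ltr_wpDl.
have xL : - L <= x <= L by rewrite /L -ler_norml lerDl.
have cv : {within `[- L, L], continuous (v t)}.
  by apply: AC_continuous (v_AC t0 L0); lra.
have e0 : 0 < v t x - K1 by rewrite /K1; lra.
have [d' d'0 hd'] := within_continuous_dist cv xL e0.
pose d := Num.min d' 1 / 2.
have d0 : 0 < d by rewrite divr_gt0// lt_min d'0 ltr01.
have dd' : d < d'.
  have : Num.min d' 1 <= d' by rewrite ge_min lexx.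
  by rewrite /d; lra.
have d1 : d < 1.
  have : Num.min d' 1 <= 1 by rewrite ge_min lexx orbT.
  by rewrite /d; lra.
have vK1 y : x - d <= y <= x + d -> `|y| <= L /\ K1 <= v t y.
  move=> yd; have yL : `|y| <= L.
    have -> : y = x + (y - x) by rewrite subrKC.
    by apply: le_trans (ler_normD _ _) _; rewrite lerD2l ler_norml; lra.
  split => //; have yL' : - L <= y <= L by rewrite -ler_norml.
  have : `|v t x - v t y| < v t x - K1 by apply: hd' => //; rewrite ltr_norml; lra.
  by rewrite ltr_norml; lra.
have rho1 : 1 < K1 / K0 t by rewrite ltr_pdivlMr// mul1r.
(* The exponent is fixed before the width [n], because the error constant of [energy_K0] depends on
   [k]. *)
have [k hk] := expr_unbounded (mu * m / (2 * d * K1)) rho1.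
have lower n : L <= n -> 2 * d / mu * K1 ^+ k.+2 <= energy k n t.
  move=> Ln; have n0 : 0 < n by exact: lt_le_trans Ln.
  have zi := itg_energy k n0 t0.
  have xn : - n <= x - d /\ x + d <= n.
    have := vK1 (x - d); have := vK1 (x + d); rewrite !ler_norml.
    by move=> [|h1 _]; [lra|move=> [|h2 _]; lra].
  have xn1 : - (3 * n) <= x - d by case: xn; lra.
  have xn2 : x + d <= 3 * n by case: xn; lra.
  apply: (@le_trans _ _ (intg (x - d) (x + d) (fun y => nu y * z n t y ^+ k.+2))).
    have -> : 2 * d / mu * K1 ^+ k.+2 = intg (x - d) (x + d) (cst (mu^-1 * K1 ^+ k.+2)).
      by rewrite intg_cst; [ring|lra].
    apply: intg_le; [exact: itg_cst|exact: itg_sub zi|].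
    move=> y yd; have [yL K1v] := vK1 y yd; apply: ler_pM.
    - by rewrite invr_ge0 ltW.
    - by rewrite exprn_ge0// ltW.
    - by case/andP: (nuP y).
    - rewrite /z cutoff_eq1 ?mul1r ?(le_trans yL)//.
      by apply: lerXn2r; rewrite ?nnegrE ?v_ge0// ltW.
  apply: intg_sub; [exact: xn1|lra|exact: xn2|exact: zi|].
  by move=> y _; rewrite mulr_ge0 ?(ltW (nu0 _))// exprn_ge0// z_ge0.
have [C C0 [n0 n01 upper]] := energy_K0 k t0.
have gap : 0 < 2 * d / mu * K1 ^+ k.+2 - K0 t ^+ k.+1 * m.
  rewrite subr_gt0.
  have hk1 : mu * m / (2 * d * K1) < (K1 / K0 t) ^+ k.+1.
    apply: lt_le_trans hk _; rewrite exprSr ler_peMr ?(ltW rho1)//.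
    by rewrite exprn_ge0// ltW// (lt_trans ltr01).
  have dK : 0 < 2 * d * K1 by rewrite mulr_gt0// mulr_gt0.
  move: hk1; rewrite expr_div_n ltr_pdivrMr// mulrAC ltr_pdivlMr ?exprn_gt0// => hk1.
  have -> : 2 * d / mu * K1 ^+ k.+2 = K1 ^+ k.+1 * (2 * d * K1) / mu.
    by rewrite exprSr; ring.
  rewrite ltr_pdivlMr//; apply: le_lt_trans hk1.
  by rewrite le_eqVlt; apply/orP; left; apply/eqP; ring.
set g := (_ - _) in gap.
pose n := Num.max (Num.max n0 L) ((C + 1) / g).
have nn0 : n0 <= n by rewrite /n !le_max lexx.
have nL : L <= n by rewrite /n !le_max lexx orbT.
have ng : (C + 1) / g <= n by rewrite /n le_max lexx orbT.
have n0' : 0 < n by apply: lt_le_trans nL.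
have := upper n nn0; have := lower n nL.
have : C / n < g.
  by rewrite ltr_pdivrMr// mulrC; move: ng; rewrite ler_pdivrMr//; lra.
rewrite /g; lra.
Qed.

End NashBound.

(** * Weak solutions on rectangles *)

Section UpperHalf.
Context {R : realType}.
Local Notation leb := (@lebesgue_measure R).
Local Notation leb2 := (@leb2 R).
Local Notation RR := (measurableTypeR R * measurableTypeR R)%type.
Local Notation rect s t a b := (`[s, t]%classic `*` `[a, b]%classic).
Implicit Types (r x s t a b c d : R) (u : R * R -> R).

Lemma rect_upper s t a b : 0 < s -> rect s t a b `<=` @upper_half R.
Proof.
move=> s0 [r x] /= []; rewrite in_itv/= => /andP[sr _] _.
exact: lt_le_trans sr.
Qed.

Lemma measurable_upper : measurable (@upper_half R : set RR).
Proof.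
have -> : @upper_half R = `]0, +oo[%classic `*` setT.
  by apply/seteqP; split => [[r x]|[r x] []] /=; rewrite /upper_half/= in_itv/= andbT.
exact: measurableX.
Qed.

Lemma L2_measurable u : L2_slabs u -> measurable_fun (@upper_half R : set RR) (u : RR -> R).
Proof. by case. Qed.

Lemma L2_measurable_rect u s t a b : 0 < s -> L2_slabs u ->
  measurable_fun (rect s t a b : set RR) (u : RR -> R).
Proof.
move=> s0 /L2_measurable mu; apply: measurable_funS mu; first exact: measurable_upper.
exact: rect_upper.
Qed.

Lemma L2_sqr_rect u s t a b : 0 < s -> L2_slabs u ->
  leb2.-integrable (rect s t a b) (EFin \o (fun z => u z ^+ 2)).
Proof.
move=> s0 [_ /(_ s t s0)] ui.
apply: (@integrableS _ RR R leb2 (`[s, t]%classic `*` setT)) ui.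
- exact: measurableX.
- exact: measurable_rect.
- by move=> [r x] /= [].
Qed.

Lemma itg_rect_bounded s t a b (f : RR -> R) M : measurable_fun (rect s t a b) f ->
  (forall z, rect s t a b z -> `|f z| <= M) -> leb2.-integrable (rect s t a b) (EFin \o f).
Proof.
move=> mf fM; have h := itg_prod (itg_cst s t M) (itg_cst a b 1).
apply: (@itg_le _ RR R leb2 _ f (fun z => M * 1)) => //; first exact: measurable_rect.
by move=> z /fM; rewrite mulr1.
Qed.

Lemma L2_rect u s t a b : 0 < s -> L2_slabs u ->
  leb2.-integrable (rect s t a b) (EFin \o u).
Proof.
move=> s0 uL; have mD := measurable_rect s t a b.
have one : leb2.-integrable (rect s t a b) (EFin \o (fun=> 1 : R)).
  by apply: (@itg_rect_bounded _ _ _ _ (fun=> 1) 1) => // z _; rewrite normr1.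
apply: (@itg_le _ RR R leb2 _ u (fun z => 1 + u z ^+ 2)) => //.
- exact: L2_measurable_rect.
- move=> z _; rewrite -[u z ^+ 2]real_normK ?num_real//.
  by have := sqr_ge0 (`|u z| - 1); have := normr_ge0 (u z); nra.
- exact: (@itgD _ RR R leb2) mD one (L2_sqr_rect t a b s0 uL).
Qed.

Lemma continuous_rect_bounded u s t a b : 0 < s ->
  {within (@upper_half R), continuous u} ->
  exists2 M, 0 <= M & forall r x, s <= r <= t -> a <= x <= b -> `|u (r, x)| <= M.
Proof.
move=> s0 cu.
have cu' : {within rect s t a b, continuous u}.
  by apply: continuous_subspaceW cu; exact: rect_upper.
have : compact (u @` rect s t a b).
  by apply: continuous_compact => //; apply: compact_setX; exact: segment_compact.
move=> /compact_bounded[M [Mr h]]; exists (`|M| + 1); first by rewrite addr_ge0.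
move=> r x rst xab; apply: h; first by rewrite ltr_pwDr// ler_norm.
by exists (r, x) => //; split; rewrite /= in_itv.
Qed.

Lemma continuous_upper_at u r x : 0 < r -> {within (@upper_half R), continuous u} ->
  u (z.1, z.2) @[z --> (r, x)] --> u (r, x).
Proof.
move=> r0 cu.
have oU : open (@upper_half R).
  have -> : @upper_half R = fst @^-1` [set s | 0 < s] by [].
  apply: open_comp; last exact: open_gt.
  by move=> z _; exact: cvg_fst.
have -> : (fun z => u (z.1, z.2)) = u by apply/funext => -[].
by move: cu; rewrite continuous_open_subspace// => /(_ (r, x)); apply; rewrite inE.
Qed.

Lemma continuous_upper_t u r x : 0 < r -> {within (@upper_half R), continuous u} ->
  {for r, continuous (fun s => u (s, x))}.
Proof.
move=> r0 cu; apply: (continuous2_cvg _ (h := fun s y => u (s, y))).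
- exact: continuous_upper_at.
- exact: cvg_id.
- exact: cvg_cst.
Qed.

Lemma continuous_upper_x u r : 0 < r -> {within (@upper_half R), continuous u} ->
  continuous (fun x => u (r, x)).
Proof.
move=> r0 cu x; apply: (continuous2_cvg _ (h := fun s y => u (s, y))).
- exact: continuous_upper_at.
- exact: cvg_cst.
- exact: cvg_id.
Qed.

End UpperHalf.

(** * Product test functions and separation of the variables *)

Section WeakFormulation.
Context {R : realType}.
Local Notation leb := (@lebesgue_measure R).
Local Notation leb2 := (@leb2 R).
Local Notation RR := (measurableTypeR R * measurableTypeR R)%type.
Local Notation rect s t a b := (`[s, t]%classic `*` `[a, b]%classic).
Implicit Types (r x s t a b c d : R) (u : R * R -> R).

Lemma C1c_measurable a b (chi dchi : R -> R) : C1c a b chi dchi ->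
  measurable_fun [set: R] chi /\ measurable_fun [set: R] dchi.
Proof.
move=> [dP cd _ _]; split; apply: continuous_measurable_fun => //.
exact: is_derive_continuous dP.
Qed.

Lemma C1c_bounded a b (chi dchi : R -> R) : a <= b -> C1c a b chi dchi ->
  exists M, forall x, `|chi x| <= M /\ `|dchi x| <= M.
Proof.
move=> ab [dP cd chi0 dchi0].
have cchi := is_derive_continuous dP.
have [M1 h1] := continuous_itv_bounded ab cchi.
have [M2 h2] := continuous_itv_bounded ab cd.
have M10 : 0 <= M1 by apply: le_trans (h1 a _); rewrite ?lexx.
have M20 : 0 <= M2 by apply: le_trans (h2 a _); rewrite ?lexx.
exists (M1 + M2) => x; have [xab|xab] := boolP (a < x < b).
  have xab' : a <= x <= b by case/andP: xab => ? ?; rewrite !ltW.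
  by have := h1 x xab'; have := h2 x xab'; split; lra.
by rewrite chi0// dchi0// normr0 addr_ge0.
Qed.

Lemma partial_t_prod (chi dchi eta : R -> R) (z : R * R) : is_derive z.1 1 chi (dchi z.1) ->
  partial_t (fun z : R * R => chi z.1 * eta z.2) z = dchi z.1 * eta z.2.
Proof.
move=> h; rewrite /partial_t derive1E /=.
have h2 : is_derive z.1 1 (fun s : R => chi s * eta z.2) (dchi z.1 * eta z.2).
  rewrite (_ : (fun s : R => chi s * eta z.2) = (fun s : R => eta z.2 * chi s)).
    by apply: is_derive_eq; rewrite /GRing.scale/= mulrC.
  by apply/funext => s; rewrite mulrC.
exact: (@derive_val _ _ _ _ _ _ _ h2).
Qed.

Lemma partial_x_prod (chi eta deta : R -> R) (z : R * R) : is_derive z.2 1 eta (deta z.2) ->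
  partial_x (fun z : R * R => chi z.1 * eta z.2) z = chi z.1 * deta z.2.
Proof.
move=> h; rewrite /partial_x derive1E /=.
have h2 : is_derive z.2 1 (fun y : R => chi z.1 * eta y) (chi z.1 * deta z.2).
  by apply: is_derive_eq; rewrite /GRing.scale/=.
exact: (@derive_val _ _ _ _ _ _ _ h2).
Qed.

Lemma test_function_prod s t c d (chi dchi eta deta : R -> R) : 0 < s ->
  C1c s t chi dchi -> C1c c d eta deta ->
  test_function (fun z : R * R => chi z.1 * eta z.2).
Proof.
move=> s0 [chiP cdchi chi0 dchi0] [etaP cdeta eta0 deta0].
have contM (f g : R -> R) : continuous f -> continuous g ->
    continuous (fun z : R * R => f z.1 * g z.2).
  move=> cf cg z; apply: cvgM.
    by apply: (@continuous_comp _ _ _ fst f); [exact: cvg_fst|exact: cf].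
  by apply: (@continuous_comp _ _ _ snd g); [exact: cvg_snd|exact: cg].
have cchi := is_derive_continuous chiP; have ceta := is_derive_continuous etaP.
split.
- move=> z; split => /=.
    rewrite (_ : (fun s : R => chi s * eta z.2) = (fun s : R => eta z.2 * chi s)).
      by have h := chiP z.1; exact: ex_derive.
    by apply/funext => y; rewrite mulrC.
  by have h := etaP z.2; exact: ex_derive.
- exact: contM.
- rewrite (_ : partial_t _ = (fun z => dchi z.1 * eta z.2)); first exact: contM.
  by apply/funext => z; exact: partial_t_prod.
- rewrite (_ : partial_x _ = (fun z => chi z.1 * deta z.2)); first exact: contM.
  by apply/funext => z; exact: partial_x_prod.
- exists (rect s t c d); first split.
  + by apply: compact_setX; exact: segment_compact.
  + exact: rect_upper.
  + move=> [r x] /= h; have [rst|rst] := boolP (s < r < t); last by rewrite chi0 ?mul0r.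
    have [xcd|xcd] := boolP (c < x < d); last by rewrite eta0 ?mulr0.
    case: h; split; rewrite /= in_itv/=.
      by case/andP: rst => ? ?; rewrite !ltW.
    by case/andP: xcd => ? ?; rewrite !ltW.
Qed.

Lemma Rintegral_upper_rect s t c d (f : R * R -> R) : 0 < s ->
  (forall z, ~ rect s t c d z -> f z = 0) ->
  \int[leb2]_(z in @upper_half R) f z = \int[leb2]_(z in rect s t c d) f z.
Proof.
move=> s0 f0; rewrite Rintegral_mkcond [RHS]Rintegral_mkcond.
apply: eq_Rintegral => z _; rewrite !patchE.
case: ifPn => [_|/negP zu].
  by case: ifPn => // /negP zr; apply: f0 => h; apply: zr; exact/mem_set.
case: ifPn => // /set_mem zr; case: zu; apply/mem_set.
exact: (@rect_upper _ s t c d).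
Qed.

Lemma itg_rect_fst s t c d (k : R * R -> R) (p : R -> R) M :
  leb2.-integrable (rect s t c d) (EFin \o k) -> measurable_fun [set: R] p ->
  (forall r, `|p r| <= M) ->
  leb2.-integrable (rect s t c d) (EFin \o (fun z => k z * p z.1)).
Proof.
move=> ki mp pM; have mD := measurable_rect s t c d.
apply: (@itg_Mbnd _ RR R leb2 _ k (fun z => p z.1) M) => //.
apply: measurable_funTS.
exact: (measurableT_comp (mp : measurable_fun [set: measurableTypeR R] p)
  (@measurable_fst _ _ (measurableTypeR R) (measurableTypeR R))).
Qed.

Lemma itg_rect_snd s t c d (k : R * R -> R) (p : R -> R) M :
  leb2.-integrable (rect s t c d) (EFin \o k) -> measurable_fun [set: R] p ->
  (forall r, `|p r| <= M) ->
  leb2.-integrable (rect s t c d) (EFin \o (fun z => k z * p z.2)).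
Proof.
move=> ki mp pM; have mD := measurable_rect s t c d.
apply: (@itg_Mbnd _ RR R leb2 _ k (fun z => p z.2) M) => //.
apply: measurable_funTS.
exact: (measurableT_comp (mp : measurable_fun [set: measurableTypeR R] p)
  (@measurable_snd _ _ (measurableTypeR R) (measurableTypeR R))).
Qed.

Lemma itg_rectD s t c d (k l : R * R -> R) :
  leb2.-integrable (rect s t c d) (EFin \o k) ->
  leb2.-integrable (rect s t c d) (EFin \o l) ->
  leb2.-integrable (rect s t c d) (EFin \o (fun z => k z + l z)).
Proof. exact: (@itgD _ RR R leb2 _ k l (measurable_rect s t c d)). Qed.

Lemma fubini_time s t c d (k l : R * R -> R) (p q : R -> R) M :
  leb2.-integrable (rect s t c d) (EFin \o k) ->
  leb2.-integrable (rect s t c d) (EFin \o l) ->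
  measurable_fun [set: R] p -> (forall r, `|p r| <= M) ->
  measurable_fun [set: R] q -> (forall r, `|q r| <= M) ->
  \int[leb2]_(z in rect s t c d) (k z * p z.1 + l z * q z.1) =
  intg s t (fun r => intg c d (fun x => k (r, x)) * p r + intg c d (fun x => l (r, x)) * q r).
Proof.
move=> ki li mp pM mq qM.
have kpi := itg_rect_fst ki mp pM; have lqi := itg_rect_fst li mq qM.
have [h1 _ <- _ _] := fubini_rect (itg_rectD kpi lqi).
have [k1 _ _ _ [kae _]] := fubini_rect ki; have [l1 _ _ _ [lae _]] := fubini_rect li.
apply: ae_eq_Rintegral => //.
- exact: itg_measurable h1.
- apply: measurable_funD; apply: measurable_funM.
  + exact: itg_measurable k1.
  + exact: measurable_funTS.
  + exact: itg_measurable l1.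
  + exact: measurable_funTS.
apply: aeS2 kae lae => r kr lr /= rst; move: (kr rst) (lr rst) => {}kr {}lr.
rewrite -(intgZr (p r) kr) -(intgZr (q r) lr) intgD//.
- by apply: itg_ext (itg_itvZ (p r) kr) => x _; rewrite mulrC.
- by apply: itg_ext (itg_itvZ (q r) lr) => x _; rewrite mulrC.
Qed.

Lemma fubini_space s t c d (k l : R * R -> R) (p q : R -> R) M :
  leb2.-integrable (rect s t c d) (EFin \o k) ->
  leb2.-integrable (rect s t c d) (EFin \o l) ->
  measurable_fun [set: R] p -> (forall r, `|p r| <= M) ->
  measurable_fun [set: R] q -> (forall r, `|q r| <= M) ->
  \int[leb2]_(z in rect s t c d) (k z * p z.2 + l z * q z.2) =
  intg c d (fun x => intg s t (fun r => k (r, x)) * p x + intg s t (fun r => l (r, x)) * q x).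
Proof.
move=> ki li mp pM mq qM.
have kpi := itg_rect_snd ki mp pM; have lqi := itg_rect_snd li mq qM.
have [_ h1 _ <- _] := fubini_rect (itg_rectD kpi lqi).
have [_ k1 _ _ [_ kae]] := fubini_rect ki; have [_ l1 _ _ [_ lae]] := fubini_rect li.
apply: ae_eq_Rintegral => //.
- exact: itg_measurable h1.
- apply: measurable_funD; apply: measurable_funM.
  + exact: itg_measurable k1.
  + exact: measurable_funTS.
  + exact: itg_measurable l1.
  + exact: measurable_funTS.
apply: aeS2 kae lae => x kx lx /= xcd; move: (kx xcd) (lx xcd) => {}kx {}lx.
rewrite -(intgZr (p x) kx) -(intgZr (q x) lx) intgD//.
- by apply: itg_ext (itg_itvZ (p x) kx) => y _; rewrite mulrC.
- by apply: itg_ext (itg_itvZ (q x) lx) => y _; rewrite mulrC.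
Qed.

(** The du Bois-Reymond lemma in time: the slice integrals of [k1] have those of [k2] as density.
    Continuity of the former gives a meaning to the values at the end points, where every test
    function vanishes. *)
Lemma time_slices s t c d (k1 k2 : R * R -> R) : s < t ->
  leb2.-integrable (rect s t c d) (EFin \o k1) ->
  leb2.-integrable (rect s t c d) (EFin \o k2) ->
  {within `[s, t], continuous (fun r => intg c d (fun x => k1 (r, x)))} ->
  (forall chi dchi, C1c s t chi dchi ->
    \int[leb2]_(z in rect s t c d) (k1 z * dchi z.1 + k2 z * chi z.1) = 0) ->
  intg c d (fun x => k1 (t, x)) - intg c d (fun x => k1 (s, x)) =
  \int[leb2]_(z in rect s t c d) k2 z.
Proof.
move=> st k1i k2i ck1 h.
have [k2t _ <- _ _] := fubini_rect k2i.
have A := @du_bois_reymond_continuous _ s t (fun r => intg c d (fun x => k1 (r, x)))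
  (fun r => intg c d (fun x => k2 (r, x))) st ck1 k2t.
rewrite (AC_diff (A _) (lexx s) (ltW st) (lexx t)).
  by rewrite addrAC subrr add0r.
move=> chi dchi Cchi; have [mchi mdchi] := C1c_measurable Cchi.
have [M hM] := C1c_bounded (ltW st) Cchi.
rewrite -(@fubini_time _ _ _ _ _ _ _ _ M)//.
- exact: h.
- by move=> r; case: (hM r).
- by move=> r; case: (hM r).
Qed.

End WeakFormulation.

(** * Integrals with a parameter and square integrable averages in time *)

Section Averages.
Context {R : realType}.
Local Notation leb := (@lebesgue_measure R).
Local Notation leb2 := (@leb2 R).
Local Notation RR := (measurableTypeR R * measurableTypeR R)%type.
Local Notation rect s t a b := (`[s, t]%classic `*` `[a, b]%classic).
Implicit Types (r x s t S T a b c d : R).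

Lemma continuous_intg_param (f : R -> R -> R) a b c d M :
  (forall r, a < r < b -> measurable_fun `[c, d] (f r)) ->
  (forall r x, a < r < b -> c <= x <= d -> `|f r x| <= M) ->
  (forall r x, a < r < b -> c <= x <= d -> {for r, continuous (fun r' => f r' x)}) ->
  forall r, a < r < b -> {for r, continuous (fun r' => intg c d (f r'))}.
Proof.
move=> mf fM cf r rab.
have Iab q : `]a, b[%classic q -> a < q < b by rewrite /= in_itv.
have Icd q : `[c, d]%classic q -> c <= q <= d by rewrite /= in_itv.
have intf q : `]a, b[%classic q -> leb.-integrable `[c, d] (EFin \o f q).
  by move=> /Iab qab; apply: (itg_bounded (mf _ qab)) => x; exact: fM.
have caf : {ae leb, forall x, `[c, d]%classic x -> {in `]a, b[%classic, continuous (f ^~ x)}}.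
  by apply: aeW => x /Icd xcd q /set_mem/Iab qab; exact: cf.
have fub q : `]a, b[%classic q -> {ae leb, forall x, `[c, d]%classic x -> `|f q x| <= cst M x}.
  by move=> /Iab qab; apply: aeW => x /Icd xcd; exact: fM.
have := @continuity_under_integral R _ (measurableTypeR R) leb f `[c, d]
  (measurable_itv _) a b intf caf (cst M) (itg_cst _ _ _) fub.
by apply; rewrite inE /= in_itv.
Qed.

Lemma sqr_intg_le s t (g : R -> R) : s < t -> itg s t g -> itg s t (fun r => g r ^+ 2) ->
  intg s t g ^+ 2 <= (t - s) * intg s t (fun r => g r ^+ 2).
Proof.
move=> st gi g2i; have ts : 0 < t - s by rewrite subr_gt0.
(* The mean of [g]: the Cauchy-Schwarz inequality is the nonnegativity of the variance. *)
pose k := intg s t g / (t - s).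
have i1 : itg s t (fun r => 2 * k * g r) by exact: itg_itvZ.
have : 0 <= intg s t (fun r => g r ^+ 2 - 2 * k * g r + k ^+ 2).
  apply: intg_ge0 => r _; have -> : g r ^+ 2 - 2 * k * g r + k ^+ 2 = (g r - k) ^+ 2 by ring.
  exact: sqr_ge0.
rewrite intgD; [|exact: itg_itvB|exact: itg_cst].
rewrite intgB// intgZ// (intg_cst _ (ltW st)).
have -> : intg s t g = k * (t - s) by rewrite /k divfK// gt_eqF.
move=> h; have -> : (k * (t - s)) ^+ 2 = (t - s) * (k ^+ 2 * (t - s)) by ring.
by rewrite ler_wpM2l ?(ltW ts)//; move: h; move: (intg _ _ _) => I h; nra.
Qed.

Lemma itg_ae_dom a b (f g : R -> R) : measurable_fun `[a, b] f -> itg a b g ->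
  {ae leb, forall x, `[a, b]%classic x -> `|f x| <= g x} -> itg a b f.
Proof.
move=> mf gi fg; have mg := itg_measurable gi.
apply/integrableP; split; first exact/measurable_EFinP.
have /integrableP[_] := gi; apply: le_lt_trans.
apply: ae_ge0_le_integral => //.
- by apply: measurableT_comp => //; exact/measurable_EFinP.
- by apply: measurableT_comp => //; exact/measurable_EFinP.
apply: aeS fg => x fg /fg h; rewrite /= lee_fin; apply: le_trans h _; exact: ler_norm.
Qed.

Lemma itg_ae_eq (D : set R) (f g : R -> R) : measurable D -> measurable_fun D g ->
  {ae leb, forall x, f x = g x} -> leb.-integrable D (EFin \o f) ->
  leb.-integrable D (EFin \o g).
Proof.
move=> mD mg fg fi; have mf := itg_measurable fi.
apply/integrableP; split; first exact/measurable_EFinP.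
have /integrableP[_] := fi; apply: le_lt_trans.
apply: ae_ge0_le_integral => //.
- by apply: measurableT_comp => //; exact/measurable_EFinP.
- by apply: measurableT_comp => //; exact/measurable_EFinP.
by apply: aeS fg => x fg _ /=; rewrite fg.
Qed.

(** Cauchy-Schwarz in time on almost every vertical section. The integral over the whole slab makes
    the bound independent of [c] and [d], and of the window inside [S, T] but for its length. *)
Lemma L2_average (f : R * R -> R) S T s t c d : L2_slabs f -> 0 < S -> S <= s -> s < t -> t <=
  T ->
  itg c d (fun x => intg s t (fun r => f (r, x)) ^+ 2) /\
  intg c d (fun x => intg s t (fun r => f (r, x)) ^+ 2) <=
    (t - s) * \int[leb2]_(z in `[S, T]%classic `*` setT) (f z ^+ 2).
Proof.
move=> fL S0 Ss st tT; have s0 : 0 < s by exact: lt_le_trans Ss.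
have fi := L2_rect t c d s0 fL; have f2i := L2_sqr_rect t c d s0 fL.
have [_ F1 _ _ [_ Fae]] := fubini_rect fi.
have [_ G1 _ GE [_ Gae]] := fubini_rect f2i.
have h : {ae leb, forall x, `[c, d]%classic x ->
    intg s t (fun r => f (r, x)) ^+ 2 <= (t - s) * intg s t (fun r => f (r, x) ^+ 2)}.
  apply: aeS2 Fae Gae => x Fx Gx xcd; apply: sqr_intg_le => //.
  - exact: Fx.
  - exact: Gx.
have i2 : itg c d (fun x => intg s t (fun r => f (r, x)) ^+ 2).
  apply: itg_ae_dom (itg_itvZ (t - s) G1) _.
    by apply: measurable_funX; exact: itg_measurable F1.
  by apply: aeS h => x h xcd; rewrite ger0_norm ?sqr_ge0//; exact: h.
split => //; apply: (@le_trans _ _ (intg c d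
    (fun x => (t - s) * intg s t (fun r => f (r, x) ^+ 2)))).
  by apply: ae_le_Rintegral => //; exact: itg_itvZ.
rewrite intgZ// GE ler_wpM2l ?subr_ge0 ?(ltW st)//.
have [_ /(_ S T S0) slab] := fL.
have mslab : measurable (`[S, T]%classic `*` setT : set RR) by exact: measurableX.
rewrite /Rintegral fine_le//.
- exact: (integrable_fin_num (measurable_rect s t c d) f2i).
- exact: (integrable_fin_num mslab slab).
apply: ge0_subset_integral => //.
- exact: measurable_rect.
- by have := measurable_int _ slab.
- by move=> z _; rewrite lee_fin sqr_ge0.
- move=> [r x] /= []; rewrite in_itv/= => /andP[sr rt] _; split => //.
  by rewrite in_itv/= (le_trans Ss sr) (le_trans rt tT).
Qed.

End Averages.

(** * The equation on a rectangle and its invariance under null sets *)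

Section WeakSolutionOnRectangles.
Context {R : realType}.
Local Notation leb := (@lebesgue_measure R).
Local Notation leb2 := (@leb2 R).
Local Notation RR := (measurableTypeR R * measurableTypeR R)%type.
Local Notation rect s t a b := (`[s, t]%classic `*` `[a, b]%classic).
Implicit Types (s t c d W : R) (nu a chi dchi eta deta : R -> R) (u ux : R * R -> R).

Lemma weak_solution_rect W nu a u ux s t c d chi dchi eta deta :
  (forall phi, test_function phi ->
    \int[leb2]_(z in @upper_half R)
      (- (nu z.2 * u z * partial_t phi z)
       + nu z.2 * a z.2 * ux z * partial_x phi z
       + W * ux z * phi z) = 0) ->
  0 < s -> C1c s t chi dchi -> C1c c d eta deta ->
  \int[leb2]_(z in rect s t c d)
    (- (nu z.2 * u z * (dchi z.1 * eta z.2))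
     + nu z.2 * a z.2 * ux z * (chi z.1 * deta z.2)
     + W * ux z * (chi z.1 * eta z.2)) = 0.
Proof.
move=> weak s0 Cchi Ceta; have T := test_function_prod s0 Cchi Ceta.
have [chiP _ chi0 dchi0] := Cchi; have [etaP _ eta0 deta0] := Ceta.
rewrite -[RHS](weak _ T) [RHS](@Rintegral_upper_rect _ s t c d)//.
  apply: eq_Rintegral => z _.
  by rewrite (@partial_x_prod _ _ _ deta)// (@partial_t_prod _ _ dchi).
move=> z h; rewrite (@partial_x_prod _ _ _ deta)// (@partial_t_prod _ _ dchi)//.
have [rst|rst] := boolP (s < z.1 < t); last first.
  by rewrite chi0// dchi0// !mul0r !mulr0 oppr0 !addr0.
have [xcd|xcd] := boolP (c < z.2 < d); last first.
  by rewrite eta0// deta0// !mulr0 oppr0 !addr0.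
case: h; split; rewrite /= in_itv/=.
  by case/andP: rst => ? ?; rewrite !ltW.
by case/andP: xcd => ? ?; rewrite !ltW.
Qed.

Lemma ae_snd (Q : R -> Prop) : {ae leb, forall x, Q x} ->
  {ae (leb \x leb)%E, forall z : RR, Q z.2}.
Proof.
move=> [N [mN N0 QN]]; exists (setT `*` N); split.
- exact: measurableX.
- by rewrite product_measure1E//= N0 mule0.
- by move=> z /= nQ; split => //; exact: QN.
Qed.

Lemma measurable_rect_fst s t c d (f : R -> R) : measurable_fun [set: R] f ->
  measurable_fun (rect s t c d : set RR) (fun z : RR => f z.1).
Proof.
move=> mf; apply: measurable_funTS.
exact: (measurableT_comp (mf : measurable_fun [set: measurableTypeR R] f)
  (@measurable_fst _ _ (measurableTypeR R) (measurableTypeR R))).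
Qed.

Lemma measurable_rect_snd s t c d (f : R -> R) : measurable_fun [set: R] f ->
  measurable_fun (rect s t c d : set RR) (fun z : RR => f z.2).
Proof.
move=> mf; apply: measurable_funTS.
exact: (measurableT_comp (mf : measurable_fun [set: measurableTypeR R] f)
  (@measurable_snd _ _ (measurableTypeR R) (measurableTypeR R))).
Qed.

(** A null set of [x] spans a null cylinder in the plane; this transfers the equation to the clamped
    coefficients. *)
Lemma weak_integral_ae W nu nu' a a' u ux s t c d chi dchi eta deta :
  measurable_fun [set: R] nu -> measurable_fun [set: R] nu' ->
  measurable_fun [set: R] a -> measurable_fun [set: R] a' ->
  {ae leb, forall x, nu x = nu' x /\ a x = a' x} ->
  L2_slabs u -> L2_slabs ux -> 0 < s -> C1c s t chi dchi -> C1c c d eta deta ->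
  \int[leb2]_(z in rect s t c d)
    (- (nu z.2 * u z * (dchi z.1 * eta z.2))
     + nu z.2 * a z.2 * ux z * (chi z.1 * deta z.2)
     + W * ux z * (chi z.1 * eta z.2)) =
  \int[leb2]_(z in rect s t c d)
    (- (nu' z.2 * u z * (dchi z.1 * eta z.2))
     + nu' z.2 * a' z.2 * ux z * (chi z.1 * deta z.2)
     + W * ux z * (chi z.1 * eta z.2)).
Proof.
move=> mnu mnu' ma ma' E uL uxL s0 Cchi Ceta.
have [mchi mdchi] := C1c_measurable Cchi; have [meta mdeta] := C1c_measurable Ceta.
have mu : measurable_fun (rect s t c d : set RR) (u : RR -> R) by exact: L2_measurable_rect.
have mux : measurable_fun (rect s t c d : set RR) (ux : RR -> R) by exact: L2_measurable_rect.
have m (n b : R -> R) : measurable_fun [set: R] n -> measurable_fun [set: R] b ->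
    measurable_fun (rect s t c d : set RR) (fun z : RR =>
     - (n z.2 * u z * (dchi z.1 * eta z.2))
     + n z.2 * b z.2 * ux z * (chi z.1 * deta z.2)
     + W * ux z * (chi z.1 * eta z.2)).
  move=> mn mb.
  have n2 : measurable_fun (rect s t c d : set RR) (fun z : RR => n z.2)
    by exact: measurable_rect_snd.
  have b2 : measurable_fun (rect s t c d : set RR) (fun z : RR => b z.2)
    by exact: measurable_rect_snd.
  have c1 : measurable_fun (rect s t c d : set RR) (fun z : RR => chi z.1)
    by exact: measurable_rect_fst.
  have dc1 : measurable_fun (rect s t c d : set RR) (fun z : RR => dchi z.1)
    by exact: measurable_rect_fst.
  have e2 : measurable_fun (rect s t c d : set RR) (fun z : RR => eta z.2)
    by exact: measurable_rect_snd.
  have de2 : measurable_fun (rect s t c d : set RR) (fun z : RR => deta z.2)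
    by exact: measurable_rect_snd.
  apply: measurable_funD; first apply: measurable_funD.
  - apply: measurableT_comp => //; apply: measurable_funM; exact: measurable_funM.
  - apply: measurable_funM; last exact: measurable_funM.
    by apply: measurable_funM => //; exact: measurable_funM.
  - apply: measurable_funM; last exact: measurable_funM.
    exact: measurable_funM.
apply: (@ae_eq_Rintegral _ RR R (leb \x leb)%E).
- exact: measurable_rect.
- exact: m.
- exact: m.
- by apply: aeS (ae_snd E) => z [-> ->].
Qed.

End WeakSolutionOnRectangles.

(** * The kernel bound for coefficients bounded at every point *)

Section HeatKernelBound.
Context {R : realType}.
Local Notation leb := (@lebesgue_measure R).
Local Notation leb2 := (@leb2 R).
Local Notation RR := (measurableTypeR R * measurableTypeR R)%type.
Local Notation rect s t a b := (`[s, t]%classic `*` `[a, b]%classic).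
Implicit Types (r q x s t S T c d n h L : R).
Variables (mu W y : R) (nu a : R -> R) (u ux : R * R -> R).
Hypothesis mu1 : 1 <= mu.
Hypothesis mnu : measurable_fun [set: R] nu.
Hypothesis ma : measurable_fun [set: R] a.
Hypothesis nuP : forall x, mu^-1 <= nu x <= mu.
Hypothesis aP : forall x, mu^-1 <= a x <= mu.
Hypothesis u_cont : {within (@upper_half R), continuous u}.
Hypothesis u_ge0 : forall z, upper_half z -> 0 <= u z.
Hypothesis uL : L2_slabs u.
Hypothesis uxL : L2_slabs ux.
Hypothesis u_weak_x : weak_partial_x u ux.
Hypothesis u_weak : forall s t c d chi dchi eta deta, 0 < s ->
  C1c s t chi dchi -> C1c c d eta deta ->
  \int[leb2]_(z in rect s t c d)
    (- (nu z.2 * u z * (dchi z.1 * eta z.2))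
     + nu z.2 * a z.2 * ux z * (chi z.1 * deta z.2)
     + W * ux z * (chi z.1 * eta z.2)) = 0.
Hypothesis u_init : initial_dirac nu y u.

Let mu0 : 0 < mu. Proof. exact: lt_le_trans mu1. Qed.
Let nu0 x : 0 < nu x.
Proof. by have /andP[h _] := nuP x; apply: lt_le_trans h; rewrite invr_gt0. Qed.
Let a0 x : 0 < a x.
Proof. by have /andP[h _] := aP x; apply: lt_le_trans h; rewrite invr_gt0. Qed.
Let nu_bound x : `|nu x| <= mu.
Proof. by rewrite ger0_norm ?(ltW (nu0 _))//; case/andP: (nuP x). Qed.

Let b x := nu x * a x.
Let mb : measurable_fun [set: R] b. Proof. exact: measurable_funM. Qed.
Let bP x : (mu ^+ 2)^-1 <= b x <= mu ^+ 2.
Proof.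
have /andP[n1 n2] := nuP x; have /andP[a1 a2] := aP x.
rewrite expr2 invfM; apply/andP; split; apply: ler_pM => //; rewrite ?invr_ge0 ltW//.
Qed.
Let b_bound x : `|b x| <= mu ^+ 2.
Proof. by rewrite ger0_norm; [case/andP: (bP x)|rewrite mulr_ge0// ltW]. Qed.

Let U s t x := intg s t (fun r => u (r, x)).
Let D s t x := intg s t (fun r => ux (r, x)).

Let meas_t x s t : 0 < s -> measurable_fun `[s, t] (fun r => u (r, x)).
Proof.
move=> s0; apply: subspace_continuous_measurable_fun => //.
apply: continuous_in_subspaceT => r /set_mem/=; rewrite in_itv/= => /andP[sr _].
by apply: continuous_upper_t u_cont; exact: lt_le_trans sr.
Qed.

Let meas_x t : 0 < t -> measurable_fun [set: R] (fun x => u (t, x)).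
Proof. by move=> t0; apply: continuous_measurable_fun; exact: continuous_upper_x u_cont. Qed.

(** The weak derivative in space-time, tested with [chi(t) eta(x)]: eliminating [chi] gives a weak
    derivative for the average over the window, and eliminating [eta] a density. *)
Let U_AC s t c d : 0 < s -> s < t -> c < d -> abs_cont c d (U s t) (D s t).
Proof.
move=> s0 st cd.
have ui := L2_rect t c d s0 uL; have uxi := L2_rect t c d s0 uxL.
have [_ Di _ _ _] := fubini_rect uxi.
apply: du_bois_reymond_continuous => //.
  apply: continuous_in_subspaceT => x /set_mem/=; rewrite in_itv/= => /andP[cx xd].
  have [M _ hM] := continuous_rect_bounded t (c - 1) (d + 1) s0 u_cont.
  apply: (@continuous_intg_param _ (fun x r => u (r, x)) (c - 1) (d + 1) s t M).
  - by move=> x' _; exact: meas_t.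
  - move=> x' r /andP[? ?] rst; apply: hM => //; apply/andP; split; lra.
  - move=> x' r _ /andP[sr _]; apply: continuous_upper_x u_cont _.
    exact: lt_le_trans sr.
  - by apply/andP; split; lra.
move=> eta deta Ceta; have [meta mdeta] := C1c_measurable Ceta.
have [M hM] := C1c_bounded (ltW cd) Ceta.
have hM1 x : `|eta x| <= M by case: (hM x).
have hM2 x : `|deta x| <= M by case: (hM x).
(* No time derivative occurs here; with 0 in its place [time_slices] says that the integral over the
   rectangle vanishes. *)
have k1i : leb2.-integrable (rect s t c d) (EFin \o (fun=> 0 : R)).
  by apply: (@itg_rect_bounded _ _ _ _ _ (fun=> 0) 0) => // z _; rewrite normr0.
have k2i := itg_rectD (itg_rect_snd ui mdeta hM2) (itg_rect_snd uxi meta hM1).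
rewrite -(fubini_space ui uxi mdeta hM2 meta hM1).
rewrite -(time_slices st k1i k2i).
- by rewrite subrr.
- by apply: continuous_subspaceT; exact: cst_continuous.
move=> chi dchi Cchi; have T := test_function_prod s0 Cchi Ceta.
have [mchi mdchi] := C1c_measurable Cchi.
have [M' hM'] := C1c_bounded (ltW st) Cchi.
have hM1' r : `|chi r| <= M' by case: (hM' r).
have [chiP _ chi0 _] := Cchi; have [etaP _ eta0 deta0] := Ceta.
have out (f : R * R -> R) (g : R -> R) z : (forall x, ~~ (c < x < d) -> g x = 0) ->
    ~ rect s t c d z -> f z * (chi z.1 * g z.2) = 0.
  move: z => [r x] /= g0 h; have [rst|rst] := boolP (s < r < t); last first.
    by rewrite chi0 ?mul0r ?mulr0.
  have [xcd|xcd] := boolP (c < x < d); last by rewrite g0 ?mulr0.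
  case: h; split; rewrite /= in_itv/=.
    by case/andP: rst => ? ?; rewrite !ltW.
  by case/andP: xcd => ? ?; rewrite !ltW.
have := u_weak_x T.
rewrite (@Rintegral_upper_rect _ s t c d) => //; last first.
  by move=> z h; rewrite (@partial_x_prod _ _ _ deta)// out.
rewrite (@Rintegral_upper_rect _ s t c d) => //; last by move=> z h; rewrite out.
have i1 : leb2.-integrable (rect s t c d) (EFin \o (fun z => u z * deta z.2 * chi z.1)).
  exact: itg_rect_fst (itg_rect_snd ui mdeta hM2) mchi hM1'.
have i2 : leb2.-integrable (rect s t c d) (EFin \o (fun z => ux z * eta z.2 * chi z.1)).
  exact: itg_rect_fst (itg_rect_snd uxi meta hM1) mchi hM1'.
move=> /eqP; rewrite -subr_eq0 opprK => /eqP E.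
rewrite -[RHS]E -(@RintegralD _ RR R leb2); first last.
- by apply: (@itg_eq _ RR R leb2 _ _ _ (measurable_rect s t c d) _ i2) => z _; ring.
- apply: (@itg_eq _ RR R leb2 _ _ _ (measurable_rect s t c d) _ i1) => z _.
  by rewrite (@partial_x_prod _ _ _ deta)//; ring.
- exact: measurable_rect.
by apply: eq_Rintegral => z _; rewrite (@partial_x_prod _ _ _ deta)//; ring.
Qed.

(** The equation integrated over the window: the time derivative becomes a difference of two slices,
    and what is left is the weak form of an ODE in [x] for the flux. *)
Let flux_weak s t c d (eta deta : R -> R) : 0 < s -> s < t -> c < d -> C1c c d eta deta ->
  intg c d (fun x => b x * D s t x * deta x +
    (nu x * (u (t, x) - u (s, x)) + W * D s t x) * eta x) = 0.
Proof.
move=> s0 st cd Ceta; have [meta mdeta] := C1c_measurable Ceta.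
have [M hM] := C1c_bounded (ltW cd) Ceta.
have M0 : 0 <= M by case: (hM c) => + _; exact: le_trans.
have hM1 x : `|eta x| <= M by case: (hM x).
have hM2 x : `|deta x| <= M by case: (hM x).
have t0 := lt_trans s0 st.
have ui := L2_rect t c d s0 uL; have uxi := L2_rect t c d s0 uxL.
have [_ Di _ _ _] := fubini_rect uxi.
(* In these weights the tested integrand is [u g] times [dchi] plus [ux p + ux q] times [chi], the
   shape that [time_slices] expects. *)
pose p x := b x * deta x; pose q x := W * eta x; pose g x := - (nu x * eta x).
pose M1 := mu ^+ 2 * M + `|W| * M + mu * M.
have mp : measurable_fun [set: R] p by exact: measurable_funM.
have mq : measurable_fun [set: R] q by exact: measurable_funM.
have mg : measurable_fun [set: R] g.
  by apply: measurableT_comp => //; exact: measurable_funM.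
have h1 : 0 <= mu ^+ 2 * M by rewrite mulr_ge0// exprn_ge0// ltW.
have h2 : 0 <= `|W| * M by rewrite mulr_ge0.
have h3 : 0 <= mu * M by rewrite mulr_ge0// ltW.
have pM x : `|p x| <= M1.
  have : `|p x| <= mu ^+ 2 * M by rewrite normrM; exact: ler_pM.
  by rewrite /M1; lra.
have qM x : `|q x| <= M1.
  have : `|q x| <= `|W| * M by rewrite normrM; exact: ler_pM.
  by rewrite /M1; lra.
have gM x : `|g x| <= M1.
  have : `|g x| <= mu * M by rewrite normrN normrM; exact: ler_pM.
  by rewrite /M1; lra.
have k1i := itg_rect_snd ui mg gM.
have k2i := itg_rectD (itg_rect_snd uxi mp pM) (itg_rect_snd uxi mq qM).
have ck1 : {within `[s, t], continuous (fun r => intg c d (fun x => u (r, x) * g x))}.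
  apply: continuous_in_subspaceT => r /set_mem/=; rewrite in_itv/= => /andP[sr rt].
  have s20 : 0 < s / 2 by rewrite divr_gt0.
  have [B B0 hB] := continuous_rect_bounded (t + 1) c d s20 u_cont.
  have I0 r' : s / 2 < r' < t + 1 -> 0 < r' by case/andP => ? _; lra.
  apply: (@continuous_intg_param _ (fun r x => u (r, x) * g x) (s / 2) (t + 1) c d (B * M1)).
  - move=> r' /I0 r'0; apply: measurable_funTS; apply: measurable_funM => //.
    exact: meas_x.
  - move=> r' x rI xI; rewrite normrM; apply: ler_pM => //; apply: hB => //.
    by case/andP: rI => ? ?; rewrite !ltW.
  - move=> r' x /I0 r'0 _; apply: continuousM; last exact: cst_continuous.
    exact: continuous_upper_t u_cont.
  - by apply/andP; split; lra.
have key := time_slices st k1i k2i ck1.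
have uxt : itg c d (fun x => u (t, x) * g x).
  apply: (@itg_ext _ _ _ (fun x => g x * u (t, x))); first by move=> x _; rewrite mulrC.
  apply: (itg_bndM (M := M1)) => //; first exact: measurable_funTS.
  by apply: itg_continuous; apply: continuous_subspaceT; exact: continuous_upper_x u_cont.
have uxs : itg c d (fun x => u (s, x) * g x).
  apply: (@itg_ext _ _ _ (fun x => g x * u (s, x))); first by move=> x _; rewrite mulrC.
  apply: (itg_bndM (M := M1)) => //; first exact: measurable_funTS.
  by apply: itg_continuous; apply: continuous_subspaceT; exact: continuous_upper_x u_cont.
have DpI : itg c d (fun x => D s t x * p x).
  apply: (@itg_ext _ _ _ (fun x => p x * D s t x)); first by move=> x _; rewrite mulrC.
  by apply: (itg_bndM (M := M1)) => //; exact: measurable_funTS.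
have DqI : itg c d (fun x => D s t x * q x).
  apply: (@itg_ext _ _ _ (fun x => q x * D s t x)); first by move=> x _; rewrite mulrC.
  by apply: (itg_bndM (M := M1)) => //; exact: measurable_funTS.
transitivity (intg c d (fun x => (D s t x * p x + D s t x * q x) -
    (u (t, x) * g x - u (s, x) * g x))).
  by apply: eq_intg => x _; rewrite /p /q /g; ring.
rewrite intgB; [|exact: itg_itvD|exact: itg_itvB].
rewrite (intgB uxt uxs) key; last first.
  move=> chi dchi Cchi; rewrite -[RHS](u_weak s0 Cchi Ceta).
  by apply: eq_Rintegral => z _; rewrite /p /q /g /b; ring.
rewrite (fubini_space uxi uxi mp pM mq qM); exact: subrr.
Qed.

Let flux s t L : 0 < s -> s < t -> 0 < L -> exists G,
  abs_cont (- L) L G (fun x => nu x * (u (t, x) - u (s, x)) + W * D s t x) /\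
  {ae leb, forall x, - L <= x <= L -> b x * D s t x = G x}.
Proof.
move=> s0 st L0; have LL : - L < L by lra.
have t0 := lt_trans s0 st.
have Di := (U_AC s0 st LL).1.
have bDi : itg (- L) L (fun x => b x * D s t x).
  by apply: (itg_bndM (M := mu ^+ 2)) => //; exact: measurable_funTS.
have ci q : 0 < q -> itg (- L) L (fun x => u (q, x)).
  by move=> q0; apply: itg_continuous; apply: continuous_subspaceT;
    exact: continuous_upper_x u_cont.
have ni : itg (- L) L (fun x => nu x * (u (t, x) - u (s, x)) + W * D s t x).
  apply: itg_itvD; last exact: itg_itvZ.
  apply: (itg_bndM (M := mu)) => //; first exact: measurable_funTS.
  by apply: itg_itvB; exact: ci.
have [K hK] := du_bois_reymond LL bDi ni (fun eta deta => flux_weak s0 st LL).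
exists (fun x => K + intg (- L) x (fun x => nu x * (u (t, x) - u (s, x)) + W * D s t x)).
by split => //; split => // x _; rewrite intg_pt addr0.
Qed.

Let mass t := \int[leb]_(x in [set: R]) (nu x * u (t, x)).

Let mass_itg t : 0 < t -> leb.-integrable [set: R] (EFin \o (fun x => nu x * u (t, x))).
Proof. by move=> t0; case: u_init => + _; apply. Qed.

Let mass_itv t c d : 0 < t -> itg c d (fun x => nu x * u (t, x)).
Proof.
by move=> t0; have := mass_itg t0; apply: integrableS => //; exact: subsetT.
Qed.

Let nuu_ge0 t x : 0 < t -> 0 <= nu x * u (t, x).
Proof. by move=> t0; rewrite mulr_ge0 ?(ltW (nu0 _))// u_ge0. Qed.

Let intg_le_mass t c d : 0 < t -> intg c d (fun x => nu x * u (t, x)) <= mass t.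
Proof.
move=> t0; rewrite /mass /intg Rintegral_mkcond; apply: le_Rintegral => //.
- rewrite -restrict_EFin; exact: (integrable_mkcond _ _).1 (mass_itv c d t0).
- exact: mass_itg.
- by move=> x _; rewrite patchE; case: ifPn => // _; exact: nuu_ge0.
Qed.

Let AMGM (k w' : R) : 0 < k -> `|w'| <= k * w' ^+ 2 + k^-1.
Proof.
move=> k0; rewrite -[w' ^+ 2]real_normK ?num_real//; set z := `|w'|.
have -> : k * z ^+ 2 + k^-1 = k * (z - k^-1) ^+ 2 + 2 * z by field; rewrite gt_eqF.
have h1 : 0 <= k * (z - k^-1) ^+ 2 by rewrite mulr_ge0 ?sqr_ge0// ltW.
have h2 : 0 <= z by exact: normr_ge0.
lra.
Qed.

(* The flux term tested against a cutoff of width n is O(n^(-1/2)), as U and D are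
   square integrable. *)
Let mass_mono s t L : 0 < s -> s < t -> 0 < L ->
  intg (- L) L (fun x => nu x * u (t, x)) <= mass s.
Proof.
move=> s0 st L0; have t0 := lt_trans s0 st.
pose Q := (t - s) * \int[leb2]_(z in `[s, t]%classic `*` setT) (u z ^+ 2) +
  (t - s) * \int[leb2]_(z in `[s, t]%classic `*` setT) (ux z ^+ 2).
have UD2 c d : itg c d (fun x => U s t x ^+ 2 + D s t x ^+ 2) /\
    intg c d (fun x => U s t x ^+ 2 + D s t x ^+ 2) <= Q.
  have [i1 l1] := L2_average c d uL s0 (lexx s) st (lexx t).
  have [i2 l2] := L2_average c d uxL s0 (lexx s) st (lexx t).
  by split; [exact: itg_itvD|rewrite intgD// lerD].
have Q0 : 0 <= Q.
  apply: le_trans (UD2 0 0).2; apply: intg_ge0 => x _.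
  by rewrite addr_ge0 ?sqr_ge0.
pose C := mu ^+ 2 + `|W|.
have C0 : 0 < C by rewrite ltr_wpDr// exprn_gt0.
apply/ler_addgt0Pl => e e0; rewrite addrC.
(* In the bound by [k w^2 + 1/k], the constant part over length [6 * n], times [C / n], gives
   exactly [e / 2] for this [k]; a large [n] then makes the quadratic part at most [e / 2]. *)
pose k := 12 * C / e; have k0 : 0 < k by rewrite divr_gt0// mulr_gt0.
pose n := Num.max (Num.max 1 L) (2 * C * k * Q / e).
have n1 : 1 <= n by rewrite /n !le_max lexx.
have nL : L <= n by rewrite /n !le_max lexx orbT.
have nQ : 2 * C * k * Q / e <= n by rewrite /n le_max lexx orbT.
have n0 : 0 < n by exact: lt_le_trans n1.
have LL : - (3 * n) < 3 * n by lra.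
have Ceta := C1c_cutoff n0; have [etaP cdeta eta0 _] := Ceta.
have etaA : abs_cont (- (3 * n)) (3 * n) (cutoff n) (dcutoff n) by exact: AC_derivable.
have UA := U_AC s0 st LL; have Di := UA.1.
have meta : measurable_fun `[- (3 * n), 3 * n] (cutoff n) by exact: AC_measurable etaA.
have mdeta : measurable_fun `[- (3 * n), 3 * n] (dcutoff n) by exact: itg_measurable etaA.1.
have eta1 x : `|cutoff n x| <= 1 by rewrite ger0_norm ?cutoff_ge0 ?cutoff_le1.
have Mi q : 0 < q -> itg (- (3 * n)) (3 * n) (fun x => cutoff n x * (nu x * u (q, x))).
  move=> q0; apply: (itg_bndM (M := 1)) => //.
  exact: mass_itv.
have Dd : itg (- (3 * n)) (3 * n) (fun x => dcutoff n x * D s t x).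
  by apply: (itg_bndM (M := n^-1) mdeta _ Di) => x _; exact: dcutoff_le.
have bDd : itg (- (3 * n)) (3 * n) (fun x => b x * (dcutoff n x * D s t x)).
  by apply: (itg_bndM (M := mu ^+ 2)) => //; exact: measurable_funTS.
have De : itg (- (3 * n)) (3 * n) (fun x => cutoff n x * D s t x).
  exact: (itg_bndM (M := 1)).
have dU : itg (- (3 * n)) (3 * n) (fun x => dcutoff n x * U s t x).
  exact: AC_itgM UA etaA.1.
(* The drift carries the cutoff itself; integration by parts moves the derivative onto it and gains
   the factor 1/n. *)
have ibp : intg (- (3 * n)) (3 * n) (fun x => cutoff n x * D s t x) =
    - intg (- (3 * n)) (3 * n) (fun x => dcutoff n x * U s t x).
  have := (AC_M UA etaA).2 (3 * n); rewrite lexx (ltW LL) => /(_ isT).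
  rewrite !eta0 ?lexx ?ltxx ?andbF// !mulr0 add0r => /esym E.
  apply/eqP; rewrite -subr_eq0 opprK -intgD//; apply/eqP; rewrite -[RHS]E.
  by apply: eq_intg => x _; ring.
have fl := flux_weak s0 st LL Ceta.
have E1 : intg (- (3 * n)) (3 * n) (fun x => cutoff n x * (nu x * u (t, x))) =
    intg (- (3 * n)) (3 * n) (fun x => cutoff n x * (nu x * u (s, x))) +
    intg (- (3 * n)) (3 * n) (fun x => W * (dcutoff n x * U s t x) - b x * (dcutoff n x * D s t x)).
  rewrite intgB//; last exact: itg_itvZ.
  rewrite intgZ//.
  have : intg (- (3 * n)) (3 * n) (fun x => b x * (dcutoff n x * D s t x) +
      (cutoff n x * (nu x * u (t, x)) - cutoff n x * (nu x * u (s, x)) +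
       W * (cutoff n x * D s t x))) = 0.
    by rewrite -[RHS]fl; apply: eq_intg => x _; ring.
  rewrite intgD//; last by apply: itg_itvD; [apply: itg_itvB; exact: Mi|exact: itg_itvZ].
  rewrite intgD//; [|by apply: itg_itvB; exact: Mi|exact: itg_itvZ].
  rewrite intgB; [|exact: Mi|exact: Mi].
  rewrite intgZ// ibp; set X := intg _ _ _; set Y := intg _ _ _; set Z := intg _ _ _.
  set V := intg _ _ _ => H; lra.
have E2 : intg (- (3 * n)) (3 * n) (fun x => W * (dcutoff n x * U s t x) - b x * (dcutoff n x * D s t x)) <= e.
  have [i2 l2] := UD2 (- (3 * n)) (3 * n).
  apply: (@le_trans _ _ (intg (- (3 * n)) (3 * n)
     (fun x => C / n * (k * (U s t x ^+ 2 + D s t x ^+ 2) + k^-1)))).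
    apply: intg_le.
    - by apply: itg_itvB => //; exact: itg_itvZ.
    - by apply: itg_itvZ; apply: itg_itvD; [exact: itg_itvZ|exact: itg_cst].
    move=> x _; have dn := dcutoff_le x n0.
    have h1 : W * (dcutoff n x * U s t x) <=
      `|W| * (n^-1 * (k * (U s t x ^+ 2 + D s t x ^+ 2) + k^-1)).
      apply: le_trans (ler_norm _) _; rewrite !normrM ler_wpM2l//; apply: ler_pM => //.
      apply: le_trans (AMGM _ k0) _; rewrite lerD2r ler_wpM2l ?(ltW k0)// lerDl sqr_ge0//.
    have h2 : - (b x * (dcutoff n x * D s t x)) <=
      mu ^+ 2 * (n^-1 * (k * (U s t x ^+ 2 + D s t x ^+ 2) + k^-1)).
      apply: le_trans (ler_norm _) _; rewrite normrN normrM; apply: ler_pM => //.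
      rewrite normrM; apply: ler_pM => //.
      apply: le_trans (AMGM _ k0) _; rewrite lerD2r ler_wpM2l ?(ltW k0)// lerDr sqr_ge0//.
    apply: le_trans (lerD h1 h2) _.
    by rewrite le_eqVlt; apply/orP; left; apply/eqP; rewrite /C; ring.
  rewrite intgZ; last by apply: itg_itvD; [exact: itg_itvZ|exact: itg_cst].
  rewrite intgD; [|exact: itg_itvZ|exact: itg_cst].
  rewrite intgZ// intg_cst; last exact: ltW.
  have e2 : C / n * (k * Q) <= e / 2.
    have -> : C / n * (k * Q) = (2 * C * k * Q / e) * (e / (2 * n)) by field; rewrite !gt_eqF.
    have -> : e / 2 = n * (e / (2 * n)) by field; rewrite gt_eqF.
    by rewrite ler_wpM2r// divr_ge0 ?(ltW e0)// mulr_ge0// ltW.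
  have e3 : C / n * (k^-1 * (3 * n - - (3 * n))) = e / 2.
    by rewrite /k; field; rewrite !gt_eqF.
  have e4 : C / n * (k * intg (- (3 * n)) (3 * n) (fun x => U s t x ^+ 2 + D s t x ^+ 2)) <=
    C / n * (k * Q).
    by rewrite ler_wpM2l ?divr_ge0 ?(ltW n0) ?(ltW C0)// ler_wpM2l// ltW.
  by rewrite mulrDr e3; lra.
apply: (@le_trans _ _ (intg (- (3 * n)) (3 * n) (fun x => cutoff n x * (nu x * u (t, x))))).
  have -> : intg (- L) L (fun x => nu x * u (t, x)) =
      intg (- L) L (fun x => cutoff n x * (nu x * u (t, x))).
    apply: eq_intg => x xL; rewrite cutoff_eq1 ?mul1r//.
    by rewrite ler_norml; lra.
  apply: intg_sub; [lra|lra|lra|exact: Mi|].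
  by move=> x _; rewrite mulr_ge0 ?cutoff_ge0 ?nuu_ge0.
rewrite E1 lerD//; apply: le_trans (intg_le_mass (- (3 * n)) (3 * n) s0).
apply: intg_le; [exact: Mi|exact: mass_itv|].
by move=> x _; rewrite ler_piMl ?nuu_ge0 ?cutoff_le1.
Qed.

(** The initial datum tested with the constant 1 makes the mass at time [s] tend to 1 as [s] tends
    to 0, and the mass at [t] does not exceed it. *)
Let mass_le1 t L : 0 < t -> 0 < L -> intg (- L) L (fun x => nu x * u (t, x)) <= 1.
Proof.
move=> t0 L0; apply/ler_addgt0Pl => e e0.
have [_ /(_ (cst 1))] := u_init.
have c1 : continuous (cst 1 : R -> R) by exact: cst_continuous.
have b1 : exists M : R, forall x, `|cst 1 x : R| <= M by exists 1 => x; rewrite normr1.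
move=> /(_ c1 b1) /cvgrPdist_lt/(_ _ e0) near1.
near (0:R)^'+ => s.
have s0 : 0 < s by near: s; exact: nbhs_right_gt.
have st : s < t by near: s; exact: nbhs_right_lt.
apply: le_trans (mass_mono s0 st L0) _.
have : `|cst 1 y - \int[leb]_(x in [set: R]) (nu x * u (s, x) * cst 1 x)| < e by near: s.
rewrite /=; have -> : \int[leb]_(x in [set: R]) (nu x * u (s, x) * 1) = mass s.
  by apply: eq_Rintegral => x _; rewrite mulr1.
by rewrite ltr_norml; lra.
Unshelve. all: by end_near. Qed.

Let U_derive h r x : 0 < h -> 0 < r ->
  is_derive r 1 (fun s => U s (s + h) x) (u (r + h, x) - u (r, x)).
Proof.
move=> h0 r0; pose c := r / 2; pose T := r + h + 1.
have c0 : 0 < c by rewrite divr_gt0.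
have ci : itg c T (fun s => u (s, x)).
  apply: itg_continuous; apply: continuous_in_subspaceT => s /set_mem/=.
  rewrite in_itv/= => /andP[cs _]; apply: continuous_upper_t u_cont.
  exact: lt_le_trans cs.
(* Both ends of the window move with [s]; its integral is a difference of two values of one
   primitive with base point below [r]. *)
pose F s := intg c s (fun q => u (q, x)).
have dF s : c < s -> s < T -> is_derive s 1 F (u (s, x)).
  move=> cs sT; have s0 : 0 < s by exact: lt_trans cs.
  have cont : {for s, continuous (fun q => u (q, x))} by exact: continuous_upper_t u_cont.
  have [h1 h2] := continuous_FTC1_closed sT ci cs cont.
  by rewrite -h2 derive1E; exact: derivableP.
have d1 : is_derive r 1 (fun s => F (s + h)) (u (r + h, x)).
  have := @is_derive1_comp _ F (shift h) r _ _ (dF (r + h) _ _) (is_derive_shift r 1 h).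
  by rewrite mulr1; apply; rewrite /c /T; lra.
have d2 : is_derive r 1 F (u (r, x)) by apply: dF; rewrite /c /T; lra.
apply: near_eq_is_derive (is_deriveB d1 d2).
near=> s.
have cs : c < s by near: s; apply: lt_nbhsr; rewrite /c; lra.
have sT : s < r + 1 by near: s; apply: lt_nbhsl; lra.
have shT : s + h <= T by rewrite /T; lra.
have ci' : itg c (s + h) (fun q => u (q, x)) := itg_sub (lexx c) shT ci.
have ssh : s <= s + h by rewrite lerDl ltW.
suff : F (s + h) - F s = U s (s + h) x by [].
by rewrite /F (intg_split (ltW cs) ssh ci') addrAC subrr add0r.
Unshelve. all: by end_near. Qed.

Let U_le h t x : 0 < h -> 0 < t -> U t (t + h) x <= 5 * mu ^+ 2 * h / Num.sqrt t.
Proof.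
move=> h0; move: t x.
apply: (@nash_bound R mu W nu b (fun r x => U r (r + h) x)
  (fun r x => u (r + h, x) - u (r, x)) (fun r x => D r (r + h) x) h) => //.
- move=> r x r0; apply: intg_ge0 => s /andP[rs _]; apply: u_ge0.
  exact: lt_le_trans rs.
- by move=> r x r0; exact: U_derive.
- move=> s T L s0.
  have [M M0 hM] := continuous_rect_bounded (T + h) (- L) L s0 u_cont.
  exists (M * h + 2 * M) => r x /andP[sr rT] xL; split.
    have rh : r <= r + h by rewrite lerDl ltW.
    have r0 : 0 < r by exact: lt_le_trans sr.
    have ii : itg r (r + h) (fun q => u (q, x)).
      apply: (itg_bounded (M := M)); first exact: meas_t.
      move=> q /andP[rq qrh]; apply: hM => //; apply/andP; split; lra.
    apply: le_trans (intg_norm ii) _.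
    apply: (@le_trans _ _ (intg r (r + h) (cst M))).
      apply: intg_le; [exact: itg_abs_itv|exact: itg_cst|].
      move=> q /andP[rq qrh]; apply: hM => //; apply/andP; split; lra.
    by rewrite intg_cst// [r + h]addrC addrK lerDl mulr_ge0.
  apply: le_trans (ler_normB _ _) _.
  have h1 : `|u (r + h, x)| <= M by apply: hM => //; apply/andP; split; lra.
  have h2 : `|u (r, x)| <= M by apply: hM => //; apply/andP; split; lra.
  have h3 : 0 <= M * h by rewrite mulr_ge0// ltW.
  lra.
- move=> r r0; apply: measurable_funB; apply: meas_x => //.
  exact: addr_gt0.
- by move=> r L r0 L0; apply: U_AC => //; [rewrite ltrDl|lra].
- by move=> r L r0 L0; apply: flux => //; rewrite ltrDl.
- move=> s T s0; exists (h * \int[leb2]_(z in `[s, T + h]%classic `*` setT) (u z ^+ 2) +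
    h * \int[leb2]_(z in `[s, T + h]%classic `*` setT) (ux z ^+ 2)).
  move=> r L /andP[sr rT] L0.
  have rh : r < r + h by rewrite ltrDl.
  have rTh : r + h <= T + h by rewrite lerD2r.
  have hh : r + h - r = h by rewrite addrAC subrr add0r.
  have [i1 l1] := L2_average (- L) L uL s0 sr rh rTh.
  have [i2 l2] := L2_average (- L) L uxL s0 sr rh rTh.
  rewrite hh in l1 l2.
  by split => //; rewrite intgD// lerD.
- move=> r L r0 L0.
  have rh : r <= r + h by rewrite lerDl ltW.
  have ui := L2_rect (r + h) (- L) L r0 uL.
  have k1i := itg_rect_snd ui mnu nu_bound.
  have [it _ E1 _ _] := fubini_rect k1i.
  have E2 := fubini_rect_swap k1i.
  have -> : intg (- L) L (fun x => nu x * U r (r + h) x) =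
      intg r (r + h) (fun q => intg (- L) L (fun x => u (q, x) * nu x)).
    rewrite E2; apply: eq_intg => x _; rewrite /U -intgZ; last first.
      have [M _ hM] := continuous_rect_bounded (r + h) x x r0 u_cont.
      apply: (itg_bounded (M := M)); first exact: meas_t.
      by move=> q qr; apply: hM; rewrite ?lexx.
    by apply: eq_intg => q _; rewrite mulrC.
  apply: (@le_trans _ _ (intg r (r + h) (cst 1))); last first.
    by rewrite intg_cst// mul1r addrAC subrr add0r.
  apply: intg_le => //; first exact: itg_cst.
  move=> q /andP[rq _]; have q0 : 0 < q by exact: lt_le_trans rq.
  rewrite (@eq_intg _ _ _ _ (fun x => nu x * u (q, x))); first exact: mass_le1.
  by move=> x _; rewrite mulrC.
Qed.

Lemma heat_kernel_bound t x : 0 < t -> u (t, x) <= 5 * mu ^+ 2 / Num.sqrt t.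
Proof.
move=> t0; set K := _ / _; rewrite leNgt; apply/negP => Ku.
have e0 : 0 < (u (t, x) - K) / 2 by rewrite divr_gt0// subr_gt0.
have [M _ hM] := continuous_rect_bounded (t + 1) x x t0 u_cont.
have wc : {within `[t, t + 1], continuous (fun s => u (s, x))}.
  apply: continuous_in_subspaceT => s /set_mem/=; rewrite in_itv/= => /andP[ts _].
  by apply: continuous_upper_t u_cont; exact: lt_le_trans ts.
have tt : t <= t <= t + 1 by rewrite lexx lerDl ler01.
have [d d0 hd] := within_continuous_dist wc tt e0.
pose h := Num.min d 1 / 2.
have h0 : 0 < h by rewrite divr_gt0// lt_min d0 ltr01.
have hd' : h < d by have : Num.min d 1 <= d by [rewrite ge_min lexx]; rewrite /h; lra.
have h1 : h < 1 by have : Num.min d 1 <= 1 by [rewrite ge_min lexx orbT]; rewrite /h; lra.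
have := U_le x h0 t0; rewrite leNgt => /negP; apply.
have -> : 5 * mu ^+ 2 * h / Num.sqrt t = K * h by rewrite /K; ring.
(* If [u] exceeded [K] at [(t, x)], it would stay above this midpoint during a short window, whose
   integral would contradict [U_le]. *)
pose K1 := (K + u (t, x)) / 2.
have KK1 : K < K1 by rewrite /K1; lra.
apply: (@lt_le_trans _ _ (K1 * h)); first by rewrite ltr_pM2r.
have -> : K1 * h = intg t (t + h) (cst K1).
  by rewrite intg_cst ?lerDl ?(ltW h0)// [t + h]addrC addrK.
apply: intg_le; first exact: itg_cst.
  apply: (itg_bounded (M := M)); first exact: meas_t.
  by move=> q /andP[q1 q2]; apply: hM; rewrite ?lexx//; apply/andP; split; lra.
move=> q /andP[q1 q2]; have qt : t <= q <= t + 1 by apply/andP; split; lra.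
have : `|u (t, x) - u (q, x)| < (u (t, x) - K) / 2.
  by apply: hd => //; rewrite ltr_norml; lra.
by rewrite ltr_norml /K1 /=; lra.
Qed.

End HeatKernelBound.

(** * Fundamental solutions *)

Section FundamentalSolution.
Context {R : realType}.
Local Notation leb := (@lebesgue_measure R).
Implicit Types (mu W : R) (nu a : R -> R).

Lemma one_le_of_ae_bounds mu nu : 0 < mu ->
  {ae leb, forall x, mu^-1 <= nu x <= mu} -> 1 <= mu.
Proof.
move=> mu0 nuP; have [x _ /andP[h1 h2]] := ae_exists ltr01 nuP.
rewrite leNgt; apply/negP => mu1.
have : 1 < mu^-1 by rewrite invf_gt1.
by have := le_trans h1 h2; lra.
Qed.

Lemma clamp_bounds mu nu : 1 <= mu -> measurable_fun [set: R] nu ->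
  {ae leb, forall x, mu^-1 <= nu x <= mu} ->
  exists nu', [/\ measurable_fun [set: R] nu', forall x, mu^-1 <= nu' x <= mu &
    {ae leb, forall x, nu x = nu' x}].
Proof.
move=> mu1 mnu nuP; have mu0 : 0 < mu by exact: lt_le_trans mu1.
exists (fun x => Num.max mu^-1 (Num.min (nu x) mu)); split.
- apply: measurable_maxr => //; exact: measurable_minr.
- move=> x; rewrite le_max lexx/= ge_max ge_min lexx orbT andbT.
  by apply: (@le_trans _ _ 1) => //; rewrite invf_le1.
- by apply: aeS nuP => x /andP[h1 h2]; rewrite min_l// max_r.
Qed.

Lemma fundamental_solution_bound mu W nu a (P : R -> R -> R -> R) : 0 < mu ->
  measurable_fun [set: R] nu -> measurable_fun [set: R] a ->
  {ae leb, forall x, mu^-1 <= nu x <= mu} ->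
  {ae leb, forall x, mu^-1 <= a x <= mu} ->
  fundamental_solution W nu a P ->
  forall t x y, 0 < t -> 0 <= P t x y <= 5 * mu ^+ 2 / Num.sqrt t.
Proof.
move=> mu0 mnu ma nuP aP fundP t x y t0.
have mu1 := one_le_of_ae_bounds mu0 nuP.
have [nu' [mnu' nu'P nuE]] := clamp_bounds mu1 mnu nuP.
have [a' [ma' a'P aE]] := clamp_bounds mu1 ma aP.
have [cu u0 [ux [uL uxL wx weak]] [ii ic]] := fundP y.
apply/andP; split; first exact: (u0 (t, x)).
have E : {ae leb, forall x, nu x = nu' x /\ a x = a' x} by apply: aeS2 nuE aE.
have mut s : 0 < s -> measurable_fun [set: R] (fun x => P s x y).
  by move=> s0; apply: continuous_measurable_fun; exact: continuous_upper_x cu.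
apply: (@heat_kernel_bound _ mu W y nu' a' (fun z => P z.1 z.2 y) ux) => //.
- move=> s' t' c d chi dchi eta deta s'0 Cchi Ceta.
  rewrite -(weak_integral_ae W mnu mnu' ma ma' E uL uxL s'0 Cchi Ceta).
  exact: weak_solution_rect weak s'0 Cchi Ceta.
split.
- move=> s s0; have mus := mut s s0.
  apply: (itg_ae_eq _ _ _ (ii s s0)) => //.
  - exact: measurable_funM.
  - by apply: aeS nuE => z ->.
(* The integrals with [nu] and with its clamped version agree at every positive time, hence have the
   same limit at 0. *)
- move=> f cf fb; have := ic f cf fb; apply: cvg_trans; apply: near_eq_cvg.
  near=> s; have s0 : 0 < s by near: s; exact: nbhs_right_gt.
  have mus := mut s s0; have mf := continuous_measurable_fun cf.
  apply: ae_eq_Rintegral => //.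
  - by apply: measurable_funM => //; exact: measurable_funM.
  - by apply: measurable_funM => //; exact: measurable_funM.
  - by apply: aeS nuE => z ->.
Unshelve. all: by end_near. Qed.

End FundamentalSolution.
Theorem proposition1p4 (R : realType) (mu : R) (hmu : 0 < mu) :
  exists2 C : R, 0 < C &
    forall (W : R) (nu a : R -> R),
      measurable_fun [set: R] nu -> measurable_fun [set: R] a ->
      {ae (@lebesgue_measure R), forall x, mu^-1 <= nu x <= mu} ->
      {ae (@lebesgue_measure R), forall x, mu^-1 <= a x <= mu} ->
    forall P : R -> R -> R -> R, fundamental_solution W nu a P ->
    forall p q : R -> R -> R, solution_of P nu p -> solution_of P nu q ->
      (@lebesgue_measure R).-integrable [set: R] (EFin \o (p 0 \- q 0)) ->
    forall t : R, 0 < t ->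
      ('N[@lebesgue_measure R]_+oo[EFin \o (p t \- q t)%R] <=
       (C / Num.sqrt t)%:E *
         'N[@lebesgue_measure R]_1[EFin \o (p 0%R \- q 0%R)%R])%E.
Proof.
(* [5 * mu ^+ 2] comes from the kernel, the third factor [mu] from the weight [nu] in the
   representation formula. *)
exists (5 * mu ^+ 3) => [|W nu a mnu ma nuP aP P fundP p q pP qP pqi t t0].
  by rewrite mulr_gt0// exprn_gt0.
have Pbound := fundamental_solution_bound hmu mnu ma nuP aP fundP.
have sq0 : 0 < Num.sqrt t by rewrite sqrtr_gt0.
pose f0 y := p 0 y - q 0 y.
have pqi' : (@lebesgue_measure R).-integrable [set: R] (EFin \o f0) by exact: pqi.
have f0i : (@lebesgue_measure R).-integrable [set: R] (EFin \o (fun y => `|f0 y|)).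
  exact: itg_abs.
have key x : `|p t x - q t x| <=
    5 * mu ^+ 3 / Num.sqrt t * \int[@lebesgue_measure R]_(y in [set: R]) `|f0 y|.
  (* Each kernel integral converges absolutely on its own, so they may be subtracted although [p 0]
     and [q 0] need not be integrable separately. *)
  have [pi ->] := pP t x t0; have [qi ->] := qP t x t0.
  rewrite -RintegralB//.
  have fi : (@lebesgue_measure R).-integrable [set: R]
      (EFin \o (fun y => P t x y * nu y * p 0 y - P t x y * nu y * q 0 y)).
    exact: itgB.
  apply: le_trans (le_normr_Rintegral _ fi) _ => //.
  rewrite -RintegralZl//; apply: ae_le_Rintegral => //.
  - exact: itg_abs.
  - exact: itgZ.
  apply: aeS nuP => y /andP[nu1 nu2] _.
  have /andP[P0 PK] := Pbound t x y t0.
  have nu0 : 0 <= nu y by apply: le_trans nu1; rewrite invr_ge0 ltW.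
  rewrite -mulrBr normrM ler_wpM2r// ger0_norm ?mulr_ge0//.
  have -> : 5 * mu ^+ 3 / Num.sqrt t = 5 * mu ^+ 2 / Num.sqrt t * mu by ring.
  exact: ler_pM.
rewrite Lnorm1.
have -> : (\int[@lebesgue_measure R]_x `|(EFin \o (p 0%R \- q 0%R)%R) x|)%E =
    (\int[@lebesgue_measure R]_(y in [set: R]) `|f0 y|)%R%:E.
  by rewrite /Rintegral fineK//; exact: integrable_fin_num f0i.
(* The infinity norm is an essential supremum if the whole space has positive measure and 0
   otherwise; both branches satisfy the bound. *)
rewrite -EFinM unlock /Lnorm; case: ifPn => [_|_].
  by apply/ess_supP; apply: aeW => x; rewrite /= lee_fin; exact: key.
by rewrite lee_fin mulr_ge0 ?Rintegral_ge0// divr_ge0 ?(ltW sq0)// mulr_ge0// exprn_ge0// ltW.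
Qed.
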